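(* Let $d\in\mathbb N$ and consider the time-reversed dead leaves random measure $\xi$ on $\mathbb R^d$ defined in the context. Assume $\mathbb Q'$ is such that $\mathbb E[|M|]<\infty$, and also $\mathbb E[\mathcal H_d(S\oplus B(1))]<\infty$. Then $\xi$ is a stationary random measure and its intensity, denoted $\alpha$, is given by $$\alpha=\lambda^{-1}\,\mathbb E[|M|].$$
   Context: Notation: $\mathcal H_d$ is Lebesgue measure on $\mathbb R^d$; $A+x:=\{a+x:a\in A\}$; $A\oplus B:=\{a+b:a\in A,b\in B\}$; $B(r)$ is the closed Euclidean ball of radius $r$ centred on the origin. $\mathbf M$ is the space of locally finite Borel measures on $\mathbb R^d$, with the smallest $\sigma$-algebra making all maps $\mu\mapsto\mu(A)$ ($A$ Borel) measurable; $|\mu|:=\mu(\mathbb R^d)$; $(\mu+x)(A):=\mu(A+(-x))$. A random measure is a random element of $\mathbf M$. It is stationary if its distribution is shift invariant; its intensity is then the constant $\gamma$ such that the expected measure of every Borel $B$ is $\gamma\mathcal H_d(B)$. Dead leaves random measure: Let $\mathcal C$ be the space of compact subsets of $\mathbb R^d$, with the $\sigma$-algebra generated by the Fell topology (generated by all sets $\{F\in\mathcal C:F\cap G\ne\emptyset\}$ with $G$ open and $\{F\in\mathcal C:F\cap K=\emptyset\}$ with $K$ compact). Let $\mathbb Q'$ be a probability measure on $\mathcal C\times\mathbf M$ whose first marginal $\mathbb Q$ assigns strictly positive measure to the collection of sets having non-empty interior. $(S,M)$ denotes a random element of $\mathcal C\times\mathbf M$ with distribution $\mathbb Q'$; $\lambda:=\mathbb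 E[\mathcal H_d(S)]$. Let $\sum_{i=1}^\infty\delta_{(x_i,t_i)}$ be a homogeneous Poisson process of unit intensity in $\mathbb R^d\times\mathbb R$ and, independently of it, let $(S_i,M_i)_{i\ge1}$ be independent random elements of $\mathcal C\times\mathbf M$ with distribution $\mathbb Q'$. The time-reversed dead leaves random measure is $$\xi:=\sum_{\{i:t_i\ge0\}}(M_i+x_i)\Big(\cdot\cap\mathbb R^d\setminus\bigcup_{\{j:0\le t_j<t_i\}}(S_j+x_j)\Big).$$ *)

(* Defs.v *)
From HB Require Import structures.
From mathcomp Require Import all_boot all_order all_algebra.
From mathcomp Require Import all_classical all_reals all_analysis.
From mathcomp Require Import measurable_realfun.

Set Implicit Arguments.
Unset Strict Implicit.
Unset Printing Implicit Defensive.

Import Order.TTheory GRing.Theory Num.Theory.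
Import numFieldNormedType.Exports.

Local Open Scope classical_set_scope.
Local Open Scope ring_scope.

(* The space R^d is 'rV[R]_d. Its library topology comes from the sup norm and
   is the Euclidean one; matrices get the corresponding Borel sigma-algebra. *)

Definition mx_display : measure_display.
Proof. by constructor. Qed.

Section borel_matrix.
Context (R : realType) (m n : nat).

Definition mx_borel : set (set 'M[R]_(m, n)) := <<s @open 'M[R]_(m, n) >>.

Let mx_borel0 : mx_borel set0.
Proof. exact: sigma_algebra0. Qed.

Let mx_borelC (A : set 'M[R]_(m, n)) : mx_borel A -> mx_borel (~` A).
Proof. exact: sigma_algebraC. Qed.

Let mx_borelU (F : (set 'M[R]_(m, n))^nat) :
  (forall i, mx_borel (F i)) -> mx_borel (\bigcup_i F i).
Proof. exact: sigma_algebra_bigcup. Qed.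

HB.instance Definition _ :=
  @isMeasurable.Build mx_display 'M[R]_(m, n) mx_borel
    mx_borel0 mx_borelC mx_borelU.

Lemma open_measurable_mx (U : set 'M[R]_(m, n)) : open U -> measurable U.
Proof. exact: sub_sigma_algebra. Qed.

Lemma mx_ball_coordE (x : 'M[R]_(m, n)) (e : R) : 0 < e ->
  ball x e = [set y | forall i j, ball (x i j) e (y i j)].
Proof.
move=> e0; apply/seteqP; split => y.
  by rewrite /ball/= => -[].
by move=> H; split.
Qed.

Lemma open_mx_bigcup_ball (U : set 'M[R]_(m, n)) : open U ->
  U = \bigcup_(p in [set p : 'M[rat]_(m, n) * nat |
        ball (map_mx ratr p.1 : 'M[R]_(m, n)) p.2.+1%:R^-1 `<=` U])
      ball (map_mx ratr p.1 : 'M[R]_(m, n)) p.2.+1%:R^-1.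
Proof.
move=> oU; apply/seteqP; split => [x Ux|x [p pU xp]]; last exact: pU.
have /nbhs_ballP[e /= e0 xeU] : nbhs x U by exact: open_nbhs_nbhs.
have [k ke] : exists k : nat, k.+1%:R^-1 < e / 2.
  by near \oo => k; exists k; near: k; exact: near_infty_natSinv_lt (PosNum (divr_gt0 e0 _)).
have k0 : 0 < k.+1%:R^-1 :> R by rewrite invr_gt0.
have Hq i j : exists q : rat, ball (ratr q : R) k.+1%:R^-1 (x i j).
  have : x i j - k.+1%:R^-1 < x i j + k.+1%:R^-1.
    by rewrite ltrBlDr -addrA ltrDl addr_gt0.
  move=> /rat_in_itvoo[q]; rewrite in_itv/= => q12.
  by exists q; rewrite /ball/= ltr_distl.
pose q := \matrix_(i, j) sval (cid (Hq i j)) : 'M[rat]_(m, n).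
have xq : ball (map_mx ratr q : 'M[R]_(m, n)) k.+1%:R^-1 x.
  by rewrite mx_ball_coordE// => i j; rewrite !mxE; case: cid.
exists (q, k) => //= y qy; apply: xeU.
apply: (@le_ball _ _ _ (k.+1%:R^-1 + k.+1%:R^-1)).
  by rewrite [leRHS](splitr e) lerD// ltW.
by apply: ball_triangle qy; exact: ball_sym.
Unshelve. all: end_near. Qed.

Lemma measurable_mx_coord i j :
  measurable_fun setT (fun A : 'M[R]_(m, n) => A i j).
Proof.
apply: (measurability _ (RGenOpens.measurableE R)) => _ [_ [a [b ->]] <-].
rewrite setTI; apply: open_measurable_mx.
apply: open_comp; last exact: interval_open.
by move=> A _; exact: coord_continuous.
Qed.

Lemma measurable_mxP d (T : measurableType d) (f : T -> 'M[R]_(m, n)) :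
  (forall i j, measurable_fun setT (fun t => f t i j)) -> measurable_fun setT f.
Proof.
move=> mf; apply: (@measurability _ _ _ _ setT f open) => // _ [U oU <-].
rewrite setTI (open_mx_bigcup_ball oU) preimage_bigcup bigcup_mkcond.
apply: countable_bigcupT_measurable; first exact: countableP.
move=> p; case: ifPn => // _.
have -> : f @^-1` ball (map_mx ratr p.1 : 'M[R]_(m, n)) p.2.+1%:R^-1 =
    \bigcap_(ij in [set: 'I_m * 'I_n])
      ((fun t => f t ij.1 ij.2) @^-1`
        ball ((map_mx ratr p.1 : 'M[R]_(m, n)) ij.1 ij.2) p.2.+1%:R^-1).
  rewrite /preimage mx_ball_coordE ?invr_gt0//.
  apply/seteqP; split => [t/= H ij _|t/= H i j]; first exact: H.
  exact: (H (i, j)).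
apply: fin_bigcap_measurable => // ij _.
rewrite -[X in measurable X]setTI; apply: mf => //.
by apply: open_measurable; exact: ball_open.
Qed.

End borel_matrix.

Section lebesgue_rV.
Context (R : realType).

Definition rV_cons d (p : 'rV[R]_d * R) : 'rV[R]_d.+1 :=
  row_mx (p.2%:M : 'rV_1) p.1.

Lemma measurable_rV_cons d : measurable_fun setT (@rV_cons d).
Proof.
apply: measurable_mxP => i j; rewrite ord1.
case: (@split_ordP 1 d j) => k ->.
- rewrite [X in measurable_fun _ X](_ : _ = snd)//.
  apply/funext => p; apply: (etrans (row_mxEl _ _ _ _)).
  by rewrite !ord1 mxE eqxx mulr1n.
- rewrite [X in measurable_fun _ X](_ : _ = (fun v : 'rV[R]_d => v 0 k) \o fst).
    by apply: measurableT_comp => //; exact: measurable_mx_coord.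
  by apply/funext => p; exact: row_mxEr.
Qed.

Section step.
Context d (mu : {measure set 'rV[R]_d -> \bar R}).

Definition lebesgue_step : set 'rV[R]_d.+1 -> \bar R :=
  pushforward (mu \x (@lebesgue_measure R))%E (@rV_cons d).

Let lebesgue_step0 : lebesgue_step set0 = 0%E.
Proof. by rewrite /lebesgue_step /pushforward preimage_set0 measure0. Qed.

Let lebesgue_step_ge0 A : (0 <= lebesgue_step A)%E.
Proof. by rewrite /lebesgue_step /pushforward integral_ge0. Qed.

Let lebesgue_step_sigma_additive : semi_sigma_additive lebesgue_step.
Proof.
apply: (@measure_semi_sigma_additive _ _ _
  (pushforward (mu \x (@lebesgue_measure R))%E (@rV_cons d))).
exact: measurable_rV_cons.
Qed.

HB.instance Definition _ := isMeasure.Build _ _ _ lebesgue_step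
  lebesgue_step0 lebesgue_step_ge0 lebesgue_step_sigma_additive.

End step.

Fixpoint lebesgue_rV d : {measure set 'rV[R]_d -> \bar R} :=
  if d is d'.+1 then lebesgue_step (lebesgue_rV d')
  else \d_(0 : 'rV[R]_0).


Lemma lebesgue_rV_box d (A : 'I_d -> set R) :
  (forall i, measurable (A i)) ->
  lebesgue_rV d [set v | forall i, A i (v 0 i)] =
  (\prod_(i < d) lebesgue_measure (A i))%E.
Proof.
elim: d A => [|d IH] A mA.
  by rewrite /= big_ord0 diracE mem_set//= => -[].
have mcoord (k : 'I_d) : measurable_fun setT (fun v : 'rV[R]_d => v 0 k).
  exact: measurable_mx_coord.
have mbox : measurable [set v : 'rV[R]_d | forall i, A (lift ord0 i) (v 0 i)].
  rewrite (_ : mkset _ = \bigcap_(i in [set: 'I_d])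
      ((fun v : 'rV[R]_d => v 0 i) @^-1` A (lift ord0 i))).
    apply: fin_bigcap_measurable => // i _.
    by rewrite -[X in measurable X]setTI; exact: mcoord.
  by apply/seteqP; split => [v/= H i _|v/= H i]; exact: H.
rewrite big_ord_recl muleC -IH//= -product_measure1E//; last exact: mA.
rewrite /lebesgue_step /pushforward; congr product_measure1.
have E0 (p : 'rV[R]_d * R) : rV_cons p 0 ord0 = p.2.
  rewrite (_ : ord0 = lshift d (@ord0 0)); last exact: val_inj.
  by apply: (etrans (row_mxEl _ _ _ _)); rewrite mxE eqxx mulr1n.
have EL (p : 'rV[R]_d * R) k : rV_cons p 0 (lift ord0 k) = p.1 0 k.
  rewrite (_ : lift ord0 k = rshift 1 k); last exact: val_inj.
  exact: row_mxEr.
apply/seteqP; split => [p/= H|p/= [H1 H2] i].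
  by split => [i|]; [rewrite -EL; exact: H|rewrite -E0; exact: H].
by case: (unliftP ord0 i) => [k|] ->; rewrite ?EL ?E0.
Qed.

End lebesgue_rV.

Section translation.
Context (R : realType) (d : nat).
Implicit Types (A B : set 'rV[R]_d) (x : 'rV[R]_d).

Definition translate A x : set 'rV[R]_d := [set a + x | a in A].

Definition minkowski_sum A B : set 'rV[R]_d := [set a + b | a in A & b in B].

Definition euclidean_ball (r : R) : set 'rV[R]_d :=
  [set x | Num.sqrt (\sum_i x 0 i ^+ 2) <= r].

Lemma translateE A x : translate A x = (fun a => a - x) @^-1` A.
Proof.
apply/seteqP; split => [_ [a Aa <-]|a/= Aa]; first by rewrite /= addrK.
by exists (a - x) => //; rewrite subrK.
Qed.

Lemma measurable_addl x : measurable_fun setT (fun a : 'rV[R]_d => a + x).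
Proof.
apply: measurable_mxP => i j.
under eq_fun do rewrite mxE.
by apply: measurable_funD => //; exact: measurable_mx_coord.
Qed.

Lemma measurable_translate A x : measurable A -> measurable (translate A x).
Proof.
by move=> mA; rewrite translateE -[X in measurable X]setTI; exact: measurable_addl.
Qed.

End translation.

(* Two elements of lfmeasure may differ on non-Borel sets, where a library
   measure takes arbitrary values. The sigma-algebra below and all the notions
   that follow only depend on the values on Borel sets. *)

Section locally_finite_measures.
Context (R : realType) (d : nat).

Record lfmeasure := LFMeasure {
  lfm_measure :> {measure set 'rV[R]_d -> \bar R};
  lfm_finite : forall B : set 'rV[R]_d,
    measurable B -> bounded_set B -> (lfm_measure B < +oo)%E }.

Lemma mzero_lf (B : set 'rV[R]_d) : measurable B -> bounded_set B ->
  ((@mzero _ 'rV[R]_d R : {measure set 'rV[R]_d -> \bar R}) B < +oo)%E.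
Proof. by move=> _ _; rewrite ltry. Qed.

HB.instance Definition _ := gen_eqMixin lfmeasure.
HB.instance Definition _ := gen_choiceMixin lfmeasure.
HB.instance Definition _ := isPointed.Build lfmeasure (LFMeasure mzero_lf).

Definition lfm_measurable : set (set lfmeasure) :=
  <<s \bigcup_(A in @measurable _ 'rV[R]_d)
        preimage_set_system setT (fun mu : lfmeasure => mu A) measurable >>.

Let lfm_measurable0 : lfm_measurable set0.
Proof. exact: sigma_algebra0. Qed.

Let lfm_measurableC (U : set lfmeasure) :
  lfm_measurable U -> lfm_measurable (~` U).
Proof. exact: sigma_algebraC. Qed.

Let lfm_measurableU (F : (set lfmeasure)^nat) :
  (forall i, lfm_measurable (F i)) -> lfm_measurable (\bigcup_i F i).
Proof. exact: sigma_algebra_bigcup. Qed.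

Definition lfm_display : measure_display.
Proof. by constructor. Qed.

HB.instance Definition _ :=
  @isMeasurable.Build lfm_display lfmeasure lfm_measurable
    lfm_measurable0 lfm_measurableC lfm_measurableU.

Section shift.
Context (mu : lfmeasure) (x : 'rV[R]_d).

Definition shift_measure (A : set 'rV[R]_d) : \bar R :=
  mu (translate A (- x)).

Lemma shift_measureE :
  shift_measure = pushforward mu (fun a : 'rV[R]_d => a + x).
Proof.
by apply/funext => A; rewrite /shift_measure translateE opprK.
Qed.

Let shift_measure0 : shift_measure set0 = 0%E.
Proof. by rewrite /shift_measure translateE preimage_set0 measure0. Qed.

Let shift_measure_ge0 A : (0 <= shift_measure A)%E.
Proof. exact: measure_ge0. Qed.

Let shift_measure_sigma_additive : semi_sigma_additive shift_measure.
Proof.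
rewrite shift_measureE; apply: measure_semi_sigma_additive.
exact: measurable_addl.
Qed.

HB.instance Definition _ := isMeasure.Build _ _ _ shift_measure
  shift_measure0 shift_measure_ge0 shift_measure_sigma_additive.

Lemma shift_lf (B : set 'rV[R]_d) : measurable B -> bounded_set B ->
  ((shift_measure : {measure set 'rV[R]_d -> \bar R}) B < +oo)%E.
Proof.
move=> mB [r [_ bB]]; apply: lfm_finite; first exact: measurable_translate.
exists (r + 1 + `|x|); split; first exact: num_real.
move=> s rs _ [a Ba <-] /=.
rewrite (le_trans (ler_normD _ _))// normrN (le_trans _ (ltW rs))// lerD2r.
by apply: (bB (r + 1)) => //; rewrite ltrDl.
Qed.

Definition lfm_shift : lfmeasure := LFMeasure shift_lf.

End shift.

End locally_finite_measures.

Section fell.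
Context (R : realType) (d : nat).

Record compact_sets := CompactSet {
  cset :> set 'rV[R]_d;
  cset_compact : compact cset }.

HB.instance Definition _ := gen_eqMixin compact_sets.
HB.instance Definition _ := gen_choiceMixin compact_sets.
HB.instance Definition _ :=
  isPointed.Build compact_sets (CompactSet compact0).

Definition fell_subbase : set (set compact_sets) :=
  [set [set F : compact_sets | F `&` G !=set0] | G in open] `|`
  [set [set F : compact_sets | F `&` K = set0] | K in compact].

HB.instance Definition _ :=
  @isSubBaseTopological.Build compact_sets (set compact_sets) fell_subbase id.

Definition fell_borel : set (set compact_sets) := <<s @open compact_sets >>.

Let fell_borel0 : fell_borel set0.
Proof. exact: sigma_algebra0. Qed.

Let fell_borelC (U : set compact_sets) : fell_borel U -> fell_borel (~` U).
Proof. exact: sigma_algebraC. Qed.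

Let fell_borelU (F : (set compact_sets)^nat) :
  (forall i, fell_borel (F i)) -> fell_borel (\bigcup_i F i).
Proof. exact: sigma_algebra_bigcup. Qed.

Definition fell_display : measure_display.
Proof. by constructor. Qed.

HB.instance Definition _ :=
  @isMeasurable.Build fell_display compact_sets fell_borel
    fell_borel0 fell_borelC fell_borelU.

End fell.

Section probability_notions.
Local Open Scope ereal_scope.
Context (R : realType) (dW : measure_display) (W : measurableType dW)
  (P : probability W R).

Definition mutually_independent (I : choiceType) (F : I -> set (set W)) :=
  forall (J : seq I) (A : I -> set W), uniq J ->
    (forall j, j \in J -> F j (A j)) ->
    P (\bigcap_(j in [set` J]) A j) = \prod_(j <- J) P (A j).

Definition independent (F G : set (set W)) :=
  forall A B, F A -> G B -> P (A `&` B) = P A * P B.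

Definition sigma_of dT (T : measurableType dT) (Z : W -> T) : set (set W) :=
  preimage_set_system setT Z measurable.

Definition sigma_of_seq dT (T : measurableType dT) (Z : nat -> W -> T) :
    set (set W) :=
  <<s \bigcup_i sigma_of (Z i) >>.

(* The random measure \sum_i \delta_{X_i}. *)
Definition point_process dT (T : measurableType dT) (X : nat -> W -> T)
    (w : W) (B : set T) : \bar R :=
  \sum_(i <oo) \d_(X i w) B.

(* A Poisson random variable with parameter +oo is a.s. equal to +oo. *)
Definition poisson_process dT (T : measurableType dT)
    (L : set T -> \bar R) (X : nat -> W -> T) :=
  [/\ forall (B : set T) (r : R), measurable B -> L B = r%:E ->
        forall n : nat,
          P [set w | point_process X w B = (n%:R)%:E] =
            (r ^+ n / n`!%:R * expR (- r))%:E,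
      forall B : set T, measurable B -> L B = +oo ->
          P [set w | point_process X w B = +oo] = 1
    & forall (m : nat) (B : 'I_m -> set T),
        (forall i, measurable (B i)) -> trivIset setT B ->
        mutually_independent (fun i => sigma_of (point_process X ^~ (B i)))].

End probability_notions.

Section random_measures.
Local Open Scope ereal_scope.
Context (R : realType) (d : nat) (dW : measure_display) (W : measurableType dW)
  (P : probability W R) (Xi : {RV P >-> lfmeasure R d}).

Definition stationary :=
  forall (x : 'rV[R]_d) (U : set (lfmeasure R d)), measurable U ->
    P [set w | U (lfm_shift (Xi w) x)] = P [set w | U (Xi w)].

Definition has_intensity (gamma : \bar R) :=
  forall B : set 'rV[R]_d, measurable B ->
    \int[P]_w (Xi w B) = gamma * lebesgue_rV R d B.

End random_measures.

Definition dead_leaves (R : realType) (d : nat)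
    (x : nat -> 'rV[R]_d) (t : nat -> R)
    (S : nat -> compact_sets R d) (M : nat -> lfmeasure R d)
    (A : set 'rV[R]_d) : \bar R :=
  (\sum_(i <oo | (0 <= t i)%R)
    lfm_shift (M i) (x i)
      (A `&` ~` \bigcup_(j in [set j | (0 <= t j < t i)%R])
                  translate (S j) (x j)))%E.

(* Main.v *)
Require Import Defs.
From HB Require Import structures.
From mathcomp Require Import all_boot all_order all_algebra.
From mathcomp Require Import all_classical all_reals all_analysis.
From mathcomp Require Import measurable_realfun ring lra.

(** Write a leaf as [e = ((x, t), (S, M))]. The leaves form a Poisson process Y
    on space, time and marks with intensity measure Lam, the product of Lebesgue
    measure and Q', and the random measure xi is a function of Y. Three facts
    on Y carry the proof.

    Void probabilities ([marked_missing]): Y misses F with probability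
    [exp (- Lam F)]. This is the marking theorem. Given the points, the marks
    are integrated out independently ([marking_hybrid]), and what remains is the
    generating functional of the unmarked Poisson process ([avoidE]).

    Uniqueness ([count_events_same]): void probabilities determine the law of
    all numbers of points. Indeed the times are almost surely distinct
    ([distinct_times]), so that points can be separated by rational times and
    the number of points is a function of void events.

    Mecke formula ([mecke]): the mean of a sum of [f (e, Y)] over the leaves e of
    Y is the integral of the mean of [f (e, Y + e)] with respect to Lam. It
    follows from the two previous facts and from the mean numbers of points
    ([marked_mean]).

    Stationarity: translating all leaves preserves Lam, hence void
    probabilities, hence the law of Y; and it translates xi.

    Intensity: the leaves that fall during [0, t[ and cover a given point v
    have Lam-measure [lambda * t], so v is uncovered at time t with probability
    [exp (- lambda * t)]. A leaf e with [t >= 0] shows exactly its points that are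
    uncovered at its time t, and adding e to Y does not change these. By the
    Mecke formula, the mean of [xi A] is the integral over [t >= 0] of
    [exp (- lambda * t)], times the mean over the marks of the integral over x of
    the mass that M translated by x gives to A. The first factor is [1 / lambda],
    the second one is the mean of the total mass of M times the volume of A.
    Here lambda is positive because compact sets with an interior point have
    positive volume, and finite because the volume of S is at most that of its
    Minkowski sum with a ball. In particular xi is almost surely finite on all
    cubes, so it is a random element of the space of locally finite measures. *)

Set Implicit Arguments.
Unset Strict Implicit.
Unset Printing Implicit Defensive.

Import Order.TTheory GRing.Theory Num.Theory.
Import numFieldNormedType.Exports.

Local Open Scope classical_set_scope.
Local Open Scope ring_scope.
Local Open Scope ereal_scope.

(** * Image measures and counting measures *)

Section pushforward_packed.
Context d1 d2 (T1 : measurableType d1) (T2 : measurableType d2) (R : realType).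

Definition mpush (m : {measure set T1 -> \bar R}) (f : T1 -> T2)
    (mf : measurable_fun setT f) : {measure set T2 -> \bar R} :=
  measure_function_pushforward__canonical__measure_function_Measure m mf.

Lemma mpushE m f mf A : @mpush m f mf A = m (f @^-1` A).
Proof. by []. Qed.

Lemma integral_mpush m f (mf : measurable_fun setT f) (g : T2 -> \bar R) :
  measurable_fun setT g -> (forall x, 0 <= g x) ->
  \int[mpush m mf]_x g x = \int[m]_x g (f x).
Proof. by move=> mg g0; rewrite ge0_integral_pushforward. Qed.

End pushforward_packed.

Section counting_points.
Context d (T : measurableType d) (R : realType).
Implicit Types (y : nat -> T) (B : set T).

(** A point process is handled as a random sequence of points; the counting
    measure of the sequence is the object that has a meaning, the order of the
    points has none. *)
Definition npts y : {measure set T -> \bar R} :=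
  mseries (fun i => \d_(y i)) 0.

Lemma nptsE y B : npts y B = \sum_(i <oo) (y i \in B)%:R%:E.
Proof. by rewrite /npts /= /mseries; apply: eq_eseriesr => i _; exact: diracE. Qed.

Definition missing B : set (nat -> T) := [set y | forall i, ~ B (y i)].

Let partE y B n : \sum_(0 <= i < n) (y i \in B)%:R%:E =
  ((\sum_(i < n) (y i \in B))%N%:R)%:E :> \bar R.
Proof. by rewrite big_mkord sumEFin natr_sum. Qed.

Lemma npts_natP y B (m : nat) :
  m%:R%:E <= npts y B <->
  exists n, (m <= \sum_(i < n) (y i \in B))%N.
Proof.
rewrite nptsE; split => [|[n mn]]; last first.
  apply: (@le_trans _ _ (\sum_(0 <= i < n) (y i \in B)%:R%:E)).
    by rewrite partE lee_fin ler_nat.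
  by apply: nneseries_lim_ge => i _ _; rewrite lee_fin.
case: m => [_|m mN]; first by exists 0%N.
apply: contrapT => /forallNP H.
suff : \sum_(i <oo) (y i \in B)%:R%:E <= m%:R%:E :> \bar R.
  by move=> /(le_trans mN); rewrite lee_fin ler_nat ltnn.
apply: lime_le; first by apply: is_cvg_nneseries => i _ _; rewrite lee_fin.
near=> n; rewrite partE lee_fin ler_nat.
by have /negP := H n; rewrite -ltnNge ltnS.
Unshelve. all: end_near. Qed.

Lemma npts_value y B :
  npts y B = +oo \/ exists k : nat, npts y B = k%:R%:E.
Proof.
have [H|/existsNP H] := pselect (forall m : nat, m%:R%:E <= npts y B).
  left; apply/eqyP => r r0; rewrite (le_trans _ (H (Num.truncn r).+1))//.
  by rewrite lee_fin ltW// truncnS_gt.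
right; have {}H : exists m : nat, ~~ (m%:R%:E <= npts y B).
  by case: H => m /negP; exists m.
case: (ex_minnP H) => -[|k] nk mink; first by rewrite measure_ge0 in nk.
exists k; apply/eqP; rewrite eq_le; apply/andP; split; last first.
  by apply: contraT => /mink; rewrite ltnn.
rewrite nptsE.
apply: lime_le; first by apply: is_cvg_nneseries => i _ _; rewrite lee_fin.
near=> n; rewrite partE lee_fin ler_nat leqNgt; apply: contra nk => nk.
by apply/npts_natP; exists n.
Unshelve. all: end_near. Qed.

(** The layer-cake formula for counts; it turns an expected count into a series
    of probabilities of events that the void events control. *)
Lemma npts_layers y B :
  npts y B = \sum_(k <oo) (k.+1%:R%:E <= npts y B)%E%:R%:E.
Proof.
have [->|[k ->]] := npts_value y B.
  under eq_eseriesr do rewrite leey.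
  apply/esym/eqyP => r r0.
  rewrite (le_trans _ (nneseries_lim_ge (Num.truncn r).+1 _))//.
  by rewrite big_mkord sumEFin sumr_const cardT size_enum_ord lee_fin ltW// truncnS_gt.
rewrite (nneseries_split 0 k)// add0n [X in _ + X]eseries0 ?adde0.
  rewrite big_mkord (eq_bigr (fun=> 1%:E)).
    by rewrite sumEFin sumr_const cardT size_enum_ord.
  by move=> i _; rewrite lee_fin ler_nat ltn_ord.
by move=> i ki _; rewrite lee_fin ler_nat ltnNge ki.
Qed.

Lemma npts_missing y B : (1 <= npts y B) <-> ~ missing B y.
Proof.
rewrite (npts_natP y B 1); split => [[n]|].
  rewrite lt0n sum_nat_eq0 negb_forall => /existsP[i]/=.
  by rewrite eqb0 negbK inE => Bi /(_ i).
move=> /existsNP[i /contrapT Bi]; exists i.+1.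
by rewrite big_ord_recr/= mem_set// addn1.
Qed.

Lemma npts_eq0 y B : npts y B = 0 <-> missing B y.
Proof.
split => [h0|yB].
  by apply: contrapT => /npts_missing; rewrite h0 lee_fin ler10.
by rewrite nptsE eseries0// => i _ _; rewrite memNset//.
Qed.

(** Of m+1 points in B with distinct times, the latest one has a time strictly
    above the m others, so some rational time separates it from them. This
    reduces counting up to m+1 to counting up to m and to a void event. *)
Lemma npts_split (tau : T -> R) y B (m : nat) : injective (tau \o y) ->
  m.+1%:R%:E <= npts y B -> exists q : rat,
    m%:R%:E <= npts y (B `&` [set x | (tau x < ratr q)%R]) /\
    1 <= npts y (B `&` [set x | (ratr q <= tau x)%R]).
Proof.
move=> tauI /npts_natP[n mn].
pose I := [set i : 'I_n | y i \in B]%SET.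
have I_gt : (m < #|I|)%N.
  rewrite (leq_trans mn)// -sum1dep_card [leqRHS]big_mkcond/=.
  by apply: leq_sum => i _; case: (y i \in B).
have [i0 i0I] : exists i0, i0 \in I by apply/card_gt0P; exact: leq_trans I_gt.
have := @arg_maxP _ _ _ i0 (mem I) (fun i => tau (y i)) i0I.
case: Order.TotalTheory.arg_maxP => //= i1 i1I i1max _.
have i1S : i1 \in I := i1I.
pose b := (\big[Num.max/(tau (y i1) - 1)]_(j in I | j != i1) tau (y j))%R.
have : (b < tau (y i1))%R.
  apply: bigmax_lt; first by rewrite ltrBlDr ltrDl.
  move=> j /andP[jI ji1]; rewrite lt_neqAle i1max// andbT.
  by apply: contra ji1 => /eqP/(@tauI j i1)/val_inj ->.
move=> /rat_in_itvoo[q]; rewrite in_itv/= => /andP[bq qi1]; exists q; split.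
- apply/npts_natP; exists n; rewrite -ltnS (leq_trans I_gt)//.
  rewrite (cardsD1 i1 I) i1S add1n ltnS -sum1_card big_mkcond/=.
  apply: leq_sum => j _; case: ifPn => //; rewrite !inE => /andP[ji1 Bj].
  rewrite lt0b mem_set//; split; first exact/set_mem.
  apply: le_lt_trans bq; rewrite /b.
  by apply: (le_bigmax_cond _ (fun k : 'I_n => tau (y k))); rewrite !inE Bj.
- apply: (iffRL (npts_missing y _)) => /(_ i1); apply.
  split; last exact: ltW.
  by apply/set_mem; move: i1S; rewrite /I finset.in_set.
Qed.

End counting_points.

Section configurations.
Context d (T : measurableType d) (R : realType).
Implicit Types (B : set T) (y : nat -> T).

Definition count_events B0 : set (set (nat -> T)) :=
  [set D | exists B m, [/\ measurable B, B `<=` B0 &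
    D = [set y | m%:R%:E <= npts R y B]]].

(** Sequences of points, with the sigma-algebra generated by the numbers of
    points in measurable sets: two sequences with the same counting measure are
    in the same measurable sets. *)
Definition cfg := g_sigma_algebraType (count_events setT).

Definition missing_events B0 : set (set (nat -> T)) :=
  [set D | exists B, [/\ measurable B, B `<=` B0 & D = missing B]].

Lemma measurable_missing B : measurable B -> measurable (missing B : set cfg).
Proof.
move=> mB; rewrite -[X in measurable X]setCK; apply: measurableC.
apply: sub_sigma_algebra; exists B, 1%N; split => //.
by apply/seteqP; split => y /=; rewrite npts_missing.
Qed.

Lemma measurable_npts_cfg B : measurable B ->
  measurable_fun setT (fun y : cfg => npts R y B).
Proof.
move=> mB.
rewrite [X in measurable_fun _ X](_ : _ = fun y : cfg =>
    \sum_(k <oo) (\1_[set y : cfg | (k.+1%:R%:E <= npts R y B)%E] y)%:E); last first.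
  apply/funext => y; rewrite npts_layers; apply: eq_eseriesr => k _.
  by rewrite indicE; congr ((nat_of_bool _)%:R%:E); apply/idP/idP => [?|/set_mem//]; exact/mem_set.
apply: ge0_emeasurable_sum => // k _; apply/measurable_EFinP.
apply: measurable_indic; apply: sub_sigma_algebra.
by exists B, k.+1.
Qed.

Lemma measurable_to_cfg dW (W : measurableType dW) (Y : W -> nat -> T) :
  (forall i, measurable_fun setT (fun w => Y w i)) ->
  measurable_fun setT (Y : W -> cfg).
Proof.
move=> mY; apply: (@measurability _ _ W cfg setT Y (count_events setT) erefl).
move=> _ [D [B [m [mB _ ->]]] <-].
rewrite setTI [X in measurable X](_ : _ =
    [set w | m%:R%:E <= \sum_(i <oo) \d_(Y w i) B :> \bar R])//.
rewrite -[X in measurable X]setTI; apply: emeasurable_fun_c_infty => //.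
apply: ge0_emeasurable_sum => // i _.
rewrite [X in measurable_fun _ X](_ : _ =
   EFin \o (\1_B \o (fun w => Y w i))).
  apply/measurable_EFinP; apply: measurableT_comp; last exact: mY.
  exact: measurable_indic.
by apply/funext => w /=; rewrite diracE indicE.
Qed.

End configurations.

Section avoidance.
Context d (T : measurableType d) (R : realType) (tau : T -> R).
Context d1 (W1 : measurableType d1) d2 (W2 : measurableType d2).
Variables (nu1 : {measure set W1 -> \bar R}) (nu2 : {measure set W2 -> \bar R}).
Variables (Y1 : W1 -> nat -> T) (Y2 : W2 -> nat -> T).
Hypothesis mtau : measurable_fun setT tau.
Hypothesis mY1 : forall i, measurable_fun setT (fun w => Y1 w i).
Hypothesis mY2 : forall i, measurable_fun setT (fun w => Y2 w i).
Hypothesis sep1 : nu1.-negligible [set w | ~ injective (tau \o Y1 w)].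
Hypothesis sep2 : nu2.-negligible [set w | ~ injective (tau \o Y2 w)].
Variable B0 : set T.
Hypothesis fin1 : nu1 setT < +oo.
Hypothesis same_void : forall B, measurable B -> B `<=` B0 ->
  nu1 (Y1 @^-1` missing B) = nu2 (Y2 @^-1` missing B).

(** Renyi's theorem: void probabilities determine the law. Void events are
    stable under intersection, since missing B and C is missing their union, so
    two finite measures that agree on them agree on the sigma-algebra that they
    generate. On sequences with distinct times this sigma-algebra contains all
    count events, by splitting at rational times. Restricting to subsets of B0
    allows for measures, such as those in the proof of the Mecke formula, whose
    void probabilities are only known inside B0. *)
Lemma count_events_same D : <<s count_events R B0 >> D ->
  nu1 (Y1 @^-1` D) = nu2 (Y2 @^-1` D).
Proof.
pose S : set (nat -> T) := [set y : nat -> T | injective (tau \o y)].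
pose V := missing_events B0.
have missingI B C : missing B `&` missing C = missing (B `|` C) :> set (nat -> T).
  apply/seteqP; split => [y [yB yC] i [/yB|/yC]//|y yBC].
  by split => i ?; apply: (yBC i); [left|right].
(* Only the traces on S of the two sigma-algebras coincide. *)
have trace E : <<s count_events R B0 >> E -> exists2 E0, <<s V >> E0 & E `&` S = E0 `&` S.
  move: E; apply: smallest_sub.
    split.
    - by exists set0 => //; exact: sigma_algebra0.
    - move=> E [E0 VE0 EE0]; exists (~` E0).
        by rewrite -setTD; exact: sigma_algebraCD.
      rewrite setTD; apply/seteqP; split => y [nE Sy]; split => // Ey; apply: nE.
        by have [] : (E `&` S) y by rewrite EE0.
      by have [] : (E0 `&` S) y by rewrite -EE0.
    - move=> F HF.
      have /choice[G HG] : forall n, exists E0, <<s V >> E0 /\ F n `&` S = E0 `&` S.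
        by move=> n; have [E0 ? ?] := HF n; exists E0.
      exists (\bigcup_n G n); first by apply: sigma_algebra_bigcup => n; case: (HG n).
      by rewrite !setI_bigcupl; apply: eq_bigcupr => n _; case: (HG n).
  have VU (F : nat -> set (nat -> T)) : (forall n, <<s V >> (F n)) -> <<s V >> (\bigcup_n F n).
    exact: sigma_algebra_bigcup.
  suff H m B : measurable B -> B `<=` B0 ->
      exists2 E0, <<s V >> E0 & [set y | m%:R%:E <= npts R y B] `&` S = E0 `&` S.
    by move=> _ [B [m [mB BB0 ->]]]; exact: H.
  elim: m B => [|m IH] B mB BB0.
    exists setT; first exact: (@measurableT _ (g_sigma_algebraType V)).
    congr (_ `&` _); apply/seteqP; split => // y _ /=; exact: measure_ge0.
  have mlt (q : rat) : measurable (B `&` [set x | (tau x < ratr q)%R]).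
    apply: measurableI => //; rewrite -[X in measurable X]setTI.
    exact: measurable_fun_ltr.
  have mge (q : rat) : measurable (B `&` [set x | (ratr q <= tau x)%R]).
    apply: measurableI => //; rewrite -[X in measurable X]setTI.
    exact: measurable_fun_ler.
  have /choice[G HG] : forall q : rat, exists E0, <<s V >> E0 /\
     [set y | m%:R%:E <= npts R y (B `&` [set x | (tau x < ratr q)%R])] `&` S = E0 `&` S.
    move=> q; have [//|E0 ? ?] := IH (B `&` [set x | (tau x < ratr q)%R]) (mlt q).
      by apply: subset_trans BB0; exact: subIsetl.
    by exists E0.
  pose cV : sigmaRingType _ := g_sigma_algebraType V.
  exists (\bigcup_q (G q `&` ~` missing (B `&` [set x | (ratr q <= tau x)%R]))).
    apply: (@countable_bigcupT_measurable _ cV); first exact: countableP.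
    move=> q; apply: (@measurableI _ cV); first by case: (HG q).
    apply: (@measurableC _ (g_sigma_algebraType V)); apply: sub_sigma_algebra.
    exists (B `&` [set x | (ratr q <= tau x)%R]); split => //.
    by apply: subset_trans BB0; exact: subIsetl.
  apply/seteqP; split => y [yH Sy]; split => //.
  - have [q [q1 q2]] := npts_split Sy yH; exists q => //; split.
      by have [] : (G q `&` S) y by rewrite -(HG q).2; split.
    exact/(npts_missing R).
  - case: yH => q _ [Gq /(npts_missing R) q2].
    have [/= q1 _] : ([set y | m%:R%:E <= npts R y (B `&` [set x | (tau x < ratr q)%R])] `&` S) y.
      by rewrite (HG q).2.
    rewrite /= -natr1 EFinD.
    apply: (le_trans (leeD q1 q2)).
    rewrite -measureU//; last first.
      by apply/seteqP; split => // x [[_ /= +] [_ /=]]; rewrite leNgt => ->.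
    apply: le_measure; rewrite ?inE//; first exact: measurableU.
    by move=> x [] [].
have mcfg E : <<s count_events R setT >> E -> measurable (Y1 @^-1` E) /\ measurable (Y2 @^-1` E).
  move=> mE; rewrite -[Y1 @^-1` _]setTI -[Y2 @^-1` _]setTI.
  by split; exact: (measurable_to_cfg (R := R)).
have Vc : V `<=` <<s count_events R setT >>.
  by move=> _ [B [mB _ ->]]; exact: (@measurable_missing _ _ R).
have cc : <<s count_events R B0 >> `<=` <<s count_events R setT >>.
  apply: smallest_sub; first exact: smallest_sigma_algebra.
  by move=> E [B [m [mB _ ->]]]; apply: sub_sigma_algebra; exists B, m.
have VVc : <<s V >> `<=` <<s count_events R setT >>.
  by apply: smallest_sub => //; exact: smallest_sigma_algebra.
move=> cD; have [E0 VE0 DE0] := trace _ cD.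
have swap dW (W : measurableType dW) (nu : {measure set W -> \bar R}) (Y : W -> nat -> T)
    (mY : forall i, measurable_fun setT (fun w => Y w i))
    (sep : nu.-negligible [set w | ~ injective (tau \o Y w)]) :
    nu (Y @^-1` D) = nu (Y @^-1` E0).
  have [N [mN N0 sN]] := sep.
  have cE0 : measurable (E0 : set (cfg T R)) by exact: VVc.
  have cD' : measurable (D : set (cfg T R)) by exact: cc.
  have mYc := measurable_to_cfg (R := R) mY.
  have mYD : measurable (Y @^-1` D) by rewrite -[X in measurable X]setTI; exact: mYc.
  have mYE : measurable (Y @^-1` E0) by rewrite -[X in measurable X]setTI; exact: mYc.
  have off A : measurable A -> nu A = nu (A `\` N).
    move=> mA; rewrite (measureDI nu mA mN).
    rewrite [X in _ + X](_ : _ = 0) ?adde0//.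
    by apply: (subset_measure0 _ mN (@subIsetr _ A N)) => //; exact: measurableI.
  rewrite off// [RHS]off//; congr (nu _).
  have SN w : ~ N w -> S (Y w) by move=> Nw; apply: contrapT => /sN.
  apply/seteqP; split => w [Hw Nw]; split => //.
    by have [] : (E0 `&` S) (Y w) by rewrite -DE0; split => //; exact: SN.
  by have [] : (D `&` S) (Y w) by rewrite DE0; split => //; exact: SN.
rewrite swap// [RHS]swap//.
have mY1c := measurable_to_cfg (R := R) mY1.
have mY2c := measurable_to_cfg (R := R) mY2.
change (mpush nu1 mY1c E0 = mpush nu2 mY2c E0).
apply: (@g_sigma_algebra_measure_unique _ R (cfg T R) V Vc (fun=> setT)) => //.
- move=> _; exists set0; split => //.
  by apply/seteqP; split => // y _ i.
- by rewrite bigcup_const.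
- move=> _ _ [B [mB BB0 ->]] [C [mC CB0 ->]]; exists (B `|` C); split => //.
  + exact: measurableU.
  + by move=> x [/BB0|/CB0].
- by move=> _ [B [mB BB0 ->]]; exact: same_void.
Qed.
End avoidance.

(** * Mean numbers of points and the Mecke formula *)

Section negligible_lemmas.
Context d (T : measurableType d) (R : realType).

Lemma negligible_mrestr (mu : {measure set T -> \bar R}) (D : set T)
    (mD : measurable D) N : mu.-negligible N -> (mrestr mu mD).-negligible N.
Proof.
move=> [A [mA A0 NA]]; exists A; split => //.
by apply: (subset_measure0 _ mA (@subIsetl _ A D)) => //; exact: measurableI.
Qed.

Lemma negligible_mscale (mu : {measure set T -> \bar R}) (r : {nonneg R}) N :
  mu.-negligible N -> (mscale r mu).-negligible N.
Proof.
by move=> [A [mA A0 NA]]; exists A; split => //; rewrite /mscale A0 mule0.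
Qed.

Lemma negligible_mseries (mu : nat -> {measure set T -> \bar R}) N :
  (exists A, [/\ measurable A, forall i, mu i A = 0 & N `<=` A]) ->
  (mseries mu 0).-negligible N.
Proof.
move=> [A [mA A0 NA]]; exists A; split => //.
by rewrite /mseries eseries0// => i _ _; exact: A0.
Qed.

End negligible_lemmas.

Lemma product_measure1_ysection d1 d2 (T1 : measurableType d1)
    (T2 : measurableType d2) (R : realType)
    (m1 : {sigma_finite_measure set T1 -> \bar R})
    (m2 : {sigma_finite_measure set T2 -> \bar R}) (A : set (T1 * T2)) :
  measurable A -> (m1 \x m2) A = \int[m2]_y m1 (ysection A y).
Proof.
move=> mA; rewrite -[X in (m1 \x m2) X]setIT -integral_indic//.
rewrite fubini_tonelli2//; last exact/measurable_EFinP/measurable_indic.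
apply: eq_integral => y _; rewrite /fubini_G.
rewrite -[X in m1 X]setIT -integral_indic//; last exact: measurable_ysection.
by apply: eq_integral => x _; rewrite !indicE mem_ysection.
Qed.

Section mean_count.
Context d (T : measurableType d) (R : realType).
Context dW (W : measurableType dW) (nu : {measure set W -> \bar R}).
Variable Y : W -> nat -> T.
Hypothesis mY : forall i, measurable_fun setT (fun w => Y w i).

Lemma measurable_preim i B : measurable B -> measurable [set w | B (Y w i)].
Proof. by move=> mB; rewrite -[X in measurable X]setTI; exact: mY. Qed.

Lemma measurable_preim_cfg (D : set (cfg T R)) : measurable D ->
  measurable (Y @^-1` D).
Proof.
by move=> mD; rewrite -[X in measurable X]setTI; exact: (measurable_to_cfg (R := R)).
Qed.

Lemma mean_npts B : measurable B ->
  \int[nu]_w npts R (Y w) B = \sum_(i <oo) nu [set w | B (Y w i)].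
Proof.
move=> mB; under eq_integral do rewrite nptsE.
rewrite integral_nneseries//; last first.
  move=> i; apply/measurable_EFinP.
  rewrite (_ : (fun w => _) = \1_[set w | B (Y w i)]).
    exact/measurable_indic/measurable_preim.
  by apply/funext => w; rewrite indicE /in_mem.
apply: eq_eseriesr => i _.
by rewrite -[X in nu X]setIT -integral_indic//; exact: measurable_preim.
Qed.

Lemma mean_npts_layers B : measurable B ->
  \sum_(i <oo) nu [set w | B (Y w i)] =
  \sum_(k <oo) nu [set w | k.+1%:R%:E <= npts R (Y w) B].
Proof.
move=> mB; rewrite -mean_npts//.
have mL k : measurable [set w | k.+1%:R%:E <= npts R (Y w) B].
  by apply: (@measurable_preim_cfg [set y | k.+1%:R%:E <= npts R y B]); apply: sub_sigma_algebra; exists B, k.+1.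
have E k w : (k.+1%:R%:E <= npts R (Y w) B)%E%:R =
    \1_[set w | (k.+1%:R%:E <= npts R (Y w) B)%E] w :> R.
  by rewrite indicE; congr ((nat_of_bool _)%:R); apply/idP/idP => [?|/set_mem//]; exact/mem_set.
under eq_integral do rewrite npts_layers.
rewrite integral_nneseries//; last first.
  by move=> k; apply/measurable_EFinP; under eq_fun do rewrite E; exact: measurable_indic.
apply: eq_eseriesr => k _.
rewrite -[X in nu X]setIT -integral_indic//.
by apply: eq_integral => w _; rewrite E.
Qed.

End mean_count.

Definition consq T (e : T) (y : nat -> T) : nat -> T :=
  fun i => if i is j.+1 then y j else e.

Lemma npts_consq d (T : measurableType d) (R : realType) e (y : nat -> T) B :
  npts R (consq e y) B = (e \in B)%:R%:E + npts R y B.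
Proof.
rewrite !nptsE nneseries_recl//; congr (_ + _).
by rewrite -nneseries_addn//; apply: eq_eseriesr => i _; rewrite addn1.
Qed.

(** For a process with distinct times, whose mean measure L does not charge any
    given time, independence of the void events of disjoint sets characterizes
    Poisson processes; the formula is derived from these properties. *)
Section mecke.
Context d (T : measurableType d) (R : realType) (tau : T -> R).
Context dW (W : measurableType dW) (P : probability W R).
Variables (L : {sigma_finite_measure set T -> \bar R}) (Y : W -> nat -> T).
Hypothesis mtau : measurable_fun setT tau.
Hypothesis tau_diffuse : forall c, L [set e | tau e = c] = 0.
Hypothesis mY : forall i, measurable_fun setT (fun w => Y w i).
Hypothesis sep : P.-negligible [set w | ~ injective (tau \o Y w)].
Hypothesis mean : forall B, measurable B -> \sum_(i <oo) P [set w | B (Y w i)] = L B.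
Hypothesis void_indep : forall B C, measurable B -> measurable C -> B `&` C = set0 ->
  P (Y @^-1` missing (B `|` C)) = P (Y @^-1` missing B) * P (Y @^-1` missing C).

Local Notation cfg := (cfg T R).

Let mmiss B : measurable B -> measurable (Y @^-1` missing B).
Proof. by move=> mB; apply: (measurable_preim_cfg (R := R)) => //; exact: measurable_missing. Qed.

Let missingU (B C : set T) : missing (B `|` C) = missing B `&` missing C :> set (nat -> T).
Proof.
apply/seteqP; split => [y yBC|y [yB yC] i [/yB|/yC]//].
by split => i ?; apply: (yBC i); [left|right].
Qed.

(** The number of points in B and the event of missing a disjoint set C are
    independent: P restricted to that event and P scaled by its probability have
    the same void probabilities inside B, so they give the same law to the number
    of points in B. *)
Lemma mean_count_missing_disjoint B C : measurable B -> measurable C ->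
  B `&` C = set0 -> L B < +oo ->
  \sum_(i <oo) P ([set w | B (Y w i)] `&` Y @^-1` missing C) =
  L B * P (Y @^-1` missing C).
Proof.
move=> mB mC BC LB; have mmC := mmiss mC.
have p0 : (0 <= fine (P (Y @^-1` missing C)))%R by exact: fine_ge0.
pose nu1 : {measure set W -> \bar R} := mrestr P mmC.
pose nu2 : {measure set W -> \bar R} := mscale (NngNum p0) P.
have pE : (fine (P (Y @^-1` missing C)))%:E = P (Y @^-1` missing C).
  by rewrite fineK// fin_num_measure.
transitivity (\sum_(i <oo) nu1 [set w | B (Y w i)]); first by [].
transitivity (\sum_(i <oo) nu2 [set w | B (Y w i)]); last first.
  by rewrite -mean// muleC -pE -nneseriesZl.
rewrite (mean_npts_layers nu1 mY mB) (mean_npts_layers nu2 mY mB).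
apply: eq_eseriesr => k _.
apply: (@count_events_same _ _ R tau _ _ _ _ nu1 nu2 Y Y mtau mY mY _ _ B _ _
  [set y | k.+1%:R%:E <= npts R y B]).
- exact: negligible_mrestr.
- exact: negligible_mscale.
- by rewrite /nu1/= /mrestr setTI (le_lt_trans (probability_le1 P _))// ltry.
- move=> E mE EB; rewrite /nu1 /nu2/= /mrestr /mscale/= pE muleC -void_indep//.
    by rewrite missingU preimage_setI.
  by apply/seteqP; split => // x [/EB Bx Cx]; rewrite -BC.
- by apply: sub_sigma_algebra; exists B, k.+1; split.
Qed.

Lemma mean_count_missing B C : measurable B -> measurable C -> L B < +oo ->
  \sum_(i <oo) P ([set w | B (Y w i)] `&` Y @^-1` missing C) =
  L (B `\` C) * P (Y @^-1` missing C).
Proof.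
move=> mB mC LB; have mBC : measurable (B `\` C) by exact: measurableD.
rewrite -mean_count_missing_disjoint//; last 2 first.
- by apply/seteqP; split => // x [[_ ?] ?].
- by apply: le_lt_trans LB; rewrite le_measure// inE.
apply: eq_eseriesr => i _; congr (P _).
apply/seteqP; split => w [/= Bw Cw]; split => //; last by case: Bw.
Qed.

Let mconsq i : measurable_fun setT (fun z : T * W => consq z.1 (Y z.2) i).
Proof.
case: i => [|i] /=; first exact: measurable_fst.
by apply: (measurableT_comp (mY i)); exact: measurable_snd.
Qed.

(* The time of the added point is diffuse, hence almost surely new. *)
Let sep_consq : (L \x P).-negligible [set z | ~ injective (tau \o consq z.1 (Y z.2))].
Proof.
have [N [mN N0 sN]] := sep.
have mtY i : measurable [set z : T * W | tau z.1 = tau (Y z.2 i)].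
  rewrite -[X in measurable X]setTI.
  rewrite (_ : [set z | _] = [set z : T * W | tau z.1 == tau (Y z.2 i)]).
    apply: measurable_fun_eqr => //.
      by apply: measurableT_comp => //; exact: measurable_fst.
    by apply: measurableT_comp => //; apply: (measurableT_comp (mY i)); exact: measurable_snd.
  by apply/seteqP; split => z /= /eqP.
apply: (@negligibleS _ _ _ _ ((setT `*` N) `|`
    \bigcup_i [set z : T * W | tau z.1 = tau (Y z.2 i)])).
  move=> [e w] /= ninj; apply: contrapT => /not_orP[/= n1 n2]; apply: ninj.
  have injY : injective (tau \o Y w).
    by apply: contrapT => nY; apply: n1; split => //; exact: sN.
  have ne i : tau e <> tau (Y w i) by move=> ?; apply: n2; exists i.
  move=> [|i] [|j] //=; first by move/ne.
    by move/esym/ne.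
  by move/injY ->.
apply: negligibleU.
  apply/negligibleP; first exact: measurableX.
  by apply: (etrans (product_measure1E L P measurableT mN)); rewrite [X in _ * X](_ : _ = 0) ?mule0.
apply: negligible_bigcup => i; apply/negligibleP => //.
apply: (etrans (product_measure1_ysection L P (mtY i))).
rewrite integral0_eq// => w _.
rewrite (_ : ysection _ _ = [set e | tau e = tau (Y w i)])//.
by apply/seteqP; split => e; rewrite /ysection/= inE.
Qed.

(** Both sides are finite measures in D, namely laws of a configuration weighted
    by its number of points in B, respectively of a configuration with one
    added point of B. It suffices to compare them on void events, where a
    missed set C forces the marked or added point to lie in B outside C. *)
Lemma mecke_rectangle B D : measurable B -> L B < +oo -> measurable (D : set cfg) ->
  \sum_(i <oo) P ([set w | B (Y w i)] `&` Y @^-1` D) =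
  (L \x P) ((B `*` setT) `&` [set z | D (consq z.1 (Y z.2))]).
Proof.
move=> mB LB mD.
have mYB i : measurable [set w | B (Y w i)] by exact: (measurable_preim mY).
have mBT : measurable (B `*` [set: W]) by exact: measurableX.
pose nu1 : {measure set W -> \bar R} := mseries (fun i => mrestr P (mYB i)) 0.
pose nu2 : {measure set (T * W) -> \bar R} := mrestr (L \x P) mBT.
have nu1E A : nu1 A = \sum_(i <oo) P ([set w | B (Y w i)] `&` A).
  by apply: eq_eseriesr => i _; rewrite setIC.
rewrite -nu1E [RHS](_ : _ = nu2 ((fun z => consq z.1 (Y z.2)) @^-1` D)); last first.
  by rewrite /nu2/= /mrestr setIC.
apply: (@count_events_same _ _ R tau _ _ _ _ nu1 nu2 Y _ mtau mY _ _ _ setT _ _ D) => //.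
- apply: negligible_mseries; have [N [mN N0 sN]] := sep; exists N; split => // i.
  apply: (subset_measure0 _ mN (@subIsetl _ N _)) => //; exact: measurableI.
- exact: negligible_mrestr.
- by rewrite nu1E; under eq_eseriesr do rewrite setIT; rewrite mean.
- move=> C mC _; rewrite nu1E mean_count_missing//.
  rewrite /nu2/= /mrestr [X in (L \x P) X](_ : _ = (B `\` C) `*` (Y @^-1` missing C)).
    by apply/esym/product_measure1E; [exact: measurableD|exact: mmiss].
  apply/seteqP; split => [[e w] [/= nC [Be _]]|[e w] [/= [Be Ce] nC]].
    by split; [split => //; exact: (nC 0%N)|move=> i; exact: (nC i.+1)].
  by split => // -[|i] //=; exact: nC.
Qed.

(** Rectangles B x D generate the product sigma-algebra, and those with L B
    finite form a pi-system that exhausts the space. *)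
Theorem mecke (f : T * cfg -> \bar R) : measurable_fun setT f -> (forall z, 0 <= f z) ->
  \sum_(i <oo) \int[P]_w f (Y w i, Y w) =
  \int[L]_e \int[P]_w f (e, consq e (Y w)).
Proof.
move=> mf f0.
have mYc : measurable_fun setT (Y : W -> cfg) by exact: measurable_to_cfg.
have m1 i : measurable_fun setT (fun w => (Y w i, Y w) : T * cfg).
  exact: measurable_fun_pair.
have m2 : measurable_fun setT (fun z : T * W => (z.1, consq z.1 (Y z.2)) : T * cfg).
  apply: measurable_fun_pair; first exact: measurable_fst.
  exact: measurable_to_cfg.
pose nu1 : {measure set (T * cfg) -> \bar R} := mseries (fun i => mpush P (m1 i)) 0.
pose nu2 : {measure set (T * cfg) -> \bar R} := mpush (L \x P) m2.
transitivity (\int[nu1]_z f z).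
  rewrite ge0_integral_measure_series//; apply: eq_eseriesr => i _.
  by rewrite integral_mpush.
transitivity (\int[nu2]_z f z); last first.
  rewrite integral_mpush// fubini_tonelli1//.
  exact: (measurableT_comp mf m2).
apply: eq_measure_integral => A mA _.

have [F [F1 F2]] := sigma_finiteT L.
pose G : set (set (T * cfg)) :=
  [set A | exists B D, [/\ measurable B, L B < +oo, measurable D & A = B `*` D]].
have Gsub : G `<=` measurable.
  by move=> _ [B [D [mB _ mD ->]]]; exact: measurableX.
apply: (g_sigma_algebra_measure_unique G Gsub (fun n => F n `*` [set: cfg])).
- by move=> n; exists (F n), setT; split => //; case: (F2 n).
- by rewrite -setX_bigcupl -F1 setXTT.
- move=> _ _ [B [D [mB LB mD ->]]] [B' [D' [mB' LB' mD' ->]]].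
  exists (B `&` B'), (D `&` D'); split; [exact: measurableI| |exact: measurableI|by rewrite setXI].
  by apply: le_lt_trans LB; rewrite le_measure// inE//; exact: measurableI.
- move=> _ [B [D [mB LB mD ->]]].
  transitivity (\sum_(i <oo) P ([set w | B (Y w i)] `&` Y @^-1` D)); first by [].
  by rewrite mecke_rectangle//; congr ((L \x P) _); apply/seteqP; split => z /= [] => [[]|].

- move=> n; rewrite [X in X < _](_ : _ = \sum_(i <oo) P [set w | F n (Y w i)]).
    by rewrite mean; case: (F2 n).
  by apply: eq_eseriesr => i _; rewrite mpushE; congr (P _); apply/seteqP; split => w //= [].

- move: mA; rewrite measurable_prod_measurableType; apply: smallest_sub.
    exact: smallest_sigma_algebra.
  move=> _ [B mB [D mD <-]].
  rewrite (_ : B `*` D = \bigcup_n ((B `&` F n) `*` D)).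
    apply: sigma_algebra_bigcup => n; apply: sub_sigma_algebra.
    have [mF LF] := F2 n.
    exists (B `&` F n), D; split => //; first exact: measurableI.
    by apply: le_lt_trans LF; rewrite le_measure// inE//; exact: measurableI.
  by rewrite -setX_bigcupl -setI_bigcupr -F1 setIT.
Qed.

End mecke.

(** * Independent counts *)

Lemma nneseriesZr (R : realType) (u : nat -> \bar R) (c : \bar R) :
  (forall k, 0 <= u k) -> 0 <= c ->
  \sum_(k <oo) (u k * c) = (\sum_(k <oo) u k) * c.
Proof.
move=> u0 c0; rewrite -!ge0_integral_count//; last by move=> k; rewrite mule_ge0.
by rewrite ge0_integralZr.
Qed.

Section independent_products.
Context (R : realType) dW (W : measurableType dW) (P : probability W R).
Context (I : choiceType) (N : I -> W -> \bar R).
Hypothesis mN : forall j, measurable_fun setT (N j).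
Hypothesis N_indep : mutually_independent P (fun j => sigma_of (N j)).

(** The function phi of a count, extended by 0 to the extended reals that are
    not natural numbers. Written as a series of indicators, its expectation is a
    series of point probabilities. *)
Definition count_fun (phi : nat -> R) (x : \bar R) : \bar R :=
  \sum_(k <oo) (phi k)%:E * (\1_[set k%:R%:E] x)%:E.

Let natI (m n : nat) : m%:R%:E = n%:R%:E :> \bar R -> m = n.
Proof.
move=> H; have : (m%:R = n%:R :> R)%R by case: H.
by move/eqP; rewrite eqr_nat => /eqP.
Qed.

Lemma count_funZ phi x c : (forall k, (0 <= phi k)%R) -> 0 <= c ->
  count_fun phi x * c = \sum_(k <oo) (phi k)%:E * ((\1_[set k%:R%:E] x)%:E * c).
Proof.
move=> phi0 c0; rewrite /count_fun.
have [[k ->]|nx] := pselect (exists k : nat, x = k%:R%:E); last first.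
  rewrite eseries0 => [|k _ _]; last first.
    by rewrite indicE memNset/= ?mule0// => xk; apply: nx; exists k.
  rewrite mul0e eseries0// => k _ _.
  by rewrite indicE memNset/= ?mul0e ?mule0// => xk; apply: nx; exists k.
have off (i : nat) : i != k -> (\1_[set (i%:R%:E : \bar R)] (k%:R%:E) : R) = 0%R.
  by move=> ik; rewrite indicE memNset// => H; have ki := natI H; rewrite ki eqxx in ik.
rewrite (@nneseriesD1 _ _ k)//; last first.
  by move=> i _; rewrite -EFinM lee_fin mulr_ge0.
rewrite [RHS](@nneseriesD1 _ _ k)//; last first.
  by move=> i _; rewrite !mule_ge0 ?lee_fin.
rewrite eseries0 ?adde0 => [|i _ /= ik]; last by rewrite off// mule0.
rewrite eseries0 ?adde0 => [|i _ /= ik]; last by rewrite off// mul0e mule0.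
by rewrite muleA.
Qed.

Lemma count_fun_nat phi k : (forall k, (0 <= phi k)%R) ->
  count_fun phi k%:R%:E = (phi k)%:E.
Proof.
move=> phi0; rewrite -[LHS]mule1 count_funZ//.
rewrite (@nneseriesD1 _ _ k)//; last first.
  by move=> i _; rewrite !mule_ge0 ?lee_fin.
rewrite eseries0 ?adde0 => [|i _ /= ik]; first by rewrite indicE mem_set//= !mule1.
by rewrite indicE memNset/= ?mul0e ?mule0// => H; have ki := natI H; rewrite ki eqxx in ik.
Qed.

Lemma measurable_count_fun phi : (forall k, (0 <= phi k)%R) ->
  measurable_fun setT (count_fun phi).
Proof.
move=> phi0; apply: ge0_emeasurable_sum => k.
  by move=> x _ _; rewrite -EFinM lee_fin mulr_ge0.
by move=> _; apply: measurable_funeM; exact/measurable_EFinP/measurable_indic.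
Qed.

Lemma count_fun_ge0 phi x : (forall k, (0 <= phi k)%R) -> 0 <= count_fun phi x.
Proof. by move=> phi0; apply: nneseries_ge0 => k _ _; rewrite -EFinM lee_fin mulr_ge0. Qed.

Variable phi : I -> nat -> R.
Hypothesis phi_ge0 : forall j k, (0 <= phi j k)%R.

Let mprod (s : seq I) : measurable_fun setT (fun w => \prod_(j <- s) count_fun (phi j) (N j w)).
Proof.
elim: s => [|j s IH].
  rewrite [X in measurable_fun _ X](_ : _ = cst 1)//.
  by apply/funext => w; rewrite big_nil.
under eq_fun do rewrite big_cons.
apply: emeasurable_funM => //; apply: measurableT_comp => //.
exact: measurable_count_fun.
Qed.

Let prod_ge0 (s : seq I) w : 0 <= \prod_(j <- s) count_fun (phi j) (N j w).
Proof.
elim: s => [|j s IH]; first by rewrite big_nil.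
by rewrite big_cons mule_ge0// count_fun_ge0.
Qed.

(** Independence is stated for events. The induction trades the factors
    [count_fun (phi j) (N j w)] one at a time for the events [N j w = k]; the
    conditioning on the events indexed by J2 keeps track of those already
    traded. *)
Lemma integral_prod_count_gen (J1 J2 : seq I) (A : I -> set W) :
  uniq (J1 ++ J2) -> (forall j, j \in J2 -> sigma_of (N j) (A j)) ->
  \int[P]_(w in \bigcap_(j in [set` J2]) A j)
     \prod_(j <- J1) count_fun (phi j) (N j w) =
  \prod_(j <- J1) (\sum_(k <oo) (phi j k)%:E * P [set w | N j w = k%:R%:E]) *
  \prod_(j <- J2) P (A j).
Proof.
have mA (J : seq I) (B : I -> set W) : (forall j, j \in J -> sigma_of (N j) (B j)) ->
    measurable (\bigcap_(j in [set` J]) B j).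
  move=> HB; apply: fin_bigcap_measurable; first exact: finite_seq.
  by move=> j /HB [E mE <-]; exact: mN.
elim: J1 J2 A => [|j J1 IH] J2 A uJ HA.
  rewrite big_nil mul1e -N_indep//.
  under eq_integral do rewrite big_nil.
  by rewrite integral_cst ?mul1e//; exact: (mA _ _ HA).
have mAJ2 := mA _ _ HA.
pose G w := \prod_(i <- J1) count_fun (phi i) (N i w).
pose Ck k := [set w | N j w = k%:R%:E].
have sCk k : sigma_of (N j) (Ck k).
  by exists [set k%:R%:E] => //; rewrite setTI.
have mCk k : measurable (Ck k).
  by have [E mE <-] := sCk k; exact: mN.
transitivity (\int[P]_(w in \bigcap_(i in [set` J2]) A i)
    \sum_(k <oo) ((phi j k)%:E * ((\1_(Ck k) w)%:E * G w))).
  by apply: eq_integral => w _; rewrite big_cons count_funZ.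
rewrite integral_nneseries//; last 2 first.
- move=> k; apply: measurable_funTS; apply: measurable_funeM.
  apply: emeasurable_funM; last exact: mprod.
  exact/measurable_EFinP/measurable_indic.
- by move=> k w _; rewrite !mule_ge0 ?lee_fin// prod_ge0.
rewrite big_cons -muleA -nneseriesZr; last 2 first.
- by move=> k; rewrite mule_ge0// lee_fin.
- rewrite mule_ge0//; last first.
    by elim/big_ind : _ => // *; exact: mule_ge0.
  elim/big_ind : _ => [|*|i _]; [by []|exact: mule_ge0|].
  by apply: nneseries_ge0 => k _ _; rewrite mule_ge0// lee_fin.
apply: eq_eseriesr => k _.
rewrite ge0_integralZl//; last 3 first.
- apply: measurable_funTS; apply: emeasurable_funM; last exact: mprod.
  exact/measurable_EFinP/measurable_indic.
- by move=> w _; rewrite mule_ge0 ?lee_fin// prod_ge0.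
- by rewrite lee_fin.
rewrite -muleA; congr (_ * _).
pose A' i := if i == j then Ck k else A i.
have jJ2 : j \notin J2.
  by move: uJ; rewrite /= mem_cat negb_or => /andP[/andP[]].
have A'E i : i \in J2 -> A' i = A i.
  by move=> iJ2; rewrite /A'; case: eqP iJ2 jJ2 => // -> ->.
have capE : \bigcap_(i in [set` j :: J2]) A' i =
    (\bigcap_(i in [set` J2]) A i) `&` Ck k.
  apply/seteqP; split => [w Hw|w [Hw Cw] i /=].
    split; last by have := Hw j; rewrite /= mem_head /A' eqxx; exact.
    by move=> i /= iJ2; rewrite -A'E//; apply: Hw; rewrite /= inE iJ2 orbT.
  by rewrite /= inE /A'; case: eqP => //= _ iJ2; exact: Hw.
rewrite muleCA (_ : P _ * _ = \prod_(i <- j :: J2) P (A' i)); last first.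
  rewrite big_cons /A' eqxx; congr (_ * _).
  by apply: eq_big_seq => i iJ2; rewrite -[in RHS]/(A' i) A'E.
rewrite -IH; last 2 first.
- by rewrite -cat1s uniq_catCA.
- move=> i; rewrite inE /A'; case: eqP => [->//|_ /=]; exact: HA.
rewrite capE integral_mkcondr; apply: eq_integral => w _.
by rewrite patchE indicE; case: ifPn => _; rewrite ?mul1e ?mul0e.
Qed.

Lemma integral_prod_count (J : seq I) : uniq J ->
  \int[P]_w \prod_(j <- J) count_fun (phi j) (N j w) =
  \prod_(j <- J) (\sum_(k <oo) (phi j k)%:E * P [set w | N j w = k%:R%:E]).
Proof.
move=> uJ; have := @integral_prod_count_gen J [::] (fun=> setT).
rewrite cats0 big_nil mule1 => <- //.
by congr (integral _ _ _); apply/seteqP; split.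
Qed.

End independent_products.

Lemma poisson_pgf (R : realType) (s r : R) : (0 <= s)%R -> (0 <= r)%R ->
  \sum_(k <oo) (s ^+ k)%:E * (r ^+ k / k`!%:R * expR (- r))%:E =
  (expR (- ((1 - s) * r)))%:E.
Proof.
move=> s0 r0.
under eq_eseriesr => k _.
  rewrite -EFinM mulrA mulrA -exprMn mulrC EFinM; over.
rewrite /= nneseriesZl/=; last first.
  by move=> n _; rewrite lee_fin divr_ge0// exprn_ge0// mulr_ge0.
rewrite (_ : \sum_(_ <oo) _ = (expR (s * r))%:E).
  by rewrite -EFinM -expRD; congr (expR _)%:E; rewrite mulrBl mul1r opprB addrC.
rewrite expRE -EFin_lim; last first.
  rewrite /pseries/=; under eq_fun do rewrite mulrC.
  exact: is_cvg_series_exp_coeff.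
apply/congr_lim/funext => n/=; rewrite /pseries/= /series/= -sumEFin//.
by under eq_bigr do rewrite mulrC.
Qed.

(** * First properties of Poisson processes *)

Lemma npts_eventually d (T : measurableType d) (R : realType) (y : nat -> T)
    (B : set T) k : npts R y B = k%:R%:E ->
  exists n0, forall n, (n0 <= n)%N -> (\sum_(i < n) (y i \in B))%N = k.
Proof.
move=> Nk.
have [n0 kn0] : exists n, (k <= \sum_(i < n) (y i \in B))%N.
  by apply/(npts_natP R); rewrite Nk.
exists n0 => n n0n; apply/eqP; rewrite eqn_leq; apply/andP; split.
  have : (\sum_(i < n) (y i \in B))%N%:R%:E <= npts R y B.
    by apply/npts_natP; exists n.
  by rewrite Nk lee_fin ler_nat.
rewrite (leq_trans kn0)// -!(big_mkord xpredT (fun i => nat_of_bool (y i \in B))).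
by rewrite [leqRHS](@big_cat_nat _ _ _ n0)//= leq_addr.
Qed.

Section poisson_counts.
Context d (T : measurableType d) (R : realType).
Context dW (W : measurableType dW) (P : probability W R).
Variables (L : {sigma_finite_measure set T -> \bar R}) (X : nat -> W -> T).
Hypothesis mX : forall i, measurable_fun setT (X i).
Hypothesis X_poisson : poisson_process P L X.

Local Notation N B := (fun w => npts R (X ^~ w) B).

Let mN B : measurable B -> measurable_fun setT (N B).
Proof.
move=> mB; apply: (measurableT_comp (measurable_npts_cfg mB)).
exact: (measurable_to_cfg (Y := fun w => X ^~ w)).
Qed.

Let mNk B (k : nat) : measurable B -> measurable [set w | N B w = k%:R%:E].
Proof.
move=> mB; have mk : measurable [set (k%:R%:E : \bar R)] by [].
by have := mN mB measurableT mk; rewrite setTI.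
Qed.

Lemma poisson_count B (r : R) k : measurable B -> L B = r%:E ->
  P [set w | N B w = k%:R%:E] = (r ^+ k / k`!%:R * expR (- r))%:E.
Proof. by move=> mB LB; case: X_poisson => h _ _; exact: (h B r mB LB k). Qed.

Lemma poisson_count_finite B : measurable B -> L B < +oo ->
  {ae P, forall w, exists k : nat, N B w = k%:R%:E}.
Proof.
move=> mB LB.
have LBE : L B = (fine (L B))%:E by rewrite fineK// ge0_fin_numE.
have mU : measurable (\bigcup_k [set w | N B w = k%:R%:E]).
  by apply: bigcup_measurable => k _; exact: mNk.
exists (~` \bigcup_k [set w | N B w = k%:R%:E]); split.
- exact: measurableC.
- rewrite probability_setC// measure_bigcup//; last 2 first.
  + by move=> k _; exact: mNk.
  + apply/trivIsetP => i j _ _ ij; apply/seteqP; split => // w [/= -> H].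
    by have /eqP := congr1 fine H; rewrite /= eqr_nat (negbTE ij).
  rewrite [X in _ - X](_ : _ = 1) ?subee//.
  rewrite -[RHS](_ : (expR (- ((1 - 1) * fine (L B))))%:E = _); last first.
    by rewrite subrr mul0r oppr0 expR0.
  rewrite -poisson_pgf// ?fine_ge0//.
  rewrite [LHS](_ : _ = \sum_(k <oo) P [set w | N B w = k%:R%:E]).
    by apply: eq_eseriesr => k _; rewrite expr1n mul1e; exact: poisson_count.
  by apply: eq_eseriesl => k; rewrite in_setT.
- by move=> w /= nk [k _ Nk]; apply: nk; exists k.
Qed.

Lemma integral_count_fun (phi : nat -> R) B : measurable B -> (forall k, (0 <= phi k)%R) ->
  \int[P]_w count_fun phi (N B w) = \sum_(k <oo) (phi k)%:E * P [set w | N B w = k%:R%:E].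
Proof.
move=> mB phi0; rewrite /count_fun integral_nneseries//; last 2 first.
- move=> k; apply: measurable_funeM; apply/measurable_EFinP.
  have mk : measurable [set (k%:R%:E : \bar R)] by [].
  apply: (measurableT_comp _ (mN mB)); exact: (measurable_indic mk).
- by move=> k w _; rewrite mule_ge0 ?lee_fin.
apply: eq_eseriesr => k _.
have mk1 : measurable_fun setT (fun w => (\1_[set w | N B w = k%:R%:E] w)%:E : \bar R).
  by apply/measurable_EFinP/measurable_indic; exact: mNk.
under eq_integral => w _ do rewrite (_ : \1_[set k%:R%:E] _ = \1_[set w | N B w = k%:R%:E] w)//.
rewrite ge0_integralZl ?lee_fin//.
by rewrite integral_indic ?setIT//; exact: mNk.
Qed.

Lemma poisson_mean_finite B : measurable B -> L B < +oo ->
  \int[P]_w N B w = L B.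
Proof.
move=> mB LB; have LBE : L B = (fine (L B))%:E by rewrite fineK// ge0_fin_numE.
set r := fine (L B) in LBE.
have r0 : (0 <= r)%R by exact: fine_ge0.
transitivity (\int[P]_w count_fun (fun k => k%:R%R) (N B w)).
  apply: ae_eq_integral => //; first exact: mN.
    by apply: measurableT_comp; [exact: measurable_count_fun|exact: mN].
  apply: filterS (poisson_count_finite mB LB) => w [k ->] _.
  by rewrite count_fun_nat.
rewrite integral_count_fun//.
under eq_eseriesr do rewrite (poisson_count _ mB LBE) -EFinM.
rewrite nneseries_recl//; last first.
  by move=> k _; rewrite lee_fin !mulr_ge0 ?exprn_ge0 ?expR_ge0.
rewrite mul0r add0e -(nneseries_addn 1)//; last first.
  by move=> k; rewrite lee_fin !mulr_ge0 ?exprn_ge0 ?expR_ge0.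
rewrite LBE -[RHS]mule1 -[X in _ * X](_ : (expR (- ((1 - 1) * r)))%:E = _); last first.
  by rewrite subrr mul0r oppr0 expR0.
rewrite -poisson_pgf// -nneseriesZl//; last first.
  by move=> k _; rewrite -EFinM lee_fin !mulr_ge0 ?exprn_ge0 ?expR_ge0.
apply: eq_eseriesr => k _; rewrite -!EFinM; congr EFin.
rewrite expr1n mul1r addn1 factS natrM exprS.
by field; rewrite pnatr_eq0 -lt0n fact_gt0/= addrC natr1 pnatr_eq0.
Qed.

(** [1 - (1 + r) exp (- r) <= r ^ 2], from [exp (- r) >= 1 - r]. *)
Lemma poisson_two_points B r : measurable B -> L B = r%:E ->
  P [set w | 2%:R%:E <= N B w] <= (r ^+ 2)%:E.
Proof.
move=> mB LB; have r0 : (0 <= r)%R by rewrite -lee_fin -LB.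
have m0 := mNk 0 mB; have m1 := mNk 1 mB.
rewrite (_ : [set w | _] = ~` ([set w | N B w = 0%:R%:E] `|` [set w | N B w = 1%:R%:E])).
  rewrite probability_setC; last exact: measurableU.
  rewrite measureU//; last first.
    by apply/seteqP; split => // w [/= ->] [] /esym /eqP; rewrite oner_eq0.
  have p0 := poisson_count 0 mB LB; have p1 := poisson_count 1 mB LB.
  rewrite [X in _ - X](_ : _ = (r ^+ 0 / 0`!%:R * expR (- r))%:E + (r ^+ 1 / 1`!%:R * expR (- r))%:E); last by rewrite -p0 -p1.
  rewrite fact0 -EFinD lee_fin expr0 expr1 !divr1.
  have := expR_ge1Dx (- r)%R; set e := expR _ => er.
  rewrite mul1r.
  have : ((1 - r) * (1 + r) <= e * (1 + r))%R by rewrite ler_wpM2r//; lra.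
  by rewrite expr2; lra.
apply/seteqP; split => w /=.
  by move=> N2; apply/not_orP; split => N1; rewrite N1 lee_fin ler_nat in N2.
move=> /not_orP[n0 n1]; have [->|[[|[|k]] Nk]] := npts_value R (X ^~ w) B.
- by rewrite leey.
- by case: n0.
- by case: n1.
- by rewrite Nk lee_fin ler_nat.
Qed.

(** The mean of the Poisson law covers the sets of finite measure; these
    generate the sigma-algebra. *)
Lemma poisson_mean B : measurable B ->
  \sum_(i <oo) P [set w | B (X i w)] = L B.
Proof.
move=> mB.
pose nu : {measure set T -> \bar R} := mseries (fun i => mpush P (mX i)) 0.
suff : L B = nu B by move=> ->; apply: eq_eseriesr.
have [F F1 F2] := sigma_finiteT L.
pose G : set (set T) := [set C | measurable C /\ L C < +oo].
apply: (@g_sigma_algebra_measure_unique _ _ _ G _ F) => //.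
- by move=> C [].
- by move=> C D [mC LC] [mD LD]; split; [exact: measurableI|];
    apply: le_lt_trans LC; rewrite le_measure// inE//; exact: measurableI.
- move=> C [mC LC]; apply: (etrans (esym (poisson_mean_finite mC LC))).
  exact: (mean_npts P (Y := fun w => X ^~ w)).
- by move=> k; case: (F2 k).
- rewrite -[B]setIT F1 setI_bigcupr; apply: sigma_algebra_bigcup => n.
  apply: sub_sigma_algebra; have [mF LF] := F2 n; split; first exact: measurableI.
  by apply: le_lt_trans LF; rewrite le_measure// inE//; exact: measurableI.
Qed.

Lemma poisson_campbell (f : T -> \bar R) : measurable_fun setT f -> (forall x, 0 <= f x) ->
  \sum_(i <oo) \int[P]_w f (X i w) = \int[L]_x f x.
Proof.
move=> mf f0.
pose nu : {measure set T -> \bar R} := mseries (fun i => mpush P (mX i)) 0.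
transitivity (\int[nu]_x f x).
  rewrite ge0_integral_measure_series//; apply: eq_eseriesr => i _.
  by rewrite integral_mpush.
by apply: eq_measure_integral => B mB _; exact: poisson_mean.
Qed.

End poisson_counts.

(** * The avoidance functional *)

Section avoidance_functional.
Context d (T : measurableType d) (R : realType).
Context dW (W : measurableType dW) (P : probability W R).
Variables (L : {sigma_finite_measure set T -> \bar R}) (X : nat -> W -> T).
Hypothesis mX : forall i, measurable_fun setT (X i).
Hypothesis X_poisson : poisson_process P L X.

(** The probability that the first n points all survive, when the point x is
    killed with probability q x independently of the others. *)
Definition avoid (q : T -> R) (n : nat) : \bar R :=
  \int[P]_w (\prod_(i < n) (1 - q (X i w)))%:E.

Let mavoid (q : T -> R) n : measurable_fun setT q ->
  measurable_fun setT (fun w => (\prod_(i < n) (1 - q (X i w)))%:E).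
Proof.
move=> mq; apply/measurable_EFinP; apply: measurable_prod => i _.
by apply: measurable_funB => //; exact: (measurableT_comp mq).
Qed.

Let avoid_prod_ge0 (q : T -> R) n w : (forall x, 0 <= q x <= 1)%R ->
  (0 <= \prod_(i < n) (1 - q (X i w)))%R.
Proof. by move=> q01; apply: prodr_ge0 => i _; have := q01 (X i w); lra. Qed.

Let avoid_prod_le1 (q : T -> R) n w : (forall x, 0 <= q x <= 1)%R ->
  (\prod_(i < n) (1 - q (X i w)) <= 1)%R.
Proof. by move=> q01; apply: prodr_ile1 => i _; have := q01 (X i w); lra. Qed.

Lemma avoid_nonincreasing (q : T -> R) (m n : nat) : (forall x, 0 <= q x <= 1)%R ->
  measurable_fun setT q -> (m <= n)%N -> avoid q n <= avoid q m.
Proof.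
move=> q01 mq mn; apply: ge0_le_integral => //; try exact: mavoid.
- by move=> w _; rewrite lee_fin avoid_prod_ge0.
- move=> w _; rewrite lee_fin -!(big_mkord xpredT (fun i => 1 - q (X i w))%R).
  rewrite (@big_cat_nat _ _ _ m)//= ler_piMr//.
    by rewrite big_mkord avoid_prod_ge0.
  by apply: prodr_ile1 => i _; have := q01 (X i w); lra.
Qed.

(** For a simple q the product over points is a product over the disjoint sets B j of
    powers of [1 - a j], with the independent Poisson numbers of points as
    exponents. These numbers are almost surely finite, so that the products are
    eventually constant in n; the limit is given by the generating function. *)
Lemma avoid_simple m (q : T -> R) (a : 'I_m -> R) (B : 'I_m -> set T) :
  (forall x, 0 <= q x <= 1)%R -> measurable_fun setT q ->
  (forall j, 0 <= a j <= 1)%R -> (forall j, measurable (B j)) ->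
  trivIset setT B -> (forall j, L (B j) < +oo) ->
  (forall x, 1 - q x = \prod_(j < m) (1 - a j) ^+ (x \in B j))%R ->
  avoid q n @[n --> \oo] --> (\prod_(j < m) expR (- (a j * fine (L (B j)))))%:E.
Proof.
move=> q01 mq a01 mB tB LB qE.
have LBE j : L (B j) = (fine (L (B j)))%:E by rewrite fineK// ge0_fin_numE.
pose N j w := npts R (X ^~ w) (B j).
have mN j : measurable_fun setT (N j).
  apply: (measurableT_comp (measurable_npts_cfg (mB j))).
  exact: (measurable_to_cfg (Y := fun w => X ^~ w)).
have N_indep : mutually_independent P (fun j => sigma_of (N j)).
  by case: X_poisson => _ _ h; exact: (h m B mB tB).
pose phi j k := ((1 - a j) ^+ k)%R.
have phi0 j k : (0 <= phi j k)%R by rewrite exprn_ge0//; have := a01 j; lra.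
have -> : (\prod_(j < m) expR (- (a j * fine (L (B j)))))%:E =
    \int[P]_w \prod_(j <- index_enum 'I_m) count_fun (phi j) (N j w).
  rewrite integral_prod_count//; last exact: index_enum_uniq.
  rewrite -prodEFin; apply: eq_bigr => j _.
  rewrite -[X in (- (X * _))%R](_ : (1 - (1 - a j) = _)%R); last by ring.
  rewrite -poisson_pgf ?fine_ge0//; last by have := a01 j; lra.
  by apply: eq_eseriesr => k _; rewrite -(poisson_count X_poisson k (mB j) (LBE j)).
have mG : measurable_fun setT (fun w => \prod_(j <- index_enum 'I_m) count_fun (phi j) (N j w)).
  elim: (index_enum _) => [|j s IH].
    rewrite [X in measurable_fun _ X](_ : _ = cst 1)//.
    by apply/funext => w; rewrite big_nil.
  under eq_fun do rewrite big_cons.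
  apply: emeasurable_funM => //; apply: measurableT_comp => //.
  exact: measurable_count_fun.
have [] // := @dominated_convergence _ _ _ P setT measurableT
  (fun n w => (\prod_(i < n) (1 - q (X i w)))%:E) _ (cst 1) (fun n => mavoid n mq) mG.
- have : {ae P, forall w, forall j, exists k : nat, N j w = k%:R%:E}.
    by apply: filter_forall => j; exact: (poisson_count_finite mX X_poisson (mB j) (LB j)).
  apply: filterS => w Nfin _.
  have /choice[k Nk] := Nfin.
  have /choice[n0 n0E] : forall j, exists n0, forall n, (n0 <= n)%N ->
      (\sum_(i < n) (X i w \in B j))%N = k j.
    by move=> j; exact: npts_eventually (Nk j).
  rewrite (_ : \prod_(j <- _) _ = (\prod_(j < m) (1 - a j) ^+ k j)%:E); last first.
    by rewrite -prodEFin; apply: eq_bigr => j _; rewrite Nk count_fun_nat.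
  apply: cvg_near_cst; exists (\max_(j < m) n0 j)%N => // n /= n0n; congr EFin.
  under eq_bigr do rewrite qE.
  rewrite exchange_big/=; apply: eq_bigr => j _.
  rewrite prodrXr n0E// (leq_trans _ n0n)//; exact: leq_bigmax.
- exact: finite_measure_integrable_cst.
- apply: aeW => w n _ /=; rewrite lee_fin ger0_norm ?avoid_prod_ge0//.
  exact: avoid_prod_le1.
Qed.

Lemma avoid_simple_integral m (q : T -> R) (a : 'I_m -> R) (B : 'I_m -> set T) :
  (forall x, 0 <= q x <= 1)%R -> measurable_fun setT q ->
  (forall j, 0 <= a j <= 1)%R -> (forall j, measurable (B j)) ->
  trivIset setT B -> (forall j, L (B j) < +oo) ->
  (forall x, (forall j, ~ B j x) -> q x = 0%R) ->
  (forall x j, B j x -> q x = a j) ->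
  avoid q n @[n --> \oo] --> expeR (- \int[L]_x (q x)%:E).
Proof.
move=> q01 mq a01 mB tB LB q0 qa.
have LBE j : L (B j) = (fine (L (B j)))%:E by rewrite fineK// ge0_fin_numE.
have disj x j i : B j x -> i != j -> (x \in B i) = false.
  move=> Bjx ij; apply/negbTE/negP => /set_mem Bix.
  by move: ij; rewrite (tB i j I I)// ?eqxx//; exists x.
have qE x : q x = (\sum_(j < m) a j * \1_(B j) x)%R.
  have [[j Bj]|nB] := pselect (exists j, B j x).
    rewrite (bigD1 j)//= big1 ?addr0 => [|i ij].
      by rewrite indicE mem_set// mulr1; exact: qa.
    by rewrite indicE (disj _ _ _ Bj)// mulr0.
  rewrite q0 => [|j Bj]; last by apply: nB; exists j.
  rewrite big1// => j _; rewrite indicE memNset ?mulr0// => Bj.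
  by apply: nB; exists j.
have IE : \int[L]_x (q x)%:E = (\sum_(j < m) a j * fine (L (B j)))%:E.
  under eq_integral do rewrite qE -sumEFin.
  rewrite ge0_integral_sum//; last 2 first.
  - move=> j; apply/measurable_EFinP; apply: measurable_funM => //.
  - by move=> j x _; rewrite lee_fin mulr_ge0//; case/andP: (a01 j).
  rewrite -sumEFin; apply: eq_bigr => j _.
  under eq_integral do rewrite EFinM.
  rewrite ge0_integralZl//; last 2 first.
  - exact/measurable_EFinP/measurable_indic.
  - by rewrite lee_fin; case/andP: (a01 j).
  by rewrite integral_indic// setIT EFinM -LBE.
rewrite IE /= -sumrN expR_sum.
apply: (avoid_simple q01 mq a01 mB tB LB) => x.
have [[j Bj]|nB] := pselect (exists j, B j x).
  rewrite (bigD1 j)//= big1 ?mulr1 => [|i ij].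
    by rewrite mem_set// expr1 (qa _ _ Bj).
  by rewrite (disj _ _ _ Bj)// expr0.
rewrite q0 => [|j Bj]; last by apply: nB; exists j.
rewrite big1 ?subr0// => j _; rewrite memNset ?expr0// => Bj.
by apply: nB; exists j.
Qed.

Import HBNNSimple.

(** The generating functional of a Poisson process. The general case follows
    from simple functions qn increasing to q, supported in sets of finite
    measure. As avoid decreases in q and in the number of points, the upper bound holds for each qn
    and the lower bound passes to the limit for each fixed number of points. The
    infimum is the limit of a decreasing sequence. *)
Theorem avoidE (q : T -> R) :
  (forall x, 0 <= q x <= 1)%R -> measurable_fun setT q ->
  ereal_inf (range (avoid q)) = expeR (- \int[L]_x (q x)%:E).
Proof.
move=> q01 mq.
have [F F1 F2] := sigma_finiteT L.
pose G n := \bigcup_(k < n) F k.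
have mG n : measurable (G n) by apply: bigcup_measurable => k _; case: (F2 k).
have LG n : L (G n) < +oo.
  rewrite /G bigcup_mkord; apply: (@le_lt_trans _ _ (\sum_(i < n) L (F i))).
    by apply: Boole_inequality => i; case: (F2 i).
  by apply: lte_sum_pinfty => i _; case: (F2 i).
have mq' : measurable_fun setT (EFin \o q) by exact/measurable_EFinP.
pose s := nnsfun_approx measurableT mq'.
pose qn n x := (s n x * \1_(G n) x)%R.
have sq n x : (s n x <= q x)%R.
  rewrite -lee_fin /s nnsfun_approxE; apply: le_approx => //.
  by move=> y _; rewrite lee_fin; case/andP: (q01 y).
have qnq n x : (qn n x <= q x)%R.
  rewrite (le_trans _ (sq n x))// /qn indicE.
  by case: (_ \in _); rewrite ?mulr1 ?mulr0.
have qn01 n x : (0 <= qn n x <= 1)%R.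
  by rewrite mulr_ge0//= (le_trans (qnq n x))//; case/andP: (q01 x).
have mqn n : measurable_fun setT (qn n).
  by apply: measurable_funM => //; exact: measurable_indic.
have qnnd x m n : (m <= n)%N -> (qn m x <= qn n x)%R.
  move=> mn; apply: ler_pM => //; first exact/lefP/nd_nnsfun_approx.
  rewrite !indicE; have [/set_mem[k /= km Fx]|] := boolP (x \in G m); last by [].
  by rewrite mem_set//; exists k => //=; exact: leq_trans mn.
have qncvg x : (qn n x)%:E @[n --> \oo] --> (q x)%:E.
  have : (s n x)%:E @[n --> \oo] --> (q x)%:E.
    apply: (cvg_nnsfun_approx measurableT mq') => // y _.
    by rewrite lee_fin; case/andP: (q01 y).
  apply: cvg_trans; apply: near_eq_cvg.
  have : (\bigcup_k F k) x by rewrite -F1.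
  move=> [k _ Fx]; exists k.+1 => // n /= kn; congr EFin.
  by rewrite /qn indicE mem_set ?mulr1//; exists k.
have simple n : avoid (qn n) k @[k --> \oo] --> expeR (- \int[L]_x (qn n x)%:E).
  have /finite_seqP[r0 r0E] := fimfunP (s n).
  pose r := undup r0.
  have rP z : range (s n) z <-> z \in r by rewrite r0E mem_undup.
  pose a (j : 'I_(size r)) := nth 0%R r j.
  pose B (j : 'I_(size r)) := (s n @^-1` [set a j]) `&` G n.
  have ar (j : 'I_(size r)) : range (s n) (a j) by apply/rP; rewrite mem_nth.
  apply: (@avoid_simple_integral _ (qn n) a B) => //.
  - by move=> j; have [x _ <-] := ar j; rewrite fun_ge0/= (le_trans (sq n x))//; case/andP: (q01 x).
  - by move=> j; apply: measurableI.
  - apply/trivIsetP => i j _ _ ij; apply/seteqP; split => // x [[/= si _] [/= sj _]].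
    move: ij; rewrite (_ : i = j) ?eqxx//; apply/val_inj/eqP.
    by rewrite -(nth_uniq 0%R (ltn_ord i) (ltn_ord j) (undup_uniq _)) -/r -/(a i) -/(a j) -si -sj.
  - move=> j; apply: le_lt_trans (LG n); apply: le_measure; rewrite ?inE//; first exact: measurableI.
    by move=> x [].
  - move=> x nB; rewrite /qn indicE; have [/set_mem Gx|_] := boolP (x \in G n); last by rewrite mulr0.
    have sr : s n x \in r by apply/rP; exists x.
    have ir : (index (s n x) r < size r)%N by rewrite index_mem.
    by case: (nB (Ordinal ir)); split => //=; rewrite /a nth_index.
  - by move=> x j [/= sx Gx]; rewrite /qn indicE mem_set// mulr1.
have Icvg : \int[L]_x (qn n x)%:E @[n --> \oo] --> \int[L]_x (q x)%:E.
  rewrite (_ : \int[L]_x (q x)%:E = \int[L]_x limn (fun n => (qn n x)%:E)).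
    apply: cvg_monotone_convergence => //.
    - by move=> n; exact/measurable_EFinP.
    - by move=> n x _; rewrite lee_fin; case/andP: (qn01 n x).
    - by move=> x _ m n mn; rewrite lee_fin qnnd.
  by apply: eq_integral => x _; apply/esym/cvg_lim => //; exact: qncvg.
have Ile n : \int[L]_x (qn n x)%:E <= \int[L]_x (q x)%:E.
  apply: ge0_le_integral => //.
  - by move=> x _; rewrite lee_fin; case/andP: (qn01 n x).
  - exact/measurable_EFinP.
  - by move=> x _; rewrite lee_fin.
have inf_simple n k : expeR (- \int[L]_x (qn n x)%:E) <= avoid (qn n) k.
  rewrite -(cvg_lim _ (simple n))//; apply: lime_le; first by apply/cvg_ex; eexists; exact: simple.
  by exists k => // l /= kl; exact: avoid_nonincreasing.
apply/eqP; rewrite eq_le; apply/andP; split.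
- have avoid_ge0 k : 0 <= avoid q k.
    by apply: integral_ge0 => w _; rewrite lee_fin avoid_prod_ge0.
  have inf_ge0 : 0 <= ereal_inf (range (avoid q)).
    by apply: le_ereal_inf_tmp => _ [k _ <-].
  have infle n : ereal_inf (range (avoid q)) <= expeR (- \int[L]_x (qn n x)%:E).
    rewrite -(cvg_lim _ (simple n))//; apply: lime_ge; first by apply/cvg_ex; eexists; exact: simple.
    exists 0%N => // k _ /=; apply: ereal_inf_le; exists (avoid q k); first by exists k.
    apply: ge0_le_integral => //; try exact: mavoid.
    + by move=> w _; rewrite lee_fin avoid_prod_ge0.
    + move=> w _; rewrite lee_fin; apply: ler_prod => i _.
      by have := q01 (X i w); have := qnq n (X i w); have := qn01 n (X i w); lra.
  have [y yE] := expeR_total inf_ge0.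
  rewrite -yE lee_expeR leeNr -(cvg_lim _ Icvg)//.
  apply: lime_le; first by apply/cvg_ex; eexists; exact: Icvg.
  by exists 0%N => // n _ /=; have := infle n; rewrite -yE lee_expeR leeNr.
- apply: le_ereal_inf_tmp => _ [k _ <-].
  have prod_cvg w : (\prod_(i < k) (1 - qn n (X i w)))%R @[n --> \oo] -->
      (\prod_(i < k) (1 - q (X i w)))%R.
    have real_cvg x : qn n x @[n --> \oo] --> q x.
      by have /fine_cvgP[] := qncvg x.
    elim: k => [|k IH].
      by under eq_fun do rewrite big_ord0; rewrite big_ord0; exact: cvg_cst.
    under eq_fun do rewrite big_ord_recr/=; rewrite big_ord_recr/=.
    apply: cvgM => //; apply: cvgB; [exact: cvg_cst|exact: real_cvg].
  have cvgk : avoid (qn n) k @[n --> \oo] --> avoid q k.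
    apply: (@dominated_cvg _ _ _ P setT measurableT _ _ (cst 1)) => //.
    + by move=> n; exact: mavoid.
    + move=> w _; apply/fine_cvgP; split; first by exists 0%N.
      exact: prod_cvg.
    + exact: finite_measure_integrable_cst.
    + move=> n w _; rewrite lee_fin ger0_norm ?avoid_prod_ge0//.
      exact: avoid_prod_le1.
  rewrite -(cvg_lim _ cvgk)//; apply: lime_ge; first by apply/cvg_ex; eexists; exact: cvgk.
  exists 0%N => // n _ /=; apply: le_trans (inf_simple n k).
  by rewrite lee_expeR leeN2.
Qed.

End avoidance_functional.

(** * Independent marking *)

Section mixture_measure.
Context dW (W : measurableType dW) d (T : measurableType d) (R : realType).
Variables (mu : {measure set W -> \bar R}) (kappa : W -> {measure set T -> \bar R}).
Hypothesis mkappa : forall B, measurable B -> measurable_fun setT (kappa ^~ B).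

Definition mixture (B : set T) : \bar R := \int[mu]_w kappa w B.

Let mixture0 : mixture set0 = 0.
Proof. by rewrite /mixture integral0_eq// => w _; rewrite measure0. Qed.

Let mixture_ge0 B : 0 <= mixture B.
Proof. exact: integral_ge0. Qed.

Let mixture_sigma_additive : semi_sigma_additive mixture.
Proof.
move=> F mF tF mUF; rewrite /mixture.
rewrite (_ : \int[mu]_w _ = \sum_(n <oo) mixture (F n)).
  by apply: is_cvg_nneseries => n _ _; exact: mixture_ge0.
rewrite -integral_nneseries//; last by move=> n; exact: mkappa.
apply: eq_integral => w _; exact: measure_semi_bigcup.
Qed.

Definition mixture_measure : {measure set T -> \bar R} :=
  HB.pack mixture (isMeasure.Build _ _ _ mixture
    mixture0 mixture_ge0 mixture_sigma_additive).

End mixture_measure.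

Section marking.
Context d (T : measurableType d) dK (K : measurableType dK) (R : realType).
Context dW (W : measurableType dW) (P : probability W R) (Q : probability K R).
Variables (X : nat -> W -> T) (Z : nat -> W -> K).
Hypothesis mX : forall i, measurable_fun setT (X i).
Hypothesis mZ : forall i, measurable_fun setT (Z i).
Hypothesis Z_law : forall i U, measurable U -> P (Z i @^-1` U) = Q U.
Hypothesis Z_indep : mutually_independent P (fun i => sigma_of (Z i)).
Hypothesis XZ_indep : independent P (sigma_of_seq X) (sigma_of_seq Z).

Let mXZ i : measurable_fun setT (fun w => (X i w, Z i w)).
Proof. exact: measurable_fun_pair. Qed.

Let sub_X A : sigma_of_seq X A -> measurable A.
Proof.
apply: smallest_sub; first exact: sigma_algebra_measurable.
by move=> _ [i _ [B mB <-]]; exact: mX.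
Qed.

Definition mark_prob (F : set (T * K)) (x : T) : R := fine (Q (xsection F x)).

Lemma mark_probE F x : measurable F -> (mark_prob F x)%:E = Q (xsection F x).
Proof.
by move=> mF; rewrite /mark_prob fineK// fin_num_measure//; exact: measurable_xsection.
Qed.

Lemma mark_prob01 F x : measurable F -> (0 <= mark_prob F x <= 1)%R.
Proof.
move=> mF; rewrite fine_ge0//= -lee_fin mark_probE//.
by apply: probability_le1; exact: measurable_xsection.
Qed.

Lemma measurable_mark_prob F : measurable F -> measurable_fun setT (mark_prob F).
Proof.
move=> mF; apply/measurable_EFinP.
rewrite (_ : EFin \o _ = fun x => Q (xsection F x)).
  exact: measurable_fun_xsection.
by apply/funext => x; rewrite /= mark_probE.
Qed.

(** Independent marks can be integrated out one at a time. As functions of the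
    set F i, both sides are finite measures on pairs of a point and a mark, so
    that F i may be taken to be a rectangle A' x K'. The condition on the point then
    joins A and the condition on the mark joins those indexed by J2, which
    leaves a shorter list J1. *)
Lemma marking_hybrid (J1 J2 : seq nat) (A : set W) (F : nat -> set (T * K))
    (B : nat -> set K) :
  uniq (J1 ++ J2) -> sigma_of_seq X A -> (forall i, measurable (F i)) ->
  (forall i, measurable (B i)) ->
  P (A `&` \bigcap_(i in [set` J1]) [set w | F i (X i w, Z i w)]
       `&` \bigcap_(j in [set` J2]) (Z j @^-1` B j)) =
  (\int[P]_(w in A) (\prod_(i <- J1) mark_prob (F i) (X i w))%:E) *
  \prod_(j <- J2) Q (B j).
Proof.
have mZB j C : measurable C -> measurable (Z j @^-1` C).
  by move=> mC; rewrite -[X in measurable X]setTI; exact: mZ.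
have mXZF i C : measurable C -> measurable [set w | C (X i w, Z i w)].
  by move=> mC; rewrite -[X in measurable X]setTI; exact: (mXZ i).
move=> + + mF; elim: J1 J2 A B => [|i J1 IH] J2 A B uJ sA mB; have mA := sub_X sA.
  rewrite (_ : \bigcap_(i in _) _ = setT) ?setIT; last by apply/seteqP; split.
  rewrite XZ_indep//; last first.
    apply: (@fin_bigcap_measurable _ (g_sigma_algebraType (\bigcup_i sigma_of (Z i)))).
      exact: finite_seq.
    move=> j _; apply: sub_sigma_algebra; exists j => //.
    by exists (B j) => //; rewrite setTI.
  under eq_integral do rewrite big_nil.
  rewrite integral_cst// mul1e; congr (_ * _).
  rewrite Z_indep//; last by move=> j _; exists (B j) => //; rewrite setTI.
  by apply: eq_bigr => j _; exact: Z_law.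
pose G w := (\prod_(j <- J1) mark_prob (F j) (X j w))%R.
have G0 w : (0 <= G w)%R.
  by apply: prodr_ge0 => j _; case/andP: (mark_prob01 (X j w) (mF j)).
have G1 w : (G w <= 1)%R.
  by apply: prodr_ile1 => j _; exact: mark_prob01.
have mG : measurable_fun setT G.
  apply: measurable_prod => j _.
  by apply: measurableT_comp => //; exact: measurable_mark_prob.
pose c := \prod_(j <- J2) Q (B j).
have c0 : 0 <= c by rewrite /c; elim/big_ind : _ => // *; exact: mule_ge0.
have c1 : c <= 1.
  rewrite /c; elim: (J2) => [|j s IHs]; first by rewrite big_nil.
  rewrite big_cons -[leRHS]mule1; apply: lee_pmul => //.
    by elim/big_ind : _ => // *; exact: mule_ge0.
  exact: probability_le1.
have cE : c = (fine c)%:E.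
  by rewrite fineK// ge0_fin_numE// (le_lt_trans c1)// ltry.
pose D := A `&` \bigcap_(i in [set` J1]) [set w | F i (X i w, Z i w)]
       `&` \bigcap_(j in [set` J2]) (Z j @^-1` B j).
have mD : measurable D.
  apply: measurableI; first apply: measurableI => //.
    by apply: fin_bigcap_measurable => // j _; exact: mXZF.
  by apply: fin_bigcap_measurable => // j _; exact: mZB.
pose nu1 : {measure set (T * K) -> \bar R} := mpush (mrestr P mD) (mXZ i).
have mpairw w : measurable_fun setT (fun z : K => (X i w, z)) by exact: measurable_pair1.
have s0 w : (0 <= \1_A w * G w * fine c)%R by rewrite !mulr_ge0// fine_ge0.
pose kap w : {measure set (T * K) -> \bar R} := mscale (NngNum (s0 w)) (mpush Q (mpairw w)).
have kapE w C : measurable C -> kap w C = (G w * mark_prob C (X i w))%:E * (\1_A w)%:E * c.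
  move=> mC; rewrite /kap/= /mscale/= cE -!EFinM.
  transitivity ((\1_A w * G w * fine c)%:E * (mark_prob C (X i w))%:E); last first.
    by rewrite -EFinM; congr EFin; ring.
  rewrite mark_probE//; congr (_ * Q _).
  by apply/seteqP; split => z; rewrite /xsection/= inE.
have mkap C : measurable C -> measurable_fun setT (kap ^~ C).
  move=> mC; under eq_fun do rewrite kapE//.
  apply: emeasurable_funM => //; apply: emeasurable_funM.
    apply/measurable_EFinP; apply: measurable_funM => //.
    by apply: measurableT_comp => //; exact: measurable_mark_prob.
  exact/measurable_EFinP/measurable_indic.
pose nu2 := mixture_measure P mkap.
have nu2E C : measurable C -> nu2 C =
    (\int[P]_(w in A) (G w * mark_prob C (X i w))%:E) * c.
  move=> mC; rewrite /nu2/= /mixture.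
  under eq_integral do rewrite kapE//.
  rewrite ge0_integralZr//; last 2 first.
  - apply: emeasurable_funM; last exact/measurable_EFinP/measurable_indic.
    apply/measurable_EFinP; apply: measurable_funM => //.
    by apply: measurableT_comp => //; exact: measurable_mark_prob.
  - move=> w _; rewrite mule_ge0 ?lee_fin// mulr_ge0//.
    by case/andP: (mark_prob01 (X i w) mC).
  congr (_ * _); rewrite [RHS]integral_mkcond; apply: eq_integral => w _.
  by rewrite patchE indicE; case: ifPn => _; rewrite ?mule1 ?mule0.
have key : nu1 (F i) = nu2 (F i).
  pose C0 := [set B1 `*` B2 | B1 in @measurable _ T & B2 in @measurable _ K].
  apply: (@measure_unique _ _ _ C0 (fun=> setT)) => //.
  - by rewrite measurable_prod_measurableType.
  - move=> _ _ [X1 mX1 [X2 mX2 <-]] [Y1 mY1 [Y2 mY2 <-]].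
    exists (X1 `&` Y1); first exact: measurableI.
    by exists (X2 `&` Y2); [exact: measurableI|rewrite setXI].
  - by move=> _; exists setT => //; exists setT => //; rewrite setXTT.
  - by rewrite bigcup_const.
  - move=> _ [A' mA' [K' mK' <-]].
    rewrite nu2E; last exact: measurableX.
    have mXA : measurable (X i @^-1` A') by rewrite -[X in measurable X]setTI; exact: mX.
    have sA' : sigma_of_seq X (A `&` X i @^-1` A').
      apply: (@measurableI _ (g_sigma_algebraType (\bigcup_i sigma_of (X i)))) => //.
      by apply: sub_sigma_algebra; exists i => //; exists A' => //; rewrite setTI.
    pose B' j := if j == i then K' else B j.
    have mB' j : measurable (B' j) by rewrite /B'; case: ifP.
    have B'J2 j : j \in J2 -> B' j = B j.
      rewrite /B'; case: eqP => // -> iJ2.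
      by move: uJ; rewrite /= mem_cat iJ2 orbT.
    transitivity (P (A `&` X i @^-1` A' `&` \bigcap_(i in [set` J1]) [set w | F i (X i w, Z i w)]
       `&` \bigcap_(j in [set` (i :: J2)]) (Z j @^-1` B' j))).
      congr (P _); apply/seteqP; split => w.
        move=> [[/= XA ZK] [[Aw E] C]]; split; first by split.
        move=> j /=; rewrite inE; have [-> _|_ /= jJ2] := eqVneq j i; first by rewrite /B' eqxx.
        by rewrite B'J2//; exact: C.
      move=> [[[Aw XA] E] C]; split; last first.
        split; first by split.
        by move=> j /= jJ2; rewrite -(B'J2 j jJ2); apply: C; rewrite /= inE jJ2 orbT.
      by split => //; have := C i; rewrite /= /B' eqxx mem_head; exact.
    rewrite IH//; last by rewrite -cat1s uniq_catCA.
    rewrite big_cons {1}/B' eqxx muleA (_ : \prod_(j <- J2) Q (B' j) = c); last first.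
      by apply: eq_big_seq => j jJ2; rewrite B'J2.
    congr (_ * _); rewrite integral_mkcondr muleC.
    have mGX : measurable_fun setT ((fun w => (G w)%:E) \_ (X i @^-1` A')).
      by apply/(measurable_restrictT _ _).1 => //; apply/measurable_EFinP; exact: measurable_funTS.
    rewrite -ge0_integralZl//; last 2 first.
    - exact: measurable_funTS.
    - by move=> w _; rewrite patchE; case: ifP => // _; rewrite lee_fin; exact: G0.
    apply: eq_integral => w _; rewrite patchE -/(G w).
    rewrite EFinM mark_probE; last exact: measurableX.
    have [/set_mem XA|XA] := boolP (w \in X i @^-1` A').
      by rewrite in_xsectionX ?mem_set// muleC.
    rewrite notin_xsectionX ?measure0 ?mule0//.
  - by move=> k; rewrite /nu1/= /pushforward /mrestr preimage_setT setTI (le_lt_trans (probability_le1 P mD))// ltry.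
under eq_integral do rewrite big_cons mulrC.
rewrite -/c -nu2E// -key /nu1/= /mrestr; congr (P _).
apply/seteqP; split => w.
  move=> [[Aw E] C]; split; first by apply: (E i); rewrite /= mem_head.
  by split => //; split => // j /= jJ; apply: (E j); rewrite /= inE jJ orbT.
move=> [Fw [[Aw E] C]]; split => //; split => // j /=; rewrite inE => /orP[/eqP->//|].
exact: E.
Qed.

End marking.

(** * Marked Poisson processes *)

(** Product measures require sigma-finiteness as part of the type; it is added
    here to a measure for which it is only known as a property. *)
Section pack_sigma_finite.
Context d (T : measurableType d) (R : realType).
Variables (m : {measure set T -> \bar R}) (sf : sigma_finite setT m).

Definition sigma_finite_copy : set T -> \bar R := let _ := sf in m.

HB.instance Definition _ := isMeasure.Build _ T R sigma_finite_copy
  (@measure0 _ _ _ m) (@measure_ge0 _ _ _ m) (@measure_semi_sigma_additive _ _ _ m).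
HB.instance Definition _ := Measure_isSigmaFinite.Build _ T R sigma_finite_copy sf.

Definition pack_sigma_finite : {sigma_finite_measure set T -> \bar R} :=
  sigma_finite_copy.

End pack_sigma_finite.

Lemma integral_pack_sigma_finite d (T : measurableType d) (R : realType)
    (m : {measure set T -> \bar R}) (sf : sigma_finite setT m) (f : T -> \bar R) :
  \int[pack_sigma_finite sf]_x f x = \int[m]_x f x.
Proof. exact: eq_measure_integral. Qed.

Section lebesgue_real_line.
Context (R : realType).

(** Lebesgue measure on the type R itself: [lebesgue_measure] lives on a copy of
    R whose measurable structure carries another display. *)
Definition lebR : set R -> \bar R := @lebesgue_measure R.

Let lebR0 : lebR set0 = 0. Proof. exact: measure0. Qed.
Let lebR_ge0 A : 0 <= lebR A. Proof. exact: measure_ge0. Qed.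
Let lebR_sigma_additive : semi_sigma_additive lebR.
Proof. exact: (@measure_semi_sigma_additive _ _ _ (@lebesgue_measure R)). Qed.

HB.instance Definition _ := isMeasure.Build _ R _ lebR
  lebR0 lebR_ge0 lebR_sigma_additive.

Let lebR_sigma_finite : sigma_finite setT lebR.
Proof. by have [F F1 F2] := sigma_finiteT (@lebesgue_measure R); exists F. Qed.

HB.instance Definition _ := Measure_isSigmaFinite.Build _ R _ lebR
  lebR_sigma_finite.

End lebesgue_real_line.

Section product_sigma_finite.
Context d1 d2 (T1 : measurableType d1) (T2 : measurableType d2) (R : realType).
Variables (m1 : {sigma_finite_measure set T1 -> \bar R}).
Variables (m2 : {sigma_finite_measure set T2 -> \bar R}).

Let prod_sigma_finite_subproof : sigma_finite setT (m1 \x m2).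
Proof.
have /sigma_finiteP[F [F1 Fnd F2]] := sigma_finiteT m1.
have /sigma_finiteP[G [G1 Gnd G2]] := sigma_finiteT m2.
exists (fun n => F n `*` G n).
  apply/seteqP; split => // -[x y] _.
  have [n _ Fx] : (\bigcup_n F n) x by rewrite -F1.
  have [m _ Gy] : (\bigcup_n G n) y by rewrite -G1.
  exists (maxn n m) => //; split => /=.
    by have /subsetPset := Fnd _ _ (leq_maxl n m); exact.
  by have /subsetPset := Gnd _ _ (leq_maxr n m); exact.
move=> n; have [mF LF] := F2 n; have [mG LG] := G2 n.
split; first exact: measurableX.
by rewrite product_measure1E// lte_mul_pinfty// ge0_fin_numE.
Qed.

Definition prod_sigma_finite : {sigma_finite_measure set (T1 * T2)%type -> \bar R} :=
  pack_sigma_finite prod_sigma_finite_subproof.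

End product_sigma_finite.

Section marked_poisson.
Context d (T : measurableType d) dK (K : measurableType dK) (R : realType).
Context dW (W : measurableType dW) (P : probability W R) (Q : probability K R).
Variables (L : {sigma_finite_measure set T -> \bar R}).
Variables (X : nat -> W -> T) (Z : nat -> W -> K).
Hypothesis mX : forall i, measurable_fun setT (X i).
Hypothesis mZ : forall i, measurable_fun setT (Z i).
Hypothesis X_poisson : poisson_process P L X.
Hypothesis Z_law : forall i U, measurable U -> P (Z i @^-1` U) = Q U.
Hypothesis Z_indep : mutually_independent P (fun i => sigma_of (Z i)).
Hypothesis XZ_indep : independent P (sigma_of_seq X) (sigma_of_seq Z).

Definition marked (w : W) (i : nat) : T * K := (X i w, Z i w).

Lemma measurable_marked i : measurable_fun setT (fun w => marked w i).
Proof. exact: measurable_fun_pair. Qed.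

Let marking_noset (J : seq nat) (F : nat -> set (T * K)) : uniq J ->
  (forall i, measurable (F i)) ->
  P (\bigcap_(i in [set` J]) [set w | F i (marked w i)]) =
  \int[P]_w (\prod_(i <- J) mark_prob Q (F i) (X i w))%:E.
Proof.
move=> uJ mF.
have := @marking_hybrid _ _ _ _ _ _ _ P Q X Z mX mZ Z_law Z_indep XZ_indep
  J [::] setT F (fun=> setT).
rewrite cats0 big_nil mule1 setTI => <- //.
- by congr (P _); apply/seteqP; split => [w H|w []//]; split => // j.
- exact: (@measurableT _ (g_sigma_algebraType (\bigcup_i sigma_of (X i)))).
Qed.

(** Integrate out the mark of each point and apply Campbell's formula. *)
Lemma marked_mean F : measurable F ->
  \sum_(i <oo) P [set w | F (marked w i)] = (L \x Q) F.
Proof.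
move=> mF.
transitivity (\sum_(i <oo) \int[P]_w (Q (xsection F (X i w)))).
  apply: eq_eseriesr => i _.
  rewrite -[LHS](_ : P (\bigcap_(j in [set` [:: i]]) [set w | F (marked w j)]) = _).
    rewrite (marking_noset _ (fun=> mF))//; apply: eq_integral => w _.
    by rewrite big_seq1 mark_probE.
  congr (P _); apply/seteqP; split => w; first by move=> /(_ i); apply; rewrite /= mem_head.
  by move=> Fw j /=; rewrite inE => /eqP ->.
by apply: (poisson_campbell mX X_poisson (f := fun x => Q (xsection F x))) => //;
  exact: measurable_fun_xsection.
Qed.

(** Given the points, the marks put the point x into F with probability
    [Q (xsection F x)], independently: the probability of missing F is the
    avoidance functional of this function of x. *)
Lemma marked_missing F : measurable F ->
  P (marked @^-1` missing F) = expeR (- (L \x Q) F).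
Proof.
move=> mF.
have mFC : measurable (~` F) by exact: measurableC.
pose G n := \bigcap_(i in [set` iota 0 n]) [set w | (~` F) (marked w i)].
have PG n : P (G n) = avoid P X (mark_prob Q F) n.
  rewrite /G (marking_noset _ (fun=> mFC)) ?iota_uniq//.
  apply: eq_integral => w _; rewrite -{1}(subn0 n) -/(index_iota 0 n) big_mkord.
  congr EFin; apply: eq_bigr => i _; apply: EFin_inj.
  rewrite EFinB !mark_probE// -probability_setC; last exact: measurable_xsection.
  by congr (Q _); apply/seteqP; split => z; rewrite /xsection/= !inE.
have mG n : measurable (G n).
  apply: fin_bigcap_measurable => // i _.
  by rewrite -[X in measurable X]setTI; exact: measurable_marked.
have GE : marked @^-1` missing F = \bigcap_n G n.
  apply/seteqP; split => [w nF n _ i _|w H i]; first exact: nF.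
  apply: (H i.+1 I i); change (is_true (i \in iota 0 i.+1)).
  by rewrite mem_iota add0n ltnSn.
have Gdecr : {homo G : n m / (n <= m)%N >-> (m <= n)%O}.
  move=> n m nm; apply/subsetPset => w H i ni; apply: H.
  change (is_true (i \in iota 0 n)) in ni; change (is_true (i \in iota 0 m)).
  by move: ni; rewrite !mem_iota !add0n => /leq_trans; exact.
have cvg1 : P (G n) @[n --> \oo] --> P (\bigcap_n G n).
  apply: nonincreasing_cvg_mu => //; last exact: bigcapT_measurable.
  by rewrite (le_lt_trans (probability_le1 P _))// ltry.
have cvg2 : P (G n) @[n --> \oo] --> ereal_inf (range (P \o G)).
  apply: ereal_nonincreasing_cvgn => n m nm.
  by rewrite le_measure// ?inE//; exact/subsetPset/Gdecr.
rewrite GE -(cvg_lim _ cvg1)// (cvg_lim _ cvg2)//.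
rewrite (_ : P \o G = avoid P X (mark_prob Q F)); last exact/funext.
rewrite (avoidE mX X_poisson).
- congr (expeR (- _)); apply: eq_integral => x _; exact: mark_probE.
- by move=> x; exact: mark_prob01.
- exact: measurable_mark_prob.
Qed.

End marked_poisson.

(** * Distinct times *)

Section distinct_times.
Context d (V : measurableType d) (R : realType).
Context dW (W : measurableType dW) (P : probability W R).
Variables (mu : {sigma_finite_measure set V -> \bar R}) (X : nat -> W -> V * R).
Hypothesis mX : forall i, measurable_fun setT (X i).
Hypothesis X_poisson : poisson_process P (mu \x @lebR R) X.

Let L : {sigma_finite_measure set (V * R)%type -> \bar R} :=
  prod_sigma_finite mu (@lebR R).

Let mXB i B : measurable B -> measurable [set w | B (X i w)].
Proof. by move=> mB; rewrite -[X in measurable X]setTI; exact: mX. Qed.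

Let mtime i : measurable_fun setT (fun w => (X i w).2).
Proof. by apply: measurableT_comp; [exact: measurable_snd|exact: mX]. Qed.

Let msame i j : measurable [set w | (X i w).2 = (X j w).2].
Proof.
rewrite -[X in measurable X]setTI (_ : [set w | _] = [set w | (X i w).2 == (X j w).2]).
  exact: measurable_fun_eqr.
by apply/seteqP; split => w /= /eqP.
Qed.

(** Cut the time window into m pieces: two points with the same time fall into
    the same piece. Each piece has measure of order 1/m and contains two points
    with probability of order 1/m^2, so the sum over the pieces tends to 0. *)
Lemma same_time_null (G : set V) (z : R) (i j : nat) : measurable G -> mu G < +oo -> i != j ->
  P ([set w | (G `*` `[z, (z + 1)%R[%classic) (X i w)] `&`
     [set w | (G `*` `[z, (z + 1)%R[%classic) (X j w)] `&` [set w | (X i w).2 = (X j w).2]) = 0.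
Proof.
move=> mG muG ij; set E := (X in P X).
have mB : measurable (G `*` `[z, (z + 1)%R[%classic) by exact: measurableX.
have mE : measurable E.
  by apply: measurableI => //; apply: measurableI; exact: mXB.
pose a := fine (mu G).
have a0 : (0 <= a)%R by exact: fine_ge0.
have aE : mu G = a%:E by rewrite fineK// ge0_fin_numE.
have bound m : P E <= (a ^+ 2 / m.+1%:R)%:E.
  pose c k := G `*` `[(z + k%:R / m.+1%:R)%R, (z + k.+1%:R / m.+1%:R)%R[%classic.
  have mc k : measurable (c k) by exact: measurableX.
  have Lc k : L (c k) = (a / m.+1%:R)%:E.
    apply: (etrans (product_measure1E mu (@lebR R) mG _)) => //.
    rewrite [X in _ * X](_ : _ = (m.+1%:R^-1)%:E).
      by rewrite [X in X * _](_ : _ = a%:E).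
    apply: (etrans (lebesgue_measure_itv _)); rewrite /= lte_fin ltrD2l.
    rewrite ltr_pM2r ?invr_gt0// ltr_nat ltnSn -EFinB; congr EFin.
    by rewrite -natr1; field; rewrite addrC natr1 pnatr_eq0.
  pose N2 k := [set w | 2%:R%:E <= npts R (X ^~ w) (c k)].
  have mN2 k : measurable (N2 k).
    rewrite -[X in measurable X]setTI; apply: emeasurable_fun_c_infty => //.
    apply: (measurableT_comp (measurable_npts_cfg (mc k))).
    exact: (measurable_to_cfg (Y := fun w => X ^~ w)).
  apply: (@le_trans _ _ (P (\big[setU/set0]_(k < m.+1) N2 k))).
    have mU : measurable (\big[setU/set0]_(k < m.+1) N2 k).
      by apply: bigsetU_measurable => k _; exact: mN2.
    apply: le_measure; rewrite ?inE//.
    move=> w [[[/= Gi ti] [/= Gj _]] /= tij].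
    have /andP[zi iz] : (z <= (X i w).2 < z + 1)%R by move: ti; rewrite in_itv.
    pose x := (((X i w).2 - z) * m.+1%:R)%R.
    have x0 : (0 <= x)%R by rewrite mulr_ge0// subr_ge0.
    have /andP[kx xk] := truncn_itv x0; set k := Num.truncn x in kx xk.
    have km : (k < m.+1)%N.
      rewrite -(ltr_nat R) (le_lt_trans kx)// -[ltRHS]mul1r ltr_pM2r//.
      by rewrite ltrBlDl.
    rewrite -bigcup_mkord; exists k => //=.
    have ck l : G (X l w).1 -> (X l w).2 = (X i w).2 -> c k (X l w).
      move=> Gl tl; split => //=; rewrite in_itv/= tl.
      by rewrite -lerBrDl -ltrBlDl ler_pdivrMr// ltr_pdivlMr// kx.
    apply/npts_natP; exists (maxn i j).+1.
    have ilt : (i < (maxn i j).+1)%N by rewrite ltnS leq_maxl.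
    have jlt : (j < (maxn i j).+1)%N by rewrite ltnS leq_maxr.
    rewrite (bigD1 (Ordinal ilt))//= (bigD1 (Ordinal jlt))/=; last first.
      by apply/eqP => /(congr1 val)/= ji; move: ij; rewrite ji eqxx.
    by rewrite !mem_set//; exact: ck.
  apply: (le_trans (Boole_inequality _ _)) => //.
  apply: (@le_trans _ _ (\sum_(k < m.+1) ((a / m.+1%:R) ^+ 2)%:E)).
    by apply: lee_sum => k _; exact: (poisson_two_points (L := L) mX).
  rewrite sumEFin sumr_const card_ord lee_fin le_eqVlt; apply/orP; left; apply/eqP.
  by rewrite -mulr_natr; field; rewrite addrC natr1 pnatr_eq0.
apply/eqP; rewrite eq_le measure_ge0 andbT.
apply/lee_addgt0Pr => e e0; rewrite add0e.
pose m := Num.truncn (a ^+ 2 / e).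
apply: (le_trans (bound m)); rewrite lee_fin ler_pdivrMr//.
have := truncnS_gt (a ^+ 2 / e); rewrite -/m ltr_pdivrMr// => /ltW.
by rewrite mulrC.
Qed.

Lemma distinct_times : P.-negligible [set w | ~ injective (fun i => (X i w).2)].
Proof.
have /sigma_finiteP[F [F1 Fnd F2]] := sigma_finiteT mu.
pose E (p : (nat * nat) * (nat * int)) := [set w |
  (F p.2.1 `*` `[p.2.2%:~R, (p.2.2%:~R + 1)%R[%classic) (X p.1.1 w)] `&`
     [set w | (F p.2.1 `*` `[p.2.2%:~R, (p.2.2%:~R + 1)%R[%classic) (X p.1.2 w)] `&`
     [set w | (X p.1.1 w).2 = (X p.1.2 w).2].
pose E' k := if unpickle k is Some p then
  if p.1.1 != p.1.2 then E p else set0 else set0.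
apply: (@negligibleS _ _ _ _ (\bigcup_k E' k)).
  move=> w /= /existsNP[i /existsNP[j /not_implyP[tij /eqP ij]]].
  have [n _ Fi] : (\bigcup_n F n) (X i w).1 by rewrite -F1.
  have [m _ Fj] : (\bigcup_n F n) (X j w).1 by rewrite -F1.
  exists (pickle ((i, j), (maxn n m, Num.floor (X i w).2))) => //.
  rewrite /E' pickleK/= ij.
  have tz : `[(Num.floor (X i w).2)%:~R, ((Num.floor (X i w).2)%:~R + 1)%R[%classic (X i w).2.
    by rewrite /= in_itv/= -intrD1 floor_itv.
  split; last exact: tij; split; split => //=; last by rewrite -tij.
  - by have /subsetPset := Fnd _ _ (leq_maxl n m); exact.
  - by have /subsetPset := Fnd _ _ (leq_maxr n m); exact.
apply: negligible_bigcup => k; rewrite /E'.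
case: unpickle => [p|]; last exact: negligible_set0.
case: ifPn => [ij|_]; last exact: negligible_set0.
have [mF LF] := F2 p.2.1.
apply/negligibleP; last exact: same_time_null.
by apply: measurableI => //; apply: measurableI; apply: mXB; exact: measurableX.
Qed.

End distinct_times.

(** * Lebesgue measure and compact sets *)

Section lebesgue_reflection.
Context (R : realType).

Lemma lebR_reflect (c : R) (B : set R) : measurable B ->
  lebR ((fun q => c - q)%R @^-1` B) = lebR B.
Proof.
move=> mB.
have mrefl : measurable_fun setT (fun q : R => (c - q)%R : measurableTypeR R).
  exact: measurable_funB.
pose mu : {measure set (measurableTypeR R) -> \bar R} := mpush (@lebR R) mrefl.
apply/esym; apply: (@lebesgue_measure_unique R mu) => // _ [[a b]] _ <-.
rewrite /mu mpushE (_ : _ @^-1` _ = `[(c - b)%R, (c - a)%R[%classic); last first.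
  apply/seteqP; split => q; rewrite /= !in_itv/= => /andP[? ?]; apply/andP; split; lra.
apply: (etrans (lebesgue_measure_itv _)); apply/esym.
apply: (etrans (lebesgue_measure_itv _)); rewrite /= !lte_fin ltrD2l ltrN2.
by case: ifP => // _; rewrite -!EFinB; congr EFin; lra.
Qed.

Lemma measurable_reflect d (v : 'rV[R]_d) : measurable_fun setT (fun x : 'rV[R]_d => v - x)%R.
Proof.
apply: measurable_mxP => i j.
under eq_fun do rewrite !mxE.
by apply: measurable_funB => //; exact: measurable_mx_coord.
Qed.

(** The expected number of leaves covering v involves the volume of
    [{x | v - x \in S}], a reflected copy of S. By induction on the dimension the
    claim reduces to the real line, where Lebesgue measure is determined by its
    values on intervals. *)
Lemma lebesgue_rV_reflect d (v : 'rV[R]_d) (A : set 'rV[R]_d) : measurable A ->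
  lebesgue_rV R d ((fun x => v - x)%R @^-1` A) = lebesgue_rV R d A.
Proof.
elim: d => [|d IH] in v A *.
  move=> mA; congr (lebesgue_rV R 0 _); apply/seteqP.
  by split => x; rewrite /= (_ : v - x = x)%R//; apply/rowP => -[].
move=> mA.
pose v' : 'rV[R]_d := rsubmx (v : 'rV_(1 + d)).
pose B := @rV_cons R d @^-1` A.
have mB : measurable B.
  by rewrite -[X in measurable X]setTI; exact: measurable_rV_cons.
have consB (p : 'rV[R]_d * R) :
    (v - rV_cons p = rV_cons (v' - p.1, v ord0 ord0 - p.2))%R.
  apply/rowP => j; rewrite !mxE; case: (@split_ordP 1 d j) => k ->.
  - rewrite !mxE !ord1 eqxx mulr1n; congr (v _ _ - _)%R; exact: val_inj.
  - by rewrite !mxE.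
transitivity (\int[lebesgue_rV R d]_p lebR (xsection B (v' - p)%R)).
  rewrite /= /lebesgue_step /pushforward.
  apply: eq_integral => p _.
  change (lebR (xsection (@rV_cons R d @^-1` ((fun x => v - x)%R @^-1` A)) p) =
    lebR (xsection B (v' - p)%R)).
  rewrite (_ : xsection _ p = (fun q => v ord0 ord0 - q)%R @^-1` xsection B (v' - p)%R).
    by apply: lebR_reflect; exact: measurable_xsection.
  by apply/seteqP; split => q; rewrite /xsection/= !inE /B/= consB.
have mphi : measurable_fun setT (fun p => lebR (xsection B p)).
  exact: measurable_fun_xsection.
rewrite -(integral_mpush (lebesgue_rV R d) (measurable_reflect v') mphi)//.
apply: eq_measure_integral => C mC _.
by rewrite mpushE IH.
Qed.

(** A translation is the composition of two reflections. *)
Lemma lebesgue_rV_translate d (v : 'rV[R]_d) (A : set 'rV[R]_d) : measurable A ->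
  lebesgue_rV R d ((fun x => x - v)%R @^-1` A) = lebesgue_rV R d A.
Proof.
move=> mA.
have mA' : measurable ((fun x => (- v) - x)%R @^-1` A).
  by rewrite -[X in measurable X]setTI; exact: measurable_reflect.
rewrite -[RHS](lebesgue_rV_reflect (- v)%R mA) -[RHS](lebesgue_rV_reflect 0%R mA').
congr (lebesgue_rV R d _); apply/seteqP; split => x /=;
  by rewrite (_ : - v - (0 - x) = x - v)%R//; rewrite sub0r opprK addrC.
Qed.

End lebesgue_reflection.

Section cubes.
Context (R : realType) (d : nat).

Definition cube (n : nat) : set 'rV[R]_d := [set v | `|v| <= n%:R]%R.

Lemma cube_bounded n : bounded_set (cube n).
Proof.
exists n%:R; split; first exact: num_real.
by move=> r nr v /= vn; rewrite (le_trans vn)// ltW.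
Qed.

Lemma measurable_cube n : measurable (cube n).
Proof.
rewrite -[X in measurable X]setCK; apply: measurableC; apply: open_measurable_mx.
rewrite openC.
apply: (@closed_comp _ _ (fun v : 'rV[R]_d => `|v|%R) [set x : R | (x <= n%:R)%R]);
  last exact: closed_le.
by move=> v _; exact: norm_continuous.
Qed.

Lemma cube_cover : \bigcup_n cube n = setT.
Proof.
apply/seteqP; split => // v _; exists (Num.truncn `|v|).+1 => //=.
by rewrite /cube/= ltW// truncnS_gt.
Qed.

Lemma subset_cube m n : (m <= n)%N -> cube m `<=` cube n.
Proof. by move=> mn v /le_trans; apply; rewrite ler_nat. Qed.

Lemma lebesgue_rV_cube n : lebesgue_rV R d (cube n) < +oo.
Proof.
pose A (i : 'I_d) : set R := `[(- n%:R)%R, n%:R]%classic.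
have mA i : measurable (A i) by exact: measurable_itv.
have mbox : measurable [set v : 'rV[R]_d | forall i, A i (v 0%R i)].
  rewrite (_ : mkset _ = \bigcap_(i in [set: 'I_d]) ((fun v : 'rV[R]_d => v 0%R i) @^-1` A i)).
    apply: fin_bigcap_measurable => // i _.
    by rewrite -[X in measurable X]setTI; exact: measurable_mx_coord.
  by apply/seteqP; split => [v/= H i _|v/= H i]; exact: H.
apply: (@le_lt_trans _ _ (lebesgue_rV R d [set v | forall i, A i (v 0%R i)])).
  apply: le_measure; rewrite ?inE//; first exact: measurable_cube.
  move=> v /= vn i; rewrite /A/= in_itv/= -ler_norml (le_trans _ vn)//.
  rewrite [leRHS]mx_normrE; exact: (le_bigmax _ (fun ij : 'I_1 * 'I_d => `|v ij.1 ij.2|%R) (ord0, i)).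
rewrite lebesgue_rV_box//.
suff : 0 <= \prod_(i < d) lebesgue_measure (A i) < +oo by case/andP.
elim/big_ind : _ => [|x y /andP[x0 x1] /andP[y0 y1]|i _].
- by rewrite lee01 ltry.
- by rewrite mule_ge0//= lte_mul_pinfty// ge0_fin_numE.
- rewrite measure_ge0/= lebesgue_measure_itv/=; case: ifP => _; last by rewrite ltry.
  by rewrite -EFinB ltry.
Qed.

Lemma lebesgue_rV_sigma_finite : sigma_finite setT (lebesgue_rV R d).
Proof.
exists cube; first exact/esym/cube_cover.
by move=> n; split; [exact: measurable_cube|exact: lebesgue_rV_cube].
Qed.

Definition lebV : {sigma_finite_measure set 'rV[R]_d -> \bar R} :=
  pack_sigma_finite lebesgue_rV_sigma_finite.

End cubes.

Section random_closed_sets.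
Context (R : realType) (d : nat).
Local Notation C := (compact_sets R d).
Local Notation V := 'rV[R]_d.

Lemma compact_sets_closed (S : C) : closed S.
Proof. by apply: compact_closed; [exact: norm_hausdorff|exact: cset_compact]. Qed.

(** The hitting sets of open sets belong to the subbase of the Fell topology. *)
Lemma measurable_hit (G : set V) : open G ->
  measurable [set S : C | S `&` G !=set0].
Proof.
move=> oG; apply: sub_sigma_algebra.
have : fell_subbase [set S : C | S `&` G !=set0] by left; exists G.
move=> H; exists [set [set S : C | S `&` G !=set0]]; last by rewrite bigcup_set1.
by move=> _ ->; exact: finI_from1.
Qed.

Let qball (p : 'M[rat]_(1, d) * nat) : set V := ball (map_mx ratr p.1 : V) p.2.+1%:R^-1%R.

Let qball_open p : open (qball p).
Proof. by apply: ball_open; rewrite invr_gt0. Qed.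

(** A closed set misses x exactly when it misses a rational ball around x. *)
Lemma measurable_membership : measurable [set z : C * V | cset z.1 z.2].
Proof.
rewrite -[X in measurable X]setCK; apply: measurableC.
rewrite (_ : ~` _ = \bigcup_p (~` [set S : C | S `&` qball p !=set0] `*` qball p)).
  apply: countable_bigcupT_measurable; first exact: countableP.
  move=> p; apply: measurableX; first by apply: measurableC; exact: measurable_hit.
  exact: open_measurable_mx.
apply/seteqP; split => [[S x] /= Sx|[S x] [p _ [/= nS px]] Sx]; last first.
  by apply: nS; exists x.
have oS : open (~` cset S) by rewrite openC; exact: compact_sets_closed.
have : (~` cset S) x by [].
rewrite (open_mx_bigcup_ball oS) => -[p /= pS px]; exists p => //; split => //=.
by move=> [y [Sy py]]; exact: (pS y).
Qed.

Lemma measurable_vol : measurable_fun setT (fun S : C => lebV R d (cset S)).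
Proof.
have := measurable_fun_xsection (lebV R d) measurable_membership.
by congr (measurable_fun _ _); apply/funext => S; congr (lebV R d _);
  apply/seteqP; split => x; rewrite /xsection/= inE.
Qed.

Lemma measurable_cset (S : C) : measurable (cset S).
Proof.
rewrite -[X in measurable X]setCK; apply: measurableC; apply: open_measurable_mx.
by rewrite openC; exact: compact_sets_closed.
Qed.

(** A closed set contains a ball as soon as it contains the rational points of
    the ball, so having an interior point is a countable condition. *)
Lemma measurable_interior_nonempty : measurable [set S : C | (cset S)° !=set0].
Proof.
pose rat_pt (q : 'M[rat]_(1, d)) : V := map_mx ratr q.
have mpt q : measurable [set S : C | cset S (rat_pt q)].
  have := measurable_ysection (rat_pt q) measurable_membership.
  by congr (measurable _); apply/seteqP; split => S; rewrite /ysection/= inE.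
rewrite (_ : [set S : C | _] = \bigcup_p \bigcap_(q in [set q | qball p (rat_pt q)])
    [set S : C | cset S (rat_pt q)]).
  apply: countable_bigcupT_measurable; first exact: countableP.
  move=> p; rewrite bigcap_mkcond -[X in measurable X]setCK setC_bigcap.
  apply: measurableC; apply: countable_bigcupT_measurable; first exact: countableP.
  move=> q; apply: measurableC; case: ifP => _; [exact: mpt|exact: measurableT].
apply/seteqP; split => S /=.
- move=> [x]; rewrite (open_mx_bigcup_ball (@open_interior _ (cset S))) => -[p /= pS px].
  by exists p => // q /= pq; apply: interior_subset; exact: pS.
- move=> [p _ H].
  have sub : qball p `<=` cset S.
    move=> x px; apply: contrapT => Sx.
    have oU : open (qball p `&` ~` cset S).
      by apply: openI => //; rewrite openC; exact: compact_sets_closed.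
    have : (qball p `&` ~` cset S) x by [].
    rewrite (open_mx_bigcup_ball oU) => -[p' /= p'S p'x].
    have r0 : (0 < p'.2.+1%:R^-1 :> R)%R by rewrite invr_gt0.
    have [pp' Sp'] := p'S (rat_pt p'.1) (ballxx _ r0).
    apply: Sp'; exact: H.
  move: sub; rewrite (open_subsetE _ (@qball_open p)) => sub.
  exists (rat_pt p.1); apply: sub.
  by apply: ballxx; rewrite invr_gt0.
Qed.

Lemma vol_interior_gt0 (S : C) : (cset S)° !=set0 -> 0 < lebV R d (cset S).
Proof.
move=> [x]; rewrite /interior => /nbhs_ballP[e /= e0 xS].
apply: (@lt_le_trans _ _ (lebV R d (ball x e))); last first.
  apply: le_measure => //; rewrite inE; last exact: measurable_cset.
  by apply: open_measurable_mx; exact: ball_open.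
rewrite (_ : ball x e = [set v : V | forall i, ball (x 0%R i) e (v 0%R i)]).
  apply: (@lt_le_trans _ _ (\prod_(i < d) lebesgue_measure (ball (x 0%R i) e))).
    elim/big_ind : _ => [|y z y0 z0|i _]; [exact: lte01|exact: mule_gt0|].
    rewrite ball_itv lebesgue_measure_itv/= lte_fin.
    have h : (x 0%R i - e < x 0%R i + e)%R by lra.
    by rewrite h -EFinB lte_fin; lra.
  rewrite le_eqVlt -lebesgue_rV_box ?eqxx// => i.
  by apply: open_measurable; exact: ball_open.
rewrite mx_ball_coordE//; apply/seteqP; split => v /=.
  by move=> H i; exact: H.
by move=> H i j; rewrite ord1; exact: H.
Qed.

Lemma compact_euclidean_ball : compact (@euclidean_ball R d 1%R).
Proof.
have sqrt1 (a : R) : (Num.sqrt a <= 1)%R = (a <= 1)%R.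
  by rewrite -[in LHS]sqrtr1 ler_sqrt.
apply: (@subclosed_compact _ _ [set v : V | forall i, `[(-1)%R, 1%R]%classic (v ord0 i)]).
- rewrite (_ : euclidean_ball 1%R =
      (fun v : V => \sum_i v 0%R i ^+ 2)%R @^-1` [set x : R | (x <= 1)%R]).
    apply: closed_comp; last exact: closed_le.
    move=> v _; move: v; apply: continuous_big; first exact: add_continuous.
    move=> i _ v.
    apply: (@continuous_comp _ _ _ (fun v : V => v 0%R i) (fun a : R => a ^+ 2)%R).
      exact: coord_continuous.
    exact: exprn_continuous.
  by apply/seteqP; split => v /=; rewrite /euclidean_ball/= sqrt1.
- exact: (@rV_compact R d (fun=> `[(-1)%R, 1%R]%classic) (fun i => @segment_compact R _ _)).
- move=> v; rewrite /euclidean_ball/= sqrt1 => v1 i.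
  rewrite in_itv/= -ler_norml -(@expr_le1 _ 2)// real_normK ?num_real//.
  apply: le_trans v1; rewrite (bigD1 i)//= lerDl.
  by apply: sumr_ge0 => j _; exact: sqr_ge0.
Qed.

(** The Minkowski sum of two compact sets is compact, hence measurable. *)
Lemma vol_le_minkowski_ball (S : C) :
  lebV R d (cset S) <= lebV R d (minkowski_sum (cset S) (euclidean_ball 1%R)).
Proof.
have cS : compact (minkowski_sum (cset S) (@euclidean_ball R d 1%R)).
  rewrite (_ : minkowski_sum _ _ =
      [set z.1 + z.2 | z in cset S `*` @euclidean_ball R d 1%R]%R).
    apply: continuous_compact.
      by apply: continuous_subspaceT => z; exact: add_continuous.
    by apply: compact_setX; [exact: cset_compact|exact: compact_euclidean_ball].
  apply/seteqP; split => v /=.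
    by move=> [a Sa [b Bb <-]]; exists (a, b).
  by move=> [[a b] [/= Sa Bb] <-]; exists a => //; exists b.
apply: le_measure; rewrite ?inE.
- exact: measurable_cset.
- exact: (measurable_cset (CompactSet cS)).
- move=> v Sv; exists v => //; exists 0%R; last by rewrite addr0.
  by rewrite /euclidean_ball/= big1 ?sqrtr0// => i _; rewrite mxE expr0n.
Qed.

End random_closed_sets.

(** * Integration against a locally finite configuration *)

(** The windows D n exhaust the space and have finite mass for each measure k x.
    A bound that is uniform in x is not available, so measurability of
    integrals in the parameter is obtained window by window. *)
Section exhausted_kernels.
Import HBNNSimple.
Context d1 d2 (X : measurableType d1) (Y : measurableType d2) (R : realType).
Variable k : X -> {measure set Y -> \bar R}.
Hypothesis mk : forall B, measurable B -> measurable_fun setT (k ^~ B).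
Variable D : nat -> set Y.
Hypothesis mD : forall n, measurable (D n).
Hypothesis ndD : {homo D : m n / (m <= n)%N >-> m `<=` n}.
Hypothesis covD : \bigcup_n D n = setT.
Hypothesis finD : forall x n, k x (D n) < +oo.

HB.instance Definition _ := isKernel.Build _ _ _ _ _ k mk.

Lemma measurable_xsection_exhausted A : measurable A ->
  measurable_fun setT (fun x => k x (xsection A x)).
Proof.
move=> mA.
have mn n : measurable_fun setT (fun x => k x (xsection A x `&` D n)).
  have [] // := @measurable_prod_subset_xsection_kernel _ _ X Y R k (D n) (mD n) _ _ mA.
  move=> x; exists (fine (k x (D n)) + 1)%R => B mB.
  apply: (@le_lt_trans _ _ (k x (D n))).
    by apply: le_measure; rewrite ?inE//; exact: measurableI.
  rewrite EFinD fineK; last by rewrite ge0_fin_numE.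
  by rewrite lteDl ?lte01// ge0_fin_numE.
apply: (emeasurable_fun_cvg _ _ mn) => x _.
rewrite -{2}(setIT (xsection A x)) -covD setI_bigcupr.
apply: nondecreasing_cvg_mu.
- by move=> n; apply: measurableI => //; exact: measurable_xsection.
- by apply: bigcupT_measurable => n; apply: measurableI => //; exact: measurable_xsection.
- by move=> m n mn'; apply/subsetPset; apply: setIS; exact: ndD.
Qed.

Lemma measurable_integral_exhausted (f : X * Y -> \bar R) :
  measurable_fun setT f -> (forall z, 0 <= f z) ->
  measurable_fun setT (fun x => \int[k x]_y f (x, y)).
Proof.
move=> mf f0.
pose f_ := nnsfun_approx measurableT mf.
apply: (@measurable_fun_xsection_integral _ _ X Y R f k f_).
- by move=> a b ab; exact/nd_nnsfun_approx.
- by move=> z; exact/cvg_nnsfun_approx.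
- move=> n r; apply: measurable_xsection_exhausted.
  exact: measurable_funPTI.
Qed.

End exhausted_kernels.

Section locally_finite_configurations.
Context d (E : measurableType d) (R : realType).
Variable D : nat -> set E.
Hypothesis mD : forall n, measurable (D n).
Hypothesis ndD : {homo D : m n / (m <= n)%N >-> m `<=` n}.
Hypothesis covD : \bigcup_n D n = setT.

Definition lf_cfg : set (cfg E R) := [set y | forall n, npts R y (D n) < +oo].

Lemma measurable_lf_cfg : measurable lf_cfg.
Proof.
rewrite (_ : lf_cfg = \bigcap_n [set y | npts R y (D n) < +oo]); last first.
  by apply/seteqP; split => [y H n _|y H n]; exact: H.
apply: bigcapT_measurable => n; rewrite -[X in measurable X]setTI.
by apply: emeasurable_fun_infty_o => //; exact: measurable_npts_cfg.
Qed.

(** Replacing by 0 the counting measures that are infinite on some window makes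
    this a family of measures to which the preceding section applies. *)
Definition lf_npts (y : cfg E R) : {measure set E -> \bar R} :=
  if y \in lf_cfg then npts R y else mzero.

Lemma lf_nptsE y : lf_cfg y -> lf_npts y = npts R y.
Proof. by move=> yl; rewrite /lf_npts mem_set. Qed.

Lemma measurable_lf_npts B : measurable B -> measurable_fun setT (lf_npts ^~ B).
Proof.
move=> mB; rewrite (_ : (lf_npts ^~ B) = (fun y => npts R y B) \_ lf_cfg).
  apply/(measurable_restrictT _ _).1; first exact: measurable_lf_cfg.
  by apply: measurable_funTS; exact: measurable_npts_cfg.
by apply/funext => y; rewrite patchE /lf_npts; case: ifP.
Qed.

Lemma lf_npts_fin y n : lf_npts y (D n) < +oo.
Proof.
rewrite /lf_npts; case: ifPn => [/set_mem|_]; first exact.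
by rewrite /mzero ltry.
Qed.

Lemma integral_lf_npts y (g : E -> \bar R) : lf_cfg y -> measurable_fun setT g ->
  (forall e, 0 <= g e) -> \int[lf_npts y]_e g e = \sum_(i <oo) g (y i).
Proof.
move=> yl mg g0; rewrite lf_nptsE// ge0_integral_measure_series//.
by apply: eq_eseriesr => i _; rewrite integral_dirac// diracT mul1e.
Qed.

Lemma measurable_lf_npts_xsection d' (X : measurableType d')
    (A : set (X * cfg E R * E)) : measurable A ->
  measurable_fun setT (fun z : X * cfg E R => lf_npts z.2 (xsection A z)).
Proof.
move=> mA; apply: (@measurable_xsection_exhausted _ _ _ _ _ (fun z : X * cfg E R => lf_npts z.2) _ D) => //.
- move=> B mB; apply: (measurableT_comp (measurable_lf_npts mB)); exact: measurable_snd.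
- by move=> z n; exact: lf_npts_fin.
Qed.

Lemma measurable_lf_npts_integral (f : cfg E R * E -> \bar R) :
  measurable_fun setT f -> (forall z, 0 <= f z) ->
  measurable_fun setT (fun y : cfg E R => \int[lf_npts y]_e f (y, e)).
Proof.
move=> mf f0; apply: (@measurable_integral_exhausted _ _ _ _ _ lf_npts _ D) => //.
- exact: measurable_lf_npts.
- exact: lf_npts_fin.
Qed.

End locally_finite_configurations.

(** * The dead leaves measure of a configuration *)

Section measurable_vectors.
Context (R : realType) d' (X : measurableType d') (n : nat).
Variables f g : X -> 'rV[R]_n.
Hypotheses (mf : measurable_fun setT f) (mg : measurable_fun setT g).

Lemma measurable_fun_rVD : measurable_fun setT (fun x => f x + g x)%R.
Proof.
apply: measurable_mxP => i j; under eq_fun do rewrite !mxE.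
apply: measurable_funD; first exact: (measurableT_comp (measurable_mx_coord i j)).
exact: (measurableT_comp (measurable_mx_coord i j)).
Qed.

Lemma measurable_fun_rVB : measurable_fun setT (fun x => f x - g x)%R.
Proof.
apply: measurable_mxP => i j; under eq_fun do rewrite !mxE.
apply: measurable_funB; first exact: (measurableT_comp (measurable_mx_coord i j)).
exact: (measurableT_comp (measurable_mx_coord i j)).
Qed.

End measurable_vectors.

Section dead_leaves_functional.
Context (R : realType) (d : nat).
Local Notation V := 'rV[R]_d.
Local Notation C := (compact_sets R d).
Local Notation M := (lfmeasure R d).
Local Notation E := ((V * R) * (C * M))%type.
Local Notation cfg := (cfg E R).

Definition window (n : nat) : set E :=
  ((@cube R d n) `*` `[(- n%:R)%R, n%:R%R]%classic) `*` setT.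

Lemma measurable_window n : measurable (window n).
Proof. by apply: measurableX => //; apply: measurableX => //; exact: measurable_cube. Qed.

Lemma subset_window m n : (m <= n)%N -> window m `<=` window n.
Proof.
move=> mn [[x t] p] [[/= xm tm] _]; split => //; split => /=.
  exact: subset_cube xm.
move: tm; rewrite !in_itv/= => /andP[t1 t2]; rewrite (le_trans _ t1) ?(le_trans t2)//.
  by rewrite ler_nat.
by rewrite lerN2 ler_nat.
Qed.

Lemma window_cover : \bigcup_n window n = setT.
Proof.
apply/seteqP; split => // -[[x t] p] _.
exists (Num.truncn (`|x| + `|t|)%R).+1 => //; split => //.
have h : (`|x| + `|t| <= (Num.truncn (`|x| + `|t|)).+1%:R :> R)%R by rewrite ltW// truncnS_gt.
split => /=; first by rewrite /cube/= (le_trans _ h)// lerDl.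
by rewrite in_itv/= -ler_norml (le_trans _ h)// lerDr.
Qed.

Local Notation lf_cfg := (lf_cfg window).
Local Notation lf_npts := (lf_npts window).

(** A leaf is [((x, t), (S, M))]: a place, a time, a grain and the measure that
    it carries. *)
Definition covering (v : V) (s : R) : set E :=
  [set e | (0 <= e.1.2 < s)%R /\ cset e.2.1 (v - e.1.1)%R].

Lemma measurable_lfm_eval (B : set V) : measurable B ->
  measurable_fun setT (fun mu : M => mu B).
Proof.
move=> mB _ U mU; rewrite setTI; apply: sub_sigma_algebra; exists B => //.
by exists U => //; rewrite setTI.
Qed.

Lemma measurable_to_lfm d' (X : measurableType d') (f : X -> M) :
  (forall B, measurable B -> measurable_fun setT (fun x => f x B)) ->
  measurable_fun setT f.
Proof.
move=> mf; apply: (@measurability _ _ X M setT f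
  (\bigcup_(A in @measurable _ V) preimage_set_system setT (fun mu : M => mu A) measurable) erefl).
move=> _ [_ [B mB [U mU <-]] <-]; rewrite !setTI.
by rewrite -[X in measurable X]setTI; exact: mf.
Qed.

Let mcov : measurable [set z : (V * R) * cfg * E | covering z.1.1.1 z.1.1.2 z.2].
Proof.
have mt : measurable_fun setT (fun z : (V * R) * cfg * E => z.2.1.2).
  apply: (measurableT_comp measurable_snd); apply: (measurableT_comp measurable_fst).
  exact: measurable_snd.
have ms : measurable_fun setT (fun z : (V * R) * cfg * E => z.1.1.2).
  apply: (measurableT_comp measurable_snd); apply: (measurableT_comp measurable_fst).
  exact: measurable_fst.
have mS : measurable_fun setT (fun z : (V * R) * cfg * E => (z.2.2.1, (z.1.1.1 - z.2.1.1)%R)).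
  apply: measurable_fun_pair.
    apply: (measurableT_comp measurable_fst); apply: (measurableT_comp measurable_snd).
    exact: measurable_snd.
  apply: measurable_fun_rVB.
    apply: (measurableT_comp measurable_fst); apply: (measurableT_comp measurable_fst).
    exact: measurable_fst.
  apply: (measurableT_comp measurable_fst); apply: (measurableT_comp measurable_fst).
  exact: measurable_snd.
rewrite (_ : [set z | _] = ([set z | (0 <= z.2.1.2)%R] `&` [set z | (z.2.1.2 < z.1.1.2)%R])
    `&` ((fun z : (V * R) * cfg * E => (z.2.2.1, (z.1.1.1 - z.2.1.1)%R)) @^-1`
         [set z | cset z.1 z.2])).
  apply: measurableI; last first.
    by rewrite -[X in measurable X]setTI; apply: mS => //; exact: measurable_membership.
  apply: measurableI; rewrite -[X in measurable X]setTI.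
    exact: measurable_fun_ler.
  exact: measurable_fun_ltr.
apply/seteqP; split => z /=; first by move=> [/andP[]].
by move=> [[t0 ts] zS]; split => //; apply/andP.
Qed.

(** Uncovered points are described by a count of leaves, which is jointly
    measurable in the point, the time and the configuration. *)
Definition uncovered : set ((V * R) * cfg) :=
  [set z | lf_npts z.2 (covering z.1.1 z.1.2) = 0].

Lemma measurable_covering v s : measurable (covering v s).
Proof.
have := measurable_xsection ((v, s), point) mcov.
by congr (measurable _); apply/seteqP; split => e; rewrite /xsection/= inE.
Qed.

Lemma measurable_uncovered : measurable uncovered.
Proof.
have := measurable_lf_npts_xsection measurable_window subset_window window_cover mcov.
move=> /(_ measurableT [set 0] (emeasurable_set1 _)); rewrite setTI.
congr (measurable _); apply/seteqP; split => z /=;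
  by rewrite (_ : xsection _ z = covering z.1.1 z.1.2)//; apply/seteqP; split => e;
   rewrite /xsection/= inE.
Qed.

(** What e shows is judged from y, which may contain e or not: in the Mecke
    formula e is added to an independent configuration. *)
Definition leaf_mass (A : set V) (z : cfg * E) : \bar R :=
  if (0 <= z.2.1.2)%R then
    z.2.2.2 [set x | A (x + z.2.1.1)%R /\ uncovered ((x + z.2.1.1)%R, z.2.1.2, z.1)]
  else 0.

Lemma leaf_mass_ge0 A z : 0 <= leaf_mass A z.
Proof. by rewrite /leaf_mass; case: ifP. Qed.

(** The set of visible points is a section of a jointly measurable set, and
    measures in M are finite on cubes. *)
Lemma measurable_leaf_mass A : measurable A -> measurable_fun setT (leaf_mass A).
Proof.
move=> mA; rewrite /leaf_mass.
have mt : measurable_fun setT (fun z : cfg * E => z.2.1.2).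
  apply: (measurableT_comp measurable_snd); apply: (measurableT_comp measurable_fst).
  exact: measurable_snd.
apply: measurable_fun_if => //.
  exact: measurable_fun_ler.
apply: measurable_funTS.
have mx : measurable_fun setT (fun u : cfg * E * V => (u.2 + u.1.2.1.1)%R).
  apply: measurable_fun_rVD; first exact: measurable_snd.
  apply: (measurableT_comp measurable_fst); apply: (measurableT_comp measurable_fst).
  by apply: (measurableT_comp measurable_snd); exact: measurable_fst.
have mU : measurable_fun setT (fun u : cfg * E * V =>
    ((u.2 + u.1.2.1.1)%R, u.1.2.1.2, u.1.1)).
  apply: measurable_fun_pair; first apply: measurable_fun_pair => //.
    by apply: (measurableT_comp mt); exact: measurable_fst.
  apply: (measurableT_comp measurable_fst); exact: measurable_fst.
have mH : measurable [set u : cfg * E * V | A (u.2 + u.1.2.1.1)%R /\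
    uncovered ((u.2 + u.1.2.1.1)%R, u.1.2.1.2, u.1.1)].
  apply: measurableI; rewrite -[X in measurable X]setTI; first exact: mx.
  by apply: mU => //; exact: measurable_uncovered.
have := @measurable_xsection_exhausted _ _ _ _ _ (fun z : cfg * E => z.2.2.2 : {measure set V -> \bar R})
  _ (@cube R d) _ _ _ _ _ mH.
rewrite /=; set f := (fun x : cfg * E => _); set g := (X in _ -> measurable_fun _ X).
rewrite (_ : f = g); last first.
  apply/funext => z; rewrite /f /g; congr (z.2.2.2 _).
  by apply/seteqP; split => x; rewrite /xsection/= inE.
apply.
- move=> B mB; apply: (measurableT_comp (measurable_lfm_eval mB)).
  apply: (measurableT_comp measurable_snd); apply: (measurableT_comp measurable_snd).
  exact: measurable_snd.
- exact: measurable_cube.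
- exact: subset_cube.
- exact: cube_cover.
- by move=> z n; apply: lfm_finite; [exact: measurable_cube|exact: cube_bounded].
Qed.

Definition dead_leaves_of (y : nat -> E) (A : set V) : \bar R :=
  dead_leaves (fun i => (y i).1.1) (fun i => (y i).1.2)
              (fun i => (y i).2.1) (fun i => (y i).2.2) A.

Definition leaves_before (y : nat -> E) (s : R) : set V :=
  \bigcup_(j in [set j | (0 <= (y j).1.2 < s)%R]) translate (cset (y j).2.1) (y j).1.1.

Lemma leaves_beforeP (y : cfg) v s : lf_cfg y ->
  (~ leaves_before y s v) <-> uncovered (v, s, y).
Proof.
move=> yl; rewrite /uncovered /= (lf_nptsE yl); split.
  move=> nc; apply/npts_eq0 => j [tj Sj]; apply: nc; exists j => //.
  by rewrite translateE.
move=> /npts_eq0 nc [j /= tj]; rewrite translateE => Sj.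
by apply: (nc j); split.
Qed.

Lemma measurable_leaves_before y s : measurable (leaves_before y s).
Proof.
apply: bigcup_measurable => j _; apply: measurable_translate; exact: measurable_cset.
Qed.

(** Campbell form of the sum over leaves, which makes it measurable in the
    counting measure of y. *)
Lemma dead_leaves_ofE (y : cfg) A : lf_cfg y -> measurable A ->
  dead_leaves_of y A = \int[lf_npts y]_e leaf_mass A (y, e).
Proof.
move=> yl mA; rewrite integral_lf_npts//; last 2 first.
- by apply: (measurableT_comp (measurable_leaf_mass mA)); exact: measurable_pair1.
- by move=> e; exact: leaf_mass_ge0.
rewrite /dead_leaves_of /dead_leaves eseries_mkcond; apply: eq_eseriesr => i _.
rewrite /leaf_mass /=; case: ifP => // ti; rewrite /shift_measure translateE opprK.
congr ((y i).2.2 _); apply/seteqP; split => x /= [Ax].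
  by move=> nc; split => //; exact/leaves_beforeP.
by move=> /leaves_beforeP nc; split => //; exact: nc.
Qed.

Definition dl_term (y : nat -> E) (i : nat) : {measure set V -> \bar R} :=
  let shifted : {measure set V -> \bar R} := lfm_shift (y i).2.2 (y i).1.1 in
  let visible : {measure set V -> \bar R} :=
    mrestr shifted (measurableC (measurable_leaves_before y (y i).1.2)) in
  if (0 <= (y i).1.2)%R then visible else mzero.

Definition dl_measure (y : nat -> E) : {measure set V -> \bar R} :=
  mseries (dl_term y) 0.

Lemma dl_measureE y A : dl_measure y A = dead_leaves_of y A.
Proof.
rewrite /dead_leaves_of /dead_leaves eseries_mkcond; apply: eq_eseriesr => i _.
by rewrite /dl_term; case: ifP.
Qed.

(** Finite masses of cubes make the sum of the leaves a locally finite measure;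
    local finiteness of y makes the condition on the masses measurable. *)
Definition good : set cfg := lf_cfg `&` [set y | forall n, dead_leaves_of y (@cube R d n) < +oo].

Let mdl A : measurable A ->
  measurable_fun setT (fun y : cfg => \int[lf_npts y]_e leaf_mass A (y, e)).
Proof.
move=> mA; apply: (measurable_lf_npts_integral measurable_window subset_window window_cover).
  exact: measurable_leaf_mass.
by move=> z; exact: leaf_mass_ge0.
Qed.

Lemma measurable_good : measurable good.
Proof.
have ml : measurable lf_cfg := measurable_lf_cfg measurable_window.
have mc n : measurable (@cube R d n) by exact: measurable_cube.
rewrite (_ : good = lf_cfg `&` \bigcap_n
    [set y : cfg | \int[lf_npts y]_e leaf_mass (@cube R d n) (y, e) < +oo]).
  apply: measurableI => //; apply: bigcapT_measurable => n.
  rewrite -[X in measurable X]setTI; apply: emeasurable_fun_infty_o => //.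
  by apply: mdl; exact: measurable_cube.
apply/seteqP; split => y [yl H]; split => //.
  by move=> n _ /=; rewrite -dead_leaves_ofE.
by move=> n; rewrite dead_leaves_ofE//; exact: (H n I).
Qed.

Lemma good_lf y : good y -> forall B : set V, measurable B -> bounded_set B -> dl_measure y B < +oo.
Proof.
move=> [_ gy] B mB [r [_ bB]].
pose n := (Num.truncn `|r|%R).+1.
have rn : (r < n%:R)%R by rewrite (le_lt_trans (ler_norm _))// truncnS_gt.
apply: le_lt_trans (gy n); rewrite -dl_measureE; apply: le_measure; rewrite ?inE//.
  exact: measurable_cube.
by move=> v Bv; exact: (bB _ rn).
Qed.

(** Outside [good] the value is the null measure. *)
Definition leaf_process (y : cfg) : M :=
  if pselect (good y) is left gy then LFMeasure (good_lf gy) else point.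

Lemma leaf_processE y A : good y -> leaf_process y A = dead_leaves_of y A.
Proof.
by move=> gy; rewrite /leaf_process; case: pselect => //= gy'; rewrite -dl_measureE.
Qed.

Lemma measurable_leaf_process : measurable_fun setT leaf_process.
Proof.
apply: measurable_to_lfm => B mB.
rewrite (_ : (fun y => _) = (fun y : cfg => \int[lf_npts y]_e leaf_mass B (y, e)) \_ good).
  apply/(measurable_restrictT _ _).1; first exact: measurable_good.
  by apply: measurable_funTS; exact: mdl.
apply/funext => y; rewrite patchE; case: ifPn => [/set_mem gy|ng].
  by rewrite leaf_processE// dead_leaves_ofE//; case: gy.
by rewrite /leaf_process; case: pselect => // gy; rewrite mem_set in ng.
Qed.

End dead_leaves_functional.

(** * The intensity measure of the leaves *)

Section expectations.
Context (R : realType).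

(** The integral of a nonnegative function is a supremum over the simple
    functions below it, hence monotone even where the upper function is not
    measurable. On the right it receives the volume of the Minkowski sum of S
    with a ball, as a function of S. *)
Lemma integral_ge0_mono d (T : measurableType d) (mu : {measure set T -> \bar R})
    (f g : T -> \bar R) : (forall x, 0 <= f x) -> (forall x, f x <= g x) ->
  \int[mu]_x f x <= \int[mu]_x g x.
Proof.
move=> f0 fg; rewrite !ge0_integralTE//; last by move=> x; exact: le_trans (fg x).
apply: le_ereal_sup => _ [h hf <-]; exists h => // x.
exact: le_trans (fg x).
Qed.

Lemma integral_lebR (f : R -> \bar R) : measurable_fun setT f -> (forall x, 0 <= f x) ->
  \int[@lebR R]_x f x = \int[@lebesgue_measure R]_x f x.
Proof.
move=> mf f0.
have mid : measurable_fun setT (id : R -> measurableTypeR R) by exact: measurable_id.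
have mf' : measurable_fun setT (f : measurableTypeR R -> \bar R) by exact: mf.
by rewrite -(integral_mpush (@lebR R) mid mf').
Qed.

(** The exponential density of rate l has total mass 1. *)
Lemma integral_exp_decay (l : R) : (0 < l)%R ->
  \int[@lebR R]_t (if (0 <= t)%R then expR (- (l * t)) else 0)%:E = (l^-1)%:E.
Proof.
move=> l0.
have mp : measurable_fun setT (EFin \o exponential_pdf l).
  by apply/measurable_EFinP; exact: measurable_exponential_pdf.
have p0 t : 0 <= (EFin \o exponential_pdf l) t.
  by rewrite lee_fin; apply: exponential_pdf_ge0; exact: ltW.
transitivity (\int[@lebR R]_t ((l^-1)%:E * (EFin \o exponential_pdf l) t)).
  apply: eq_integral => t _; case: ifP => [t0|/negbT].
    by rewrite /= exponential_pdfE// -EFinM mulrA mulVf ?gt_eqF// mul1r mulNr.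
  by rewrite -ltNge => t0; rewrite /= lt0_exponential_pdf// mule0.
rewrite ge0_integralZl//; last by rewrite lee_fin invr_ge0 ltW.
by rewrite integral_lebR// integral_exponential_pdf// mule1.
Qed.

(** Tonelli: for each z, the x such that [z + x] lies in A form a translate
    of A. *)
Lemma integral_shifted_mass d (m : {sigma_finite_measure set 'rV[R]_d -> \bar R})
    (A : set 'rV[R]_d) : measurable A ->
  \int[lebV R d]_x m [set z | A (z + x)%R] = m setT * lebV R d A.
Proof.
move=> mA.
pose B := [set u : 'rV[R]_d * 'rV[R]_d | A (u.2 + u.1)%R].
have mB : measurable B.
  rewrite -[X in measurable X]setTI; apply: (measurable_fun_rVD _ _ measurableT mA).
    exact: measurable_snd.
  exact: measurable_fst.
transitivity ((lebV R d \x m) B).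
  apply: eq_integral => x _; congr (m _); apply/seteqP.
  by split => z; rewrite /= /xsection/= inE.
rewrite product_measure1_ysection// -[X in m X]setIT -integral_indic// indicT.
rewrite muleC -ge0_integralZl//; last exact/measurable_EFinP/measurable_cst.
apply: eq_integral => z _; rewrite mule1.
apply: (etrans _ (lebesgue_rV_translate (- z)%R mA)); congr (lebesgue_rV R d _).
by apply/seteqP; split => x; rewrite /ysection/= inE opprK /B/= addrC.
Qed.

End expectations.

Section leaf_intensity_measure.
Context (R : realType) (d : nat).
Local Notation V := 'rV[R]_d.
Local Notation C := (compact_sets R d).
Local Notation M := (lfmeasure R d).
Local Notation E := ((V * R) * (C * M))%type.
Variable Q : probability (C * M)%type R.

Definition space_time : {sigma_finite_measure set (V * R)%type -> \bar R} :=
  prod_sigma_finite (lebV R d) (@lebR R).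

Definition leaf_intensity : {sigma_finite_measure set E -> \bar R} :=
  prod_sigma_finite space_time Q.

Lemma space_timeX A B : measurable A -> measurable B ->
  space_time (A `*` B) = lebV R d A * lebR B.
Proof. by move=> mA mB; exact: (product_measure1E (lebV R d) (@lebR R) mA mB). Qed.

Lemma leaf_intensityE F : measurable F ->
  leaf_intensity F = \int[Q]_p space_time (ysection F p).
Proof. by move=> mF; exact: (product_measure1_ysection space_time Q). Qed.

Lemma leaf_intensity_window n : leaf_intensity (@window R d n) < +oo.
Proof.
have mI : measurable (`[(- n%:R)%R, n%:R%R]%classic : set R) by exact: measurable_itv.
have mC := @measurable_cube R d n.
apply: (@le_lt_trans _ _ (space_time (@cube R d n `*` `[(- n%:R)%R, n%:R%R]%classic) * Q setT)).
  by rewrite -(product_measure1E space_time Q)//; exact: measurableX.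
rewrite probability_setT mule1 space_timeX// lte_mul_pinfty//.
- by rewrite ge0_fin_numE//; exact: lebesgue_rV_cube.
- rewrite (_ : lebR _ = (if (- n%:R < n%:R :> R)%R then (n%:R - - n%:R)%:E else 0)).
    by case: ifP => _; rewrite ?ltry.
  by apply: (etrans (lebesgue_measure_itv _)); rewrite /= lte_fin.
Qed.

Lemma leaf_intensity_time c : leaf_intensity [set e | e.1.2 = c] = 0.
Proof.
rewrite (_ : [set e : E | e.1.2 = c] = (setT `*` [set c]) `*` setT).
  apply: (etrans (product_measure1E space_time Q _ _)) => //.
    exact: measurableX.
  apply/eqP; rewrite mule_eq0; apply/orP; left; apply/eqP.
  apply: (etrans (space_timeX _ _)) => //.
  rewrite (_ : lebR _ = 0) ?mule0//; exact: lebesgue_measure_set1.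
by apply/seteqP; split => e /=; [move=> ?; do 2 split|case=> -[]].
Qed.

Definition mean_volume := \int[Q]_p lebV R d (cset p.1).

Lemma measurable_vol_fst : measurable_fun setT (fun p : C * M => lebV R d (cset p.1)).
Proof. by apply: (measurableT_comp (@measurable_vol R d)); exact: measurable_fst. Qed.

(** For each grain S, the leaves that cover v are those with place in [v - S]
    and time in [0, s[. *)
Lemma leaf_intensity_covering v s : (0 <= s)%R ->
  leaf_intensity (covering v s) = mean_volume * s%:E.
Proof.
move=> s0; rewrite leaf_intensityE; last exact: measurable_covering.
rewrite -ge0_integralZr//; last exact: measurable_vol_fst.
apply: eq_integral => p _.
rewrite (_ : ysection _ _ = ((fun x => v - x)%R @^-1` cset p.1) `*` `[0%R, s[%classic).
  rewrite space_timeX//; last first.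
    by rewrite -[X in measurable X]setTI; apply: measurable_reflect => //; exact: measurable_cset.
  congr (_ * _); first by apply: lebesgue_rV_reflect; exact: measurable_cset.
  apply: (etrans (lebesgue_measure_itv _)); rewrite /= lte_fin; case: ifPn.
    by rewrite -EFinB subr0.
  by rewrite -leNgt => s0'; congr EFin; apply/eqP; rewrite eq_le s0 s0'.
apply/seteqP; split => -[x t]; rewrite /ysection/= inE /covering/= in_itv/=.
  by case.
by move=> [].
Qed.

(** A set with an interior point has positive volume. *)
Lemma mean_volume_gt0 :
  0 < pushforward Q fst [set S : C | (cset S)° !=set0] -> 0 < mean_volume.
Proof.
move=> Q0; rewrite lt_neqAle integral_ge0// andbT; apply: contraTneq Q0 => /esym l0.
have [N [mN N0 sN]] : ae_eq Q setT (fun p : C * M => lebV R d (cset p.1)) (cst 0).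
  apply/ae_eq_integral_abs => //; first exact: measurable_vol_fst.
  by rewrite -[RHS]l0; apply: eq_integral => p _; rewrite gee0_abs.
rewrite -leNgt -N0 /pushforward; apply: le_measure; rewrite ?inE//.
  rewrite -[X in measurable X]setTI; apply: measurable_fst => //.
  exact: measurable_interior_nonempty.
move=> p /= /vol_interior_gt0 p0; apply: sN => /= /(_ I) pE.
by move: p0; apply/negP; rewrite -leNgt le_eqVlt; apply/orP; left; apply/eqP; exact: pE.
Qed.

Lemma mean_volume_lty :
  \int[Q]_p lebesgue_rV R d (minkowski_sum p.1 (euclidean_ball 1%R)) < +oo ->
  mean_volume < +oo.
Proof.
apply: le_lt_trans; apply: integral_ge0_mono => p //.
exact: (vol_le_minkowski_ball p.1).
Qed.

End leaf_intensity_measure.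

(** * The mean of the dead leaves measure *)

Section almost_everywhere.
Context d (T : measurableType d) (R : realType) (mu : {measure set T -> \bar R}).

Lemma ae_eq_measure A B : measurable A -> measurable B ->
  {ae mu, forall x, A x <-> B x} -> mu A = mu B.
Proof.
move=> mA mB AB; rewrite -[A]setIT -[B]setIT -!integral_indic//.
apply: ae_eq_integral => //; try exact/measurable_EFinP/measurable_indic.
apply: filterS AB => x AB _ /=; rewrite !indicE; congr ((nat_of_bool _)%:R%:E).
by apply/idP/idP => /set_mem/AB/mem_set.
Qed.

Lemma ae_lty (f : T -> \bar R) : measurable_fun setT f -> (forall x, 0 <= f x) ->
  \int[mu]_x f x < +oo -> {ae mu, forall x, f x < +oo}.
Proof.
move=> mf f0 fi.
have intf : mu.-integrable setT f.
  apply/integrableP; split => //; apply: le_lt_trans fi.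
  by rewrite le_eqVlt; apply/orP; left; apply/eqP; apply: eq_integral => x _; rewrite gee0_abs.
by apply: filterS (integrable_ae measurableT intf) => x /(_ I); rewrite fin_numElt => /andP[].
Qed.

End almost_everywhere.

(** The Poisson process of leaves is described by its mean measure, its void
    probabilities and the distinctness of its times. These properties are easily
    checked for translated processes of leaves, to which the section is applied
    as well. *)
Section poisson_leaves.
Context (R : realType) (d : nat).
Local Notation V := 'rV[R]_d.
Local Notation C := (compact_sets R d).
Local Notation M := (lfmeasure R d).
Local Notation E := ((V * R) * (C * M))%type.
Local Notation cfg := (cfg E R).
Local Notation lf_cfg := (@lf_cfg _ _ R (@window R d)).
Variable Q : probability (C * M)%type R.
Context dW (W : measurableType dW) (P : probability W R).
Variable Y : W -> nat -> E.
Local Notation Lam := (leaf_intensity Q).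
Hypothesis mY : forall i, measurable_fun setT (fun w => Y w i).
Hypothesis Y_mean : forall F, measurable F ->
  \sum_(i <oo) P [set w | F (Y w i)] = Lam F.
Hypothesis Y_missing : forall F, measurable F ->
  P (Y @^-1` missing F) = expeR (- Lam F).
Hypothesis Y_distinct_times : P.-negligible [set w | ~ injective (fun i => (Y w i).1.2)].

Lemma measurable_time : measurable_fun setT (fun e : E => e.1.2).
Proof. by apply: (measurableT_comp measurable_snd); exact: measurable_fst. Qed.

Let mYc : measurable_fun setT (Y : W -> cfg).
Proof. exact: measurable_to_cfg. Qed.

Let Y_void_indep (F G : set E) : measurable F -> measurable G -> F `&` G = set0 ->
  P (Y @^-1` missing (F `|` G)) = P (Y @^-1` missing F) * P (Y @^-1` missing G).
Proof.
move=> mF mG FG; rewrite !Y_missing//; last exact: measurableU.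
by rewrite measureU// oppeD ?expeRD// ge0_adde_def// inE.
Qed.

Lemma lf_cfg_ae : {ae P, forall w, lf_cfg (Y w)}.
Proof.
apply: ae_foralln => n; apply: ae_lty => //.
  apply: (measurableT_comp (measurable_npts_cfg (@measurable_window R d n))).
  exact: mYc.
rewrite mean_npts ?Y_mean ?leaf_intensity_window//; exact: measurable_window.
Qed.

Variable l : R.
Hypothesis l_gt0 : (0 < l)%R.
Hypothesis lE : mean_volume Q = l%:E.

Let muncov v s : measurable [set w | uncovered (v, s, (Y w : cfg))].
Proof.
have m : measurable_fun setT (fun w => (v, s, (Y w : cfg))).
  by apply: measurable_fun_pair => //; exact: measurable_cst.
by rewrite -[X in measurable X]setTI; apply: m => //; exact: measurable_uncovered.
Qed.

Lemma uncovered_probability v s : (0 <= s)%R ->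
  P [set w | uncovered (v, s, (Y w : cfg))] = (expR (- (l * s)))%:E.
Proof.
move=> s0; have mcov := @measurable_covering R d v s.
rewrite (_ : P _ = P (Y @^-1` missing (covering v s))).
  by rewrite Y_missing// leaf_intensity_covering// lE.
apply: ae_eq_measure => //.
  by apply: (measurable_preim_cfg (R := R)) => //; exact: measurable_missing.
apply: filterS lf_cfg_ae => w yl.
by rewrite /uncovered/= lf_nptsE// npts_eq0.
Qed.

Lemma lf_cfg_consq e (y : nat -> E) : lf_cfg y -> lf_cfg (consq e y).
Proof. by move=> yl n; rewrite npts_consq lte_add_pinfty// ltry. Qed.

(** A leaf does not hide itself: only strictly earlier leaves cover it. *)
Lemma leaf_mass_consq A e (y : nat -> E) : lf_cfg y ->
  leaf_mass A (consq e y : cfg, e) = leaf_mass A (y : cfg, e).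
Proof.
move=> yl; rewrite /leaf_mass /=; case: ifP => // _.
suff H v : uncovered (v, e.1.2, (consq e y : cfg)) <-> uncovered (v, e.1.2, (y : cfg)).
  apply: (congr1 (fun B : set V => e.2.2 B)).
  apply/seteqP; split => z [Az Uz].
    split; first exact: Az.
    exact: (H _).1.
  split; first exact: Az.
  exact: (H _).2.
rewrite /uncovered/= lf_nptsE ?lf_nptsE//; last exact: lf_cfg_consq.
rewrite npts_consq memNset ?add0e// /covering/= ltxx andbF.
by case.
Qed.

(** By Tonelli, every point of the leaf is visible with probability
    [exp (- l t)]. *)
Lemma mean_leaf_mass A e : measurable A ->
  \int[P]_w leaf_mass A (consq e (Y w) : cfg, e) =
  (if (0 <= e.1.2)%R then expR (- (l * e.1.2)) else 0)%:E *
  e.2.2 [set z | A (z + e.1.1)%R].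
Proof.
move=> mA.
have mpair f : measurable_fun setT (f : W -> cfg) ->
    measurable_fun setT (fun w => leaf_mass A (f w, e)).
  move=> mf; apply: (measurableT_comp (measurable_leaf_mass mA)).
  by apply: measurable_fun_pair => //; exact: measurable_cst.
transitivity (\int[P]_w leaf_mass A (Y w : cfg, e)).
  apply: ge0_ae_eq_integral => //.
  - apply: mpair; apply: measurable_to_cfg; case=> [|i] /=; first exact: measurable_cst.
    exact: mY.
  - exact: mpair.
  - by move=> w _; exact: leaf_mass_ge0.
  - by move=> w _; exact: leaf_mass_ge0.
  by apply: filterS lf_cfg_ae => w yl _; exact: leaf_mass_consq.
rewrite /leaf_mass /=; case: ifPn => [t0|_]; last first.
  by rewrite mul0e; apply: integral0_eq.
set t := e.1.2 in t0 *; set x := e.1.1.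
have sfM : sigma_finite setT (e.2.2 : {measure set V -> \bar R}).
  exists (@cube R d); first exact/esym/cube_cover.
  by move=> n; split; [|apply: lfm_finite; [|exact: cube_bounded]]; exact: measurable_cube.
pose m := pack_sigma_finite sfM.
pose B := [set u : W * V | A (u.2 + x)%R /\ uncovered ((u.2 + x)%R, t, (Y u.1 : cfg))].
have mx : measurable_fun setT (fun u : W * V => (u.2 + x)%R).
  by apply: (measurableT_comp (measurable_addl x)); exact: measurable_snd.
have mB : measurable B.
  apply: measurableI; rewrite -[X in measurable X]setTI; first exact: mx.
  have mU : measurable_fun setT (fun u : W * V => ((u.2 + x)%R, t, (Y u.1 : cfg))).
    apply: measurable_fun_pair.
      by apply: measurable_fun_pair => //; exact: measurable_cst.
    by apply: (measurableT_comp mYc); exact: measurable_fst.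
  by apply: mU => //; exact: measurable_uncovered.
have mAx : measurable [set z : V | A (z + x)%R].
  by rewrite -[X in measurable X]setTI; exact: measurable_addl.
transitivity ((P \x m) B).
  apply: eq_integral => w _; congr (e.2.2 _); apply/seteqP.
  by split => z; rewrite /= /xsection/= inE.
rewrite product_measure1_ysection//.
transitivity (\int[m]_z ((expR (- (l * t)))%:E * (\1_[set z : V | A (z + x)%R] z)%:E)).
  apply: eq_integral => z _; rewrite indicE.
  case: (pselect (A (z + x)%R)) => Az.
    rewrite mem_set// mule1 -(uncovered_probability (z + x)%R t0); congr (P _).
    apply/seteqP; split => w; rewrite /ysection/= inE; first by case.
    by [].
  rewrite memNset// mule0 (_ : ysection B z = set0) ?measure0//.
  by apply/seteqP; split => // w; rewrite /ysection/= inE => -[].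
rewrite ge0_integralZl//; first by rewrite integral_indic// setIT.
exact/measurable_EFinP/measurable_indic.
Qed.

Lemma measurable_shifted_mass (A : set V) : measurable A ->
  measurable_fun setT (fun u : V * M => u.2 [set z | A (z + u.1)%R]).
Proof.
move=> mA.
have mB : measurable [set u : V * M * V | A (u.2 + u.1.1)%R].
  rewrite -[X in measurable X]setTI; apply: (measurable_fun_rVD _ _ measurableT mA).
    exact: measurable_snd.
  by apply: (measurableT_comp measurable_fst); exact: measurable_fst.
rewrite [X in measurable_fun _ X](_ : _ = fun u : V * M =>
    (u.2 : {measure set V -> \bar R}) (xsection [set u : V * M * V | A (u.2 + u.1.1)%R] u)).
  apply: (measurable_xsection_exhausted (k := fun u : V * M => u.2 : {measure set V -> \bar R})
    _ (@measurable_cube R d) (@subset_cube R d) (@cube_cover R d)) => //.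
  - move=> B mBB; apply: (measurableT_comp (measurable_lfm_eval mBB)); exact: measurable_snd.
  - by move=> u n; apply: lfm_finite; [exact: measurable_cube|exact: cube_bounded].
apply/funext => u; congr (u.2 _); apply/seteqP.
by split => z; rewrite /xsection/= inE.
Qed.

(** Integrate over the place first, which gives [M(V) * volume of A], then over the
    time, which gives [1 / l], and finally over the mark. *)
Lemma leaf_intensity_visible_mass (A : set V) : measurable A ->
  \int[Lam]_e ((if (0 <= e.1.2)%R then expR (- (l * e.1.2)) else 0)%:E *
    e.2.2 [set z | A (z + e.1.1)%R]) =
  (l^-1)%:E * (\int[Q]_p p.2 setT) * lebV R d A.
Proof.
move=> mA.
pose g (t : R) := (if (0 <= t)%R then expR (- (l * t)) else 0)%:E.
have g0 t : 0 <= g t by rewrite /g; case: ifP => _; rewrite lee_fin// expR_ge0.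
have mg : measurable_fun setT g.
  apply/measurable_EFinP; apply: measurable_fun_ifT => //.
    by apply: measurable_fun_ler => //.
  apply: measurableT_comp; first exact: measurable_expR.
  apply: measurableT_comp => //; exact: measurable_funM.
have mS := measurable_shifted_mass mA.
have mh : measurable_fun setT (fun e : E => g e.1.2 * e.2.2 [set z | A (z + e.1.1)%R]).
  apply: emeasurable_funM; first exact: (measurableT_comp mg measurable_time).
  have mp : measurable_fun setT (fun e : E => (e.1.1, e.2.2)).
    apply: measurable_fun_pair.
      by apply: (measurableT_comp measurable_fst); exact: measurable_fst.
    by apply: (measurableT_comp measurable_snd); exact: measurable_snd.
  exact: (measurableT_comp mS mp).
have mM : measurable_fun setT (fun p : C * M => p.2 setT).
  by apply: (measurableT_comp (measurable_lfm_eval measurableT)); exact: measurable_snd.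
have sfM (mu : M) : sigma_finite setT (mu : {measure set V -> \bar R}).
  exists (@cube R d); first exact/esym/cube_cover.
  by move=> n; split; [|apply: lfm_finite; [|exact: cube_bounded]]; exact: measurable_cube.
rewrite integral_pack_sigma_finite.
apply: (etrans (fubini_tonelli2 _ mh _)).
  by move=> e; rewrite mule_ge0.
transitivity (\int[Q]_p ((l^-1)%:E * (p.2 setT * lebV R d A))).
  apply: eq_integral => p _; rewrite /fubini_G.
  have mhp : measurable_fun setT (fun u : V * R => g u.2 * p.2 [set z | A (z + u.1)%R]).
    exact: (measurableT_comp mh (measurable_pair2 p)).
  rewrite integral_pack_sigma_finite.
  apply: (etrans (fubini_tonelli2 _ mhp _)).
    by move=> u; rewrite mule_ge0.
  rewrite /fubini_G -(integral_exp_decay l_gt0) -ge0_integralZr//; last 2 first.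
  - by move=> t _; exact: g0.
  - exact: mule_ge0.
  apply: eq_integral => t _ /=.
  rewrite ge0_integralZl//; last exact: (measurableT_comp mS (measurable_pair2 p.2)).
  by congr (_ * _); apply: (integral_shifted_mass (pack_sigma_finite (sfM p.2)) mA).
rewrite -muleA -ge0_integralZr// -ge0_integralZl//; last first.
- by rewrite lee_fin invr_ge0 ltW.
- by move=> p _; exact: mule_ge0.
- by apply: emeasurable_funM => //; exact: measurable_cst.
Qed.

Lemma mean_leaves A : measurable A ->
  \int[P]_w \sum_(i <oo) leaf_mass A (Y w : cfg, Y w i) =
  (l^-1)%:E * (\int[Q]_p p.2 setT) * lebV R d A.
Proof.
move=> mA.
have mf : measurable_fun setT (fun z : E * cfg => leaf_mass A (z.2, z.1)).
  apply: (measurableT_comp (measurable_leaf_mass mA)).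
  by apply: measurable_fun_pair; [exact: measurable_snd|exact: measurable_fst].
rewrite integral_nneseries//; last 2 first.
- move=> i; apply: (measurableT_comp (measurable_leaf_mass mA)).
  by apply: measurable_fun_pair; [exact: mYc|exact: mY].
- by move=> i w _; exact: leaf_mass_ge0.
have := mecke measurable_time _ mY Y_distinct_times Y_mean Y_void_indep mf.
move=> /(_ (leaf_intensity_time Q) (fun z => leaf_mass_ge0 A _))/= ->.
rewrite -leaf_intensity_visible_mass//.
by apply: eq_integral => e _; exact: mean_leaf_mass.
Qed.

Lemma dl_leaves (y : nat -> E) A : lf_cfg y -> measurable A ->
  dead_leaves_of y A = \sum_(i <oo) leaf_mass A (y : cfg, y i).
Proof.
move=> yl mA; rewrite (dead_leaves_ofE yl mA) integral_lf_npts//.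
- by apply: (measurableT_comp (measurable_leaf_mass mA)); exact: measurable_pair1.
- by move=> e; exact: leaf_mass_ge0.
Qed.

Hypothesis Q_mass : \int[Q]_p p.2 setT < +oo.

(** Finite means on all cubes. *)
Lemma good_ae : {ae P, forall w, good (Y w)}.
Proof.
suff H : {ae P, forall w, forall n, \sum_(i <oo) leaf_mass (@cube R d n) (Y w : cfg, Y w i) < +oo}.
  apply: filterS2 lf_cfg_ae H => w yl H; split => // n.
  by rewrite dl_leaves//; exact: measurable_cube.
apply: ae_foralln => n; have mc := @measurable_cube R d n.
apply: ae_lty.
- apply: ge0_emeasurable_sum => [i w _ _|i _]; first exact: leaf_mass_ge0.
  apply: (measurableT_comp (measurable_leaf_mass mc)).
  by apply: measurable_fun_pair; [exact: mYc|exact: mY].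
- by move=> w; apply: nneseries_ge0 => i _ _; exact: leaf_mass_ge0.
rewrite mean_leaves// lte_mul_pinfty//.
- by rewrite mule_ge0// ?integral_ge0// lee_fin invr_ge0 ltW.
- rewrite fin_numM// ge0_fin_numE//; exact: integral_ge0.
- exact: lebesgue_rV_cube.
Qed.

Lemma measurable_leaf_process_comp : measurable_fun setT (fun w => leaf_process (Y w)).
Proof. exact: (measurableT_comp (@measurable_leaf_process R d) mYc). Qed.

Lemma mean_leaf_process A : measurable A ->
  \int[P]_w leaf_process (Y w) A = (l^-1)%:E * (\int[Q]_p p.2 setT) * lebV R d A.
Proof.
move=> mA; rewrite -mean_leaves//; apply: ge0_ae_eq_integral => //.
- exact: (measurableT_comp (measurable_lfm_eval mA) measurable_leaf_process_comp).
- apply: ge0_emeasurable_sum => [i w _ _|i _]; first exact: leaf_mass_ge0.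
  apply: (measurableT_comp (measurable_leaf_mass mA)).
  by apply: measurable_fun_pair; [exact: mYc|exact: mY].
- by move=> w _; apply: nneseries_ge0 => i _ _; exact: leaf_mass_ge0.
apply: filterS good_ae => w gy _; rewrite leaf_processE// dl_leaves//.
by case: gy.
Qed.

End poisson_leaves.

(** * Stationarity *)

Section shifted_leaves.
Context (R : realType) (d : nat).
Local Notation V := 'rV[R]_d.
Local Notation C := (compact_sets R d).
Local Notation M := (lfmeasure R d).
Local Notation E := ((V * R) * (C * M))%type.
Local Notation cfg := (cfg E R).

(** A measurable set of measures only sees their values on Borel sets. *)
Lemma lfm_borel_eq (U : set M) (mu nu : M) : measurable U ->
  (forall A, measurable A -> mu A = nu A) -> U mu <-> U nu.
Proof.
move=> mU mn; suff : (fun U : set M => U mu <-> U nu) U by [].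
move: U mU; apply: smallest_sub.
  split => //.
  - by move=> U [H1 H2]; rewrite setTD; split => nU ?; apply: nU; [exact: H2|exact: H1].
  - by move=> F HF; split => -[i _ Fi]; exists i => //; apply/(HF i).
by move=> _ [A mA [B mB <-]]; rewrite setTI /preimage/= mn.
Qed.

Lemma measurable_lfm_shift x : measurable_fun setT (fun mu : M => lfm_shift mu x).
Proof.
apply: measurable_to_lfm => B mB.
exact: (measurable_lfm_eval (measurable_translate (- x)%R mB)).
Qed.

Definition shift_leaf (x : V) (e : E) : E := ((e.1.1 + x)%R, e.1.2, e.2).

Lemma measurable_shift_leaf x : measurable_fun setT (shift_leaf x).
Proof.
apply: measurable_fun_pair; last exact: measurable_snd.
apply: measurable_fun_pair; last exact: measurable_time.
apply: (measurableT_comp (measurable_addl x)).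
by apply: (measurableT_comp measurable_fst); exact: measurable_fst.
Qed.

Lemma measurable_shift_leaf_preimage x F : measurable F -> measurable (shift_leaf x @^-1` F).
Proof. by move=> mF; rewrite -[X in measurable X]setTI; exact: measurable_shift_leaf. Qed.

Lemma dl_shift x (y : nat -> E) A :
  dead_leaves_of (fun i => shift_leaf x (y i)) A = dead_leaves_of y (translate A (- x)%R).
Proof.
rewrite /dead_leaves_of /dead_leaves; apply: eq_eseriesr => i _.
rewrite /= /shift_measure; apply: (congr1 (fun B : set V => (y i).2.2 B)).
rewrite !translateE; apply/seteqP; split => z /=; rewrite !opprK => -[Az nz].
  split; first by rewrite -addrA.
  move=> [j tj]; rewrite translateE => Sj; apply: nz; exists j => //.
  rewrite translateE /= ; move: Sj => /=.
  by rewrite [(z + (_ + x))%R]addrA [((y j).1.1 + x)%R]addrC addrKA.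
split; first by rewrite addrA.
move=> [j tj]; rewrite translateE => Sj; apply: nz; exists j => //.
rewrite translateE /= ; move: Sj => /=.
by rewrite [(z + (_ + x))%R]addrA [((y j).1.1 + x)%R]addrC addrKA.
Qed.

Lemma leaf_process_shift x (y : cfg) A : good y -> good (fun i => shift_leaf x (y i) : E) ->
  lfm_shift (leaf_process y) x A = leaf_process (fun i => shift_leaf x (y i) : E) A.
Proof.
move=> gy gx; rewrite (leaf_processE _ gx) dl_shift /= /shift_measure.
exact: leaf_processE.
Qed.

Lemma leaf_intensity_shift (Q : probability (C * M)%type R) x F : measurable F ->
  leaf_intensity Q (shift_leaf x @^-1` F) = leaf_intensity Q F.
Proof.
move=> mF; have mF' := measurable_shift_leaf_preimage x mF.
rewrite (leaf_intensityE Q mF) (leaf_intensityE Q mF'); apply: eq_integral => p _.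
have mG := measurable_ysection p mF; have mG' := measurable_ysection p mF'.
apply: (etrans (product_measure1_ysection (lebV R d) (@lebR R) mG')).
apply: esym; apply: (etrans (product_measure1_ysection (lebV R d) (@lebR R) mG)).
apply: eq_integral => t _.
apply: (etrans (esym (lebesgue_rV_translate (- x)%R (measurable_ysection t mG)))).
apply: (congr1 (lebesgue_rV R d)); apply/seteqP; split => v; rewrite /ysection/= !inE/= !inE opprK//.
Qed.

End shifted_leaves.

Section stationary_leaves.
Context (R : realType) (d : nat).
Local Notation V := 'rV[R]_d.
Local Notation C := (compact_sets R d).
Local Notation M := (lfmeasure R d).
Local Notation E := ((V * R) * (C * M))%type.
Local Notation cfg := (cfg E R).
Variable Q : probability (C * M)%type R.
Context dW (W : measurableType dW) (P : probability W R).
Variable Y : W -> nat -> E.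
Local Notation Lam := (leaf_intensity Q).
Hypothesis mY : forall i, measurable_fun setT (fun w => Y w i).
Hypothesis Y_mean : forall F, measurable F ->
  \sum_(i <oo) P [set w | F (Y w i)] = Lam F.
Hypothesis Y_missing : forall F, measurable F ->
  P (Y @^-1` missing F) = expeR (- Lam F).
Hypothesis Y_distinct_times : P.-negligible [set w | ~ injective (fun i => (Y w i).1.2)].
Variable l : R.
Hypothesis l_gt0 : (0 < l)%R.
Hypothesis lE : mean_volume Q = l%:E.
Hypothesis Q_mass : \int[Q]_p p.2 setT < +oo.
Variable x : V.

Let Yx (w : W) (i : nat) : E := shift_leaf x (Y w i).

Let mYx i : measurable_fun setT (fun w => Yx w i).
Proof. exact: (measurableT_comp (measurable_shift_leaf x) (mY i)). Qed.

Let Yx_mean F : measurable F -> \sum_(i <oo) P [set w | F (Yx w i)] = Lam F.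
Proof.
move=> mF; rewrite -(leaf_intensity_shift Q x mF).
exact: (Y_mean (measurable_shift_leaf_preimage x mF)).
Qed.

Let Yx_missing F : measurable F -> P (Yx @^-1` missing F) = expeR (- Lam F).
Proof.
move=> mF; rewrite -(leaf_intensity_shift Q x mF).
exact: (Y_missing (measurable_shift_leaf_preimage x mF)).
Qed.

Let same_law (D : set cfg) : measurable D -> P (Yx @^-1` D) = P (Y @^-1` D).
Proof.
move=> mD.
apply: (@count_events_same _ _ R (fun e : E => e.1.2) _ _ _ _ P P Yx Y
  (@measurable_time R d) mYx mY Y_distinct_times Y_distinct_times setT _ _ D) => //.
  by rewrite (le_lt_trans (probability_le1 P _))// ltry.
by move=> B mB _; exact: (etrans (Yx_missing mB) (esym (Y_missing mB))).
Qed.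

(** Translating all leaves does not change the void probabilities, hence not the
    law of the configuration, and it translates the dead leaves measure. *)
Lemma leaf_process_stationary (U : set M) : measurable U ->
  P [set w | U (lfm_shift (leaf_process (Y w)) x)] = P [set w | U (leaf_process (Y w))].
Proof.
move=> mU.
have mproc := measurable_leaf_process_comp mY.
have mprocx := measurable_leaf_process_comp mYx.
have mUp (f : W -> M) : measurable_fun setT f -> measurable [set w | U (f w)].
  by move=> mf; rewrite -[X in measurable X]setTI; exact: mf.
transitivity (P [set w | U (leaf_process (Yx w))]); last first.
  apply: (same_law (D := [set y | U (leaf_process y)])).
  by rewrite -[X in measurable X]setTI; exact: (@measurable_leaf_process R d).
apply: ae_eq_measure; [| |].
- by apply: mUp; exact: (measurableT_comp (measurable_lfm_shift x) mproc).
- exact: mUp.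
have gY : {ae P, forall w, good (Y w)} by exact: (good_ae mY Y_mean Y_missing Y_distinct_times l_gt0 lE Q_mass).
have gYx : {ae P, forall w, good (Yx w)}.
  exact: (good_ae mYx Yx_mean Yx_missing Y_distinct_times l_gt0 lE Q_mass).
apply: filterS2 gY gYx => w gy gyx.
by apply: lfm_borel_eq => // A mA; exact: leaf_process_shift.
Qed.

End stationary_leaves.

(** * The theorem *)

Theorem theorem4p1 (R : realType) (d : nat)
  (Q' : probability (compact_sets R d * lfmeasure R d)%type R)
  (Qinterior : 0 < pushforward Q' fst
                     [set S : compact_sets R d | (cset S)° !=set0])
  (dW : measure_display) (W : measurableType dW) (P : probability W R)
  (X : nat -> {RV P >-> ('rV[R]_d * R)%type})
  (SM : nat -> {RV P >-> (compact_sets R d * lfmeasure R d)%type})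
  (X_poisson : poisson_process P (T := ('rV[R]_d * R)%type)
                 (lebesgue_rV R d \x (@lebesgue_measure R)) X)
  (SM_law : forall i U, measurable U -> distribution P (SM i) U = Q' U)
  (SM_independent : mutually_independent P (fun i => sigma_of (SM i)))
  (X_SM_independent : independent P (sigma_of_seq X) (sigma_of_seq SM))
  (M_integrable : \int[Q']_p p.2 setT < +oo)
  (S_integrable : \int[Q']_p
     lebesgue_rV R d (minkowski_sum p.1 (euclidean_ball 1%R)) < +oo) :
  let lambda := \int[Q']_p lebesgue_rV R d p.1 in
  let xi := fun w => dead_leaves (fun i => (X i w).1) (fun i => (X i w).2)
                                 (fun i => (SM i w).1) (fun i => (SM i w).2) in
  exists Xi : {RV P >-> lfmeasure R d},
    [/\ {ae P, forall w, forall A, measurable A -> Xi w A = xi w A},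
        stationary Xi
      & has_intensity Xi (lambda^-1 * \int[Q']_p p.2 setT)].
Proof.
move=> lambda xi.
have mX i : measurable_fun setT (X i) by exact: measurable_funP.
have mSM i : measurable_fun setT (SM i) by exact: measurable_funP.
have Xp : poisson_process P (T := ('rV[R]_d * R)%type) (space_time R d) (fun i => X i : W -> _).
  exact: X_poisson.
pose Y := marked (fun i => X i : W -> _) (fun i => SM i : W -> _).
have mY i : measurable_fun setT (fun w => Y w i) by exact: measurable_marked.
have Y_mean F : measurable F -> \sum_(i <oo) P [set w | F (Y w i)] = leaf_intensity Q' F.
  exact: (marked_mean mX mSM Xp SM_law SM_independent X_SM_independent).
have Y_missing F : measurable F -> P (Y @^-1` missing F) = expeR (- leaf_intensity Q' F).
  exact: (marked_missing mX mSM Xp SM_law SM_independent X_SM_independent).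
have Y_times : P.-negligible [set w | ~ injective (fun i => (Y w i).1.2)].
  exact: (distinct_times mX Xp).
pose l := fine lambda.
have lambda_gt0 : 0 < lambda := mean_volume_gt0 Qinterior.
have lE : lambda = l%:E.
  by rewrite /l fineK// ge0_fin_numE ?ltW//; exact: mean_volume_lty.
have l_gt0 : (0 < l)%R by rewrite -lte_fin -lE.
have mXi : measurable_fun setT (fun w => leaf_process (Y w)) := measurable_leaf_process_comp mY.
pose Xi : {RV P >-> lfmeasure R d} := mfun_Sub (mem_set mXi).
exists Xi; split.
- have := good_ae mY Y_mean Y_missing Y_times l_gt0 lE M_integrable.
  by apply: filterS => w gy A _; exact: leaf_processE.
- move=> x U mU.
  exact: (leaf_process_stationary mY Y_mean Y_missing Y_times l_gt0 lE M_integrable).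
- move=> B mB.
  rewrite lE inver gt_eqF//.
  exact: (mean_leaf_process mY Y_mean Y_missing Y_times l_gt0 lE M_integrable).
Qed.
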